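(* For all sufficiently large $N$, there are at least $N/(\log N)^2$ values of $n$ with $1\le n\le N$ such that $L(1/2,\chi^{4n-3})\neq 0$.
   Context: Let $\eta=\frac{1+\sqrt{-7}}{2}$ with $\sqrt{-7}=i\sqrt 7$; the ring of integers of $\mathbb{Q}(\sqrt{-7})$ is $\{a+b\eta: a,b\in\mathbb{Z}\}$, and $N(a+b\eta)=a^2+ab+2b^2$. For integers $a,b$ set $\epsilon_{a,b}=\left(\frac{a^3-2a^2b-ab^2+b^3}{7}\right)$ (Legendre symbol, equal to $0$ when $7$ divides the numerator). The Hecke Grössencharacter $\chi$ is defined on ideals by $\chi((a+b\eta))=\epsilon_{a,b}(a+b\eta)$ (so it is $0$ if $a+b\eta$ is not coprime to $\sqrt{-7}$). For each integer $n\ge 1$, $L(s,\chi^{4n-3})$ is the $L$-function (normalized so that its central point is $s=1/2$) defined for $\Re s>1$ by the absolutely convergent series $$L(s,\chi^{4n-3})=\frac12\sum_{(a,b)\in\mathbb{Z}^2\setminus\{(0,0)\}}\frac{\epsilon_{a,b}\,(a+b\eta)^{4n-3}}{(a^2+ab+2b^2)^{s+2n-3/2}},$$ and elsewhere by analytic continuation; it is entire, and $\left(\frac{7}{2\pi}\right)^s\Gamma(s+2n-3/2)L(s,\chi^{4n-3})$ is invariant under $s\mapsto 1-s$. *)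

(* Defs.v *)
From Stdlib Require Import Reals ZArith List Lia Lra.
From Coquelicot Require Import Coquelicot.
Import ListNotations.

(* The Legendre symbol (m / p), for p an odd prime. *)
Definition legendre (m p : Z) : Z :=
  if (m mod p =? 0)%Z then 0%Z
  else if existsb (fun x => (Z.of_nat x * Z.of_nat x) mod p =? m mod p)%Z
                  (List.seq 0 (Z.to_nat p))
  then 1%Z else (-1)%Z.

Definition eps (a b : Z) : Z :=
  legendre (a ^ 3 - 2 * a ^ 2 * b - a * b ^ 2 + b ^ 3) 7.

Definition eta : C := ((1 + Ci * sqrt 7) / 2)%C.

Definition qint (a b : Z) : C := (IZR a + IZR b * eta)%C.

Definition qnorm (a b : Z) : Z := (a ^ 2 + a * b + 2 * b ^ 2)%Z.

(* x ^ s := exp (s log x), with the real logarithm; meaningful for x > 0. *)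
Definition Rcpow (x : R) (s : C) : C :=
  (exp (Re s * ln x) * cos (Im s * ln x),
   exp (Re s * ln x) * sin (Im s * ln x))%R.

Definition list_sum_C {I : Type} (u : I -> C) (F : list I) : C :=
  fold_right (fun i z => (u i + z)%C) (RtoC 0) F.

(* The unordered sum of u over { i | P i } is S: convergence along the finite
   subsets, which for complex terms is the same as absolute convergence. *)
Definition is_unordered_sum {I : Type} (P : I -> Prop) (u : I -> C) (S : C)
  : Prop :=
  forall e : posreal, exists F0 : list I,
    (forall i, In i F0 -> P i) /\
    forall F : list I, NoDup F -> (forall i, In i F -> P i) -> incl F0 F ->
      (Cmod (list_sum_C u F - S)%C < e)%R.

(* As eps a b is 0, 1 or -1 and 4 n - 3 is odd (for n >= 1), the numerator is
   the (4 n - 3)-rd power of chi ((a + b eta)) = eps a b * (a + b eta). *)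
Definition L_term (n : nat) (s : C) (p : Z * Z) : C :=
  (IZR (eps (fst p) (snd p)) * qint (fst p) (snd p) ^ (4 * n - 3)
   / Rcpow (IZR (qnorm (fst p) (snd p))) (s + (2 * INR n - 3 / 2)%R))%C.

Definition entire (f : C -> C) : Prop :=
  forall s : C, @ex_derive C_AbsRing C_NormedModule f s.

(* f is the function s |-> L(s, chi ^ (4 n - 3)), for n >= 1.  By the identity
   theorem at most one f satisfies this. *)
Definition is_L_function (n : nat) (f : C -> C) : Prop :=
  entire f /\
  forall s : C, (1 < Re s)%R ->
    exists S : C,
      is_unordered_sum (fun p : Z * Z => p <> (0%Z, 0%Z)) (L_term n s) S /\
      f s = (/ 2 * S)%C.

(* L(1/2, chi ^ (4 n - 3)) <> 0; the existence of the analytic continuation is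
   part of the assertion. *)
Definition L_central_nonzero (n : nat) : Prop :=
  exists f : C -> C, is_L_function n f /\ f (RtoC (1 / 2)) <> RtoC 0.

(* Main.v *)
(* Put coef h = sum of eps(alpha) alpha^h / conj(alpha)^(h+1) over the nonzero
   alpha in Z[eta], so that L(1/2, chi^(4n-3)) = coef (2n-2) / 2.  As eps is a
   mean-zero function modulo sqrt(-7), K summations by parts gain a factor
   |alpha|^(-K); this gives a meaning to coef h, and the analytic continuation
   of the L-series to the whole plane.

   The generating function
     G(w) = sum_h coef h w^h = sum_alpha eps(alpha) / (conj(alpha) - w alpha)
   depends only on the lattice of the numbers conj(alpha) - w alpha, with its
   character.  Taking a reduced basis of this lattice shows that |G(w)| is at
   most a constant times 1/l, where l is the length of a shortest vector.
   Averaging over the circle |w| = 1 - 1/M, Parseval bounds the second moment: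
     sum_h |coef h|^2 (1 - 1/M)^(2h) = O(M log M).
   On the other hand G(r) is at least M and Re G(-r) is bounded below, for
   r = 1 - 1/M, so that the even coefficients have a first moment of order M.
   With M = N / sqrt(log N) the terms h > 2N are negligible, and the
   Cauchy-Schwarz inequality leaves at least c N / (log N)^(3/2) nonzero
   coefficients. *)

Require Import Defs.
From Stdlib Require Import Reals List.
From Stdlib Require Import ZArith Lia Lra Permutation.
From Stdlib Require Import ClassicalEpsilon FunctionalExtensionality.
From Coquelicot Require Import Coquelicot.
Import ListNotations.
Local Open Scope R_scope.

(** * Finite and unordered sums *)

(** Bounding G by 1/l meets one obstacle. If the character is nontrivial on the shortest vector, two
    differences along it make the sum absolutely convergent, uniformly over reduced lattices. If it
    is trivial there, such differences gain nothing, and cancellation of n against -n in the rows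
    parallel to that vector has to replace them. For the second moment, 1/l^2 is at most the sum of
    |conj(alpha) - w alpha|^(-2) over the nonzero alpha of a box that does not depend on the
    argument of w. For fixed alpha the average over the circle is a Poisson-kernel mean, O(M /
    |alpha|^2); summing over alpha produces the logarithm. For the first moment, the shortest vector
    at w = r comes from alpha = 1 and has length 1 - r; its row is near 2 L(1, chi7) > 0. At w = -r
    it comes from sqrt(-7), where the character is trivial. G(-r) may also have order M, but its
    leading term has nonnegative real part. The factor sqrt(log N) in the choice of M makes exp(-2
    sqrt(log N)) beat the logarithm in the tail. The exponent 3/2 < 2 leaves a factor sqrt(log N)
    that absorbs every constant. *)

Definition list_sum_R {I : Type} (u : I -> R) (F : list I) : R :=
  fold_right (fun i x => u i + x) 0 F.

Section FiniteSums.
Context {I J : Type}.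
Implicit Types (u v : I -> C) (F : list I).

Lemma list_sum_C_app u F F' :
  list_sum_C u (F ++ F') = (list_sum_C u F + list_sum_C u F')%C.
Proof. induction F as [|i F IH]; simpl; [|rewrite IH]; ring. Qed.

Lemma list_sum_C_ext u v F :
  (forall i, In i F -> u i = v i) -> list_sum_C u F = list_sum_C v F.
Proof.
induction F as [|i F IH]; simpl; intros H; [easy|].
rewrite H, IH; auto.
Qed.

Lemma list_sum_C_perm u F F' :
  Permutation F F' -> list_sum_C u F = list_sum_C u F'.
Proof.
induction 1 as [|x F F' _ IH|x y F|F F' F'' _ IH _ IH']; simpl.
- easy.
- now rewrite IH.
- ring.
- now rewrite IH.
Qed.

Lemma list_sum_C_plus u v F :
  list_sum_C (fun i => u i + v i)%C F = (list_sum_C u F + list_sum_C v F)%C.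
Proof. induction F as [|i F IH]; simpl; [|rewrite IH]; ring. Qed.

Lemma list_sum_C_minus u v F :
  list_sum_C (fun i => u i - v i)%C F = (list_sum_C u F - list_sum_C v F)%C.
Proof. induction F as [|i F IH]; simpl; [|rewrite IH]; ring. Qed.

Lemma list_sum_C_scal (c : C) u F :
  list_sum_C (fun i => c * u i)%C F = (c * list_sum_C u F)%C.
Proof. induction F as [|i F IH]; simpl; [|rewrite IH]; ring. Qed.

Lemma list_sum_C_0 F : list_sum_C (fun _ : I => RtoC 0) F = RtoC 0.
Proof. induction F as [|i F IH]; simpl; [|rewrite IH]; [easy|ring]. Qed.

Lemma list_sum_C_conj u F :
  Cconj (list_sum_C u F) = list_sum_C (fun i => Cconj (u i)) F.
Proof.
induction F as [|i F IH]; simpl.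
- unfold Cconj; simpl; now rewrite Ropp_0.
- now rewrite Cplus_conj, IH.
Qed.

Lemma list_sum_C_Re u F : Re (list_sum_C u F) = list_sum_R (fun i => Re (u i)) F.
Proof. induction F as [|i F IH]; simpl; [easy|now rewrite <- IH]. Qed.

Lemma list_sum_C_Im u F : Im (list_sum_C u F) = list_sum_R (fun i => Im (u i)) F.
Proof. induction F as [|i F IH]; simpl; [easy|now rewrite <- IH]. Qed.

Lemma list_sum_C_RtoC (u : I -> R) F :
  list_sum_C (fun i => RtoC (u i)) F = RtoC (list_sum_R u F).
Proof. induction F as [|i F IH]; simpl; [easy|now rewrite IH, RtoC_plus]. Qed.

Lemma Cmod_list_sum u F :
  Cmod (list_sum_C u F) <= list_sum_R (fun i => Cmod (u i)) F.
Proof.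
induction F as [|i F IH]; simpl.
- rewrite Cmod_0; lra.
- eapply Rle_trans; [apply Cmod_triangle|lra].
Qed.

Lemma list_sum_R_app (u : I -> R) F F' :
  list_sum_R u (F ++ F') = list_sum_R u F + list_sum_R u F'.
Proof. induction F as [|i F IH]; simpl; [|rewrite IH]; ring. Qed.

Lemma list_sum_R_ext (u v : I -> R) F :
  (forall i, In i F -> u i = v i) -> list_sum_R u F = list_sum_R v F.
Proof.
induction F as [|i F IH]; simpl; intros H; [easy|].
rewrite H, IH; auto.
Qed.

Lemma list_sum_R_le (u v : I -> R) F :
  (forall i, In i F -> u i <= v i) -> list_sum_R u F <= list_sum_R v F.
Proof.
induction F as [|i F IH]; simpl; intros H; [lra|].
apply Rplus_le_compat; auto.
Qed.

Lemma list_sum_R_pos (u : I -> R) F :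
  (forall i, In i F -> 0 <= u i) -> 0 <= list_sum_R u F.
Proof.
induction F as [|i F IH]; simpl; intros H; [lra|].
apply Rplus_le_le_0_compat; auto.
Qed.

Lemma list_sum_R_plus (u v : I -> R) F :
  list_sum_R (fun i => u i + v i) F = list_sum_R u F + list_sum_R v F.
Proof. induction F as [|i F IH]; simpl; [|rewrite IH]; ring. Qed.

Lemma list_sum_R_scal (c : R) (u : I -> R) F :
  list_sum_R (fun i => c * u i) F = c * list_sum_R u F.
Proof. induction F as [|i F IH]; simpl; [|rewrite IH]; ring. Qed.

Lemma list_sum_R_const (c : R) F :
  list_sum_R (fun _ => c) F = c * INR (length F).
Proof.
induction F as [|i F IH]; [simpl; ring|].
change (length (i :: F)) with (S (length F)); rewrite S_INR; simpl; rewrite IH; ring.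
Qed.

Lemma list_sum_R_perm (u : I -> R) F F' :
  Permutation F F' -> list_sum_R u F = list_sum_R u F'.
Proof.
induction 1 as [|x F F' _ IH|x y F|F F' F'' _ IH _ IH']; simpl.
- easy.
- now rewrite IH.
- ring.
- now rewrite IH.
Qed.


Lemma NoDup_incl_split F0 : forall F,
  NoDup F0 -> incl F0 F -> exists F1, Permutation F (F0 ++ F1).
Proof.
induction F0 as [|i F0 IH]; intros F H0 Hi; [now exists F|].
inversion H0 as [|? ? Hni H0']; subst.
destruct (in_split i F) as (A & B & ->); [apply Hi; now left|].
destruct (IH (A ++ B)) as (F1 & HF1); auto.
- intros j Hj. assert (Hj' := Hi j (or_intror Hj)).
  apply in_app_or in Hj'. apply in_or_app. destruct Hj' as [|[->|]]; auto. easy.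
- exists F1. simpl. rewrite <- HF1. symmetry. apply Permutation_middle.
Qed.

Lemma list_sum_R_incl (u : I -> R) F0 F :
  (forall i, 0 <= u i) -> NoDup F0 -> incl F0 F ->
  list_sum_R u F0 <= list_sum_R u F.
Proof.
intros Hu H0 Hi.
destruct (NoDup_incl_split F0 F H0 Hi) as (F1 & HF1).
rewrite (list_sum_R_perm u _ _ HF1), list_sum_R_app.
assert (H1 := list_sum_R_pos u F1 (fun i _ => Hu i)); lra.
Qed.

Lemma list_sum_C_map (f : J -> I) u (G : list J) :
  list_sum_C u (map f G) = list_sum_C (fun j => u (f j)) G.
Proof. induction G as [|j G IH]; simpl; [easy|now rewrite IH]. Qed.

Lemma list_sum_R_map (f : J -> I) (u : I -> R) (G : list J) :
  list_sum_R u (map f G) = list_sum_R (fun j => u (f j)) G.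
Proof. induction G as [|j G IH]; simpl; [easy|now rewrite IH]. Qed.
End FiniteSums.

Lemma list_sum_C_exchange {I J : Type} (u : I -> J -> C) F G :
  list_sum_C (fun i => list_sum_C (u i) G) F
  = list_sum_C (fun j => list_sum_C (fun i => u i j) F) G.
Proof.
induction F as [|i F IH]; simpl; [now rewrite list_sum_C_0|].
now rewrite IH, list_sum_C_plus.
Qed.

Lemma list_sum_R_exchange {I J : Type} (u : I -> J -> R) F G :
  list_sum_R (fun i => list_sum_R (u i) G) F
  = list_sum_R (fun j => list_sum_R (fun i => u i j) F) G.
Proof.
induction F as [|i F IH]; simpl.
- rewrite list_sum_R_const; ring.
- now rewrite IH, list_sum_R_plus.
Qed.

Lemma list_sum_C_prod {I J : Type} (u : I * J -> C) F G :
  list_sum_C u (list_prod F G) = list_sum_C (fun i => list_sum_C (fun j => u (i, j)) G) F.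
Proof.
induction F as [|i F IH]; simpl; [easy|].
now rewrite list_sum_C_app, IH, list_sum_C_map.
Qed.

Lemma list_sum_R_prod {I J : Type} (u : I * J -> R) F G :
  list_sum_R u (list_prod F G) = list_sum_R (fun i => list_sum_R (fun j => u (i, j)) G) F.
Proof.
induction F as [|i F IH]; simpl; [easy|].
now rewrite list_sum_R_app, IH, list_sum_R_map.
Qed.

Lemma list_sum_R_Cauchy_Schwarz {I : Type} (u v : I -> R) F :
  list_sum_R (fun i => u i * v i) F ^ 2
  <= list_sum_R (fun i => u i ^ 2) F * list_sum_R (fun i => v i ^ 2) F.
Proof.
induction F as [|i F IH]; simpl; [lra|].
set (a := u i) in *; set (b := v i) in *.
assert (HA : 0 <= list_sum_R (fun i => u i ^ 2) F)
  by (apply list_sum_R_pos; intros; apply pow2_ge_0).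
assert (HB : 0 <= list_sum_R (fun i => v i ^ 2) F)
  by (apply list_sum_R_pos; intros; apply pow2_ge_0).
simpl in HA, HB, IH.
set (A := list_sum_R (fun i => u i * (u i * 1)) F) in *.
set (B := list_sum_R (fun i => v i * (v i * 1)) F) in *.
set (D := list_sum_R (fun i => u i * v i) F) in *.
(* By the induction hypothesis the square of [a * b * D] is at most the product of the two terms on
   the right, and AM-GM applies. *)
assert (2 * (a * b * D) <= a ^ 2 * B + b ^ 2 * A).
{ assert (Hs : (a * b * D) ^ 2 <= (a ^ 2 * B) * (b ^ 2 * A)).
  { replace ((a * b * D) ^ 2) with ((a * b) ^ 2 * (D * (D * 1))) by ring.
    replace ((a ^ 2 * B) * (b ^ 2 * A)) with ((a * b) ^ 2 * (A * B)) by ring.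
    apply Rmult_le_compat_l; [apply pow2_ge_0|lra]. }
  assert (0 <= a ^ 2 * B) by (apply Rmult_le_pos; [apply pow2_ge_0|easy]).
  assert (0 <= b ^ 2 * A) by (apply Rmult_le_pos; [apply pow2_ge_0|easy]).
  destruct (Rle_dec (a * b * D) 0); [lra|].
  apply Rsqr_incr_0_var; [unfold Rsqr|lra].
  pose proof (pow2_ge_0 (a ^ 2 * B - b ^ 2 * A)). nra. }
nra.
Qed.

Section UnorderedSums.
Context {I : Type}.
Implicit Types (u v : I -> C) (F : list I).

Definition has_sum u (S : C) : Prop := is_unordered_sum (fun _ => True) u S.

Definition summable u : Prop :=
  exists B, forall F, NoDup F -> list_sum_R (fun i => Cmod (u i)) F <= B.

Definition usum u : C := epsilon (inhabits (RtoC 0)) (has_sum u).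

Let dec : forall i j : I, {i = j} + {i <> j} :=
  fun i j => excluded_middle_informative (i = j).

Lemma has_sumP u S :
  has_sum u S <-> forall e, 0 < e -> exists F0,
    forall F, NoDup F -> incl F0 F -> Cmod (list_sum_C u F - S) < e.
Proof.
split.
- intros H e He. destruct (H (mkposreal e He)) as (F0 & _ & HF0).
  exists F0; intros F HF Hi. now apply HF0.
- intros H [e He]. destruct (H e He) as (F0 & HF0).
  exists F0; split; [easy|]. intros F HF _ Hi. now apply HF0.
Qed.

Lemma has_sum_unique u S T : has_sum u S -> has_sum u T -> S = T.
Proof.
rewrite !has_sumP; intros HS HT.
apply Ceq_minus, Cmod_eq_0.
destruct (Rle_lt_or_eq_dec 0 _ (Cmod_ge_0 (S - T))) as [H|H]; [exfalso|now rewrite <- H].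
destruct (HS (Cmod (S - T) / 2)) as (F1 & H1); [lra|].
destruct (HT (Cmod (S - T) / 2)) as (F2 & H2); [lra|].
set (F := nodup dec (F1 ++ F2)).
assert (HF : NoDup F) by apply NoDup_nodup.
specialize (H1 F HF). specialize (H2 F HF).
assert (incl F1 F) by (intros i Hi; apply nodup_In, in_or_app; auto).
assert (incl F2 F) by (intros i Hi; apply nodup_In, in_or_app; auto).
specialize (H1 ltac:(easy)). specialize (H2 ltac:(easy)).
assert (Hm := Cmod_triangle (list_sum_C u F - T) (- (list_sum_C u F - S))).
rewrite Cmod_opp in Hm.
replace (list_sum_C u F - T + - (list_sum_C u F - S))%C with (S - T)%C in Hm by ring.
lra.
Qed.

Lemma usum_eq u S : has_sum u S -> usum u = S.
Proof.
intros H. apply (has_sum_unique u); [|easy].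
unfold usum; apply epsilon_spec; now exists S.
Qed.

Lemma has_sum_plus u v S T :
  has_sum u S -> has_sum v T -> has_sum (fun i => u i + v i)%C (S + T)%C.
Proof.
rewrite !has_sumP; intros HS HT e He.
destruct (HS (e / 2)) as (F1 & H1); [lra|].
destruct (HT (e / 2)) as (F2 & H2); [lra|].
exists (F1 ++ F2); intros F HF Hi.
apply incl_app_inv in Hi as [Hi1 Hi2].
rewrite list_sum_C_plus.
replace (list_sum_C u F + list_sum_C v F - (S + T))%C
  with ((list_sum_C u F - S) + (list_sum_C v F - T))%C by ring.
eapply Rle_lt_trans; [apply Cmod_triangle|].
specialize (H1 F HF Hi1); specialize (H2 F HF Hi2); lra.
Qed.

Lemma has_sum_scal c u S : has_sum u S -> has_sum (fun i => c * u i)%C (c * S)%C.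
Proof.
rewrite !has_sumP; intros HS e He.
assert (0 < Cmod c + 1) by (pose proof (Cmod_ge_0 c); lra).
destruct (HS (e / (Cmod c + 1))) as (F1 & H1); [now apply Rdiv_lt_0_compat|].
exists F1; intros F HF Hi.
rewrite list_sum_C_scal.
replace (c * list_sum_C u F - c * S)%C with (c * (list_sum_C u F - S))%C by ring.
rewrite Cmod_mult. specialize (H1 F HF Hi).
apply Rle_lt_trans with (Cmod c * (e / (Cmod c + 1))).
- apply Rmult_le_compat_l; [apply Cmod_ge_0|lra].
- unfold Rdiv; rewrite Rmult_comm, Rmult_assoc.
  rewrite <- (Rmult_1_r e) at 2. apply Rmult_lt_compat_l; [easy|].
  apply (Rmult_lt_reg_l (Cmod c + 1)); [easy|]. field_simplify; lra.
Qed.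

Lemma has_sum_ext u v S : (forall i, u i = v i) -> has_sum u S -> has_sum v S.
Proof.
intros E; rewrite !has_sumP; intros HS e He.
destruct (HS e He) as (F0 & H0); exists F0; intros F HF Hi.
rewrite <- (list_sum_C_ext u v); auto.
Qed.

Lemma has_sum_minus u v S T :
  has_sum u S -> has_sum v T -> has_sum (fun i => u i - v i)%C (S - T)%C.
Proof.
intros HS HT.
replace (S - T)%C with (S + (-1) * T)%C by ring.
apply has_sum_ext with (fun i => u i + (-1) * v i)%C; [intros; ring|].
now apply has_sum_plus, has_sum_scal.
Qed.

Lemma has_sum_Cmod_le u S B :
  has_sum u S -> (forall F, NoDup F -> list_sum_R (fun i => Cmod (u i)) F <= B) ->
  Cmod S <= B.
Proof.
rewrite has_sumP; intros HS HB.
apply le_epsilon; intros e He.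
destruct (HS e He) as (F0 & H0).
specialize (H0 (nodup dec F0) (NoDup_nodup _ _) (fun i => proj2 (nodup_In dec F0 i))).
specialize (HB _ (NoDup_nodup dec F0)).
pose proof (Cmod_list_sum u (nodup dec F0)).
pose proof (Cmod_triangle (list_sum_C u (nodup dec F0)) (- (list_sum_C u (nodup dec F0) - S))).
rewrite Cmod_opp in H1.
replace (list_sum_C u (nodup dec F0) + - (list_sum_C u (nodup dec F0) - S))%C with S in H1 by ring.
lra.
Qed.

Lemma summable_le u v c :
  summable u -> (forall i, Cmod (v i) <= c * Cmod (u i)) -> summable v.
Proof.
intros (B & HB) H. exists (Rabs c * B); intros F HF.
eapply Rle_trans; [|apply Rmult_le_compat_l; [apply Rabs_pos|exact (HB F HF)]].
rewrite <- list_sum_R_scal. apply list_sum_R_le; intros i _.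
eapply Rle_trans; [apply H|]. apply Rmult_le_compat_r; [apply Cmod_ge_0|apply Rle_abs].
Qed.

Lemma summable_ext u v : (forall i, u i = v i) -> summable u -> summable v.
Proof. intros E H; apply (summable_le u v 1 H); intros i; rewrite E; lra. Qed.

Lemma summable_plus u v : summable u -> summable v -> summable (fun i => u i + v i)%C.
Proof.
intros (B & HB) (B' & HB'). exists (B + B'); intros F HF.
apply Rle_trans with (list_sum_R (fun i => Cmod (u i) + Cmod (v i)) F).
- apply list_sum_R_le; intros; apply Cmod_triangle.
- rewrite list_sum_R_plus. specialize (HB F HF); specialize (HB' F HF); lra.
Qed.

Lemma summable_scal c u : summable u -> summable (fun i => c * u i)%C.
Proof. intros H; apply (summable_le u _ (Cmod c) H); intros; rewrite Cmod_mult; lra. Qed.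

Lemma summable_minus u v : summable u -> summable v -> summable (fun i => u i - v i)%C.
Proof.
intros H H'. apply summable_ext with (fun i => u i + (-1) * v i)%C; [intros; ring|].
now apply summable_plus, summable_scal.
Qed.

(** The sum is the supremum of the finite partial sums, which increase with the finite set. *)
Lemma has_sum_pos (u : I -> R) B :
  (forall i, 0 <= u i) -> (forall F, NoDup F -> list_sum_R u F <= B) ->
  exists S, has_sum (fun i => RtoC (u i)) S.
Proof.
intros Hu HB.
destruct (completeness (fun x => exists F, NoDup F /\ x = list_sum_R u F)) as (S & Hub & Hlub).
- exists B; intros x (F & HF & ->); auto.
- exists 0, []; split; [constructor|easy].
- exists (RtoC S); apply has_sumP; intros e He.
  destruct (excluded_middle_informative (exists F, NoDup F /\ S - e < list_sum_R u F))
    as [(F0 & HF0 & H0)|Hn].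
  + exists F0; intros F HF Hi.
    rewrite list_sum_C_RtoC, <- RtoC_minus, Cmod_R.
    pose proof (list_sum_R_incl u F0 F Hu HF0 Hi).
    assert (list_sum_R u F <= S) by (apply Hub; now exists F).
    apply Rabs_def1; lra.
  + exfalso. assert (S <= S - e); [|lra].
    apply Hlub; intros x (F & HF & ->). apply Rnot_lt_le; intros H. apply Hn; now exists F.
Qed.

(** Here u = (|u| + u) - |u| is a difference of two nonnegative families. *)
Lemma has_sum_real (u : I -> R) B :
  (forall F, NoDup F -> list_sum_R (fun i => Rabs (u i)) F <= B) ->
  exists S, has_sum (fun i => RtoC (u i)) S.
Proof.
intros HB.
destruct (has_sum_pos (fun i => Rabs (u i) + u i) (2 * B)) as (S & HS).
- intros i; pose proof (Rle_abs (- u i)); rewrite Rabs_Ropp in H; lra.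
- intros F HF.
  apply Rle_trans with (list_sum_R (fun i => 2 * Rabs (u i)) F).
  + apply list_sum_R_le; intros i _; pose proof (Rle_abs (u i)); lra.
  + rewrite list_sum_R_scal; specialize (HB F HF); lra.
- destruct (has_sum_pos (fun i => Rabs (u i)) B) as (T & HT); auto.
  { intros; apply Rabs_pos. }
  exists (S - T)%C. eapply has_sum_ext; [|exact (has_sum_minus _ _ _ _ HS HT)].
  intros i; cbv beta. rewrite <- RtoC_minus. f_equal; ring.
Qed.

Lemma summable_has_sum u : summable u -> has_sum u (usum u).
Proof.
intros (B & HB). unfold usum; apply epsilon_spec.
destruct (has_sum_real (fun i => Re (u i)) B) as (S & HS).
{ intros F HF; eapply Rle_trans; [|now apply (HB F)].
  apply list_sum_R_le; intros; apply re_le_Cmod. }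
destruct (has_sum_real (fun i => Im (u i)) B) as (T & HT).
{ intros F HF; eapply Rle_trans; [|now apply (HB F)].
  apply list_sum_R_le; intros i _. pose proof (Rmax_Cmod (u i)).
  eapply Rle_trans; [apply Rmax_r|exact H]. }
exists (S + Ci * T)%C.
eapply has_sum_ext; [|exact (has_sum_plus _ _ _ _ HS (has_sum_scal Ci _ _ HT))].
intros i; cbv beta. destruct (u i) as (a, b); unfold RtoC, Ci, Cmult, Cplus; simpl.
f_equal; ring.
Qed.

Lemma usum_plus u v : summable u -> summable v ->
  usum (fun i => u i + v i)%C = (usum u + usum v)%C.
Proof. intros; apply usum_eq, has_sum_plus; now apply summable_has_sum. Qed.

Lemma usum_minus u v : summable u -> summable v ->
  usum (fun i => u i - v i)%C = (usum u - usum v)%C.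
Proof. intros; apply usum_eq, has_sum_minus; now apply summable_has_sum. Qed.

Lemma usum_scal c u : summable u -> usum (fun i => c * u i)%C = (c * usum u)%C.
Proof. intros; apply usum_eq, has_sum_scal; now apply summable_has_sum. Qed.

Lemma usum_ext u v : summable u -> (forall i, u i = v i) -> usum u = usum v.
Proof.
intros H E; symmetry; apply usum_eq, (has_sum_ext u); [easy|now apply summable_has_sum].
Qed.

Lemma usum_Cmod_le u B :
  (forall F, NoDup F -> list_sum_R (fun i => Cmod (u i)) F <= B) -> Cmod (usum u) <= B.
Proof.
intros HB. apply (has_sum_Cmod_le u); [|easy]. apply summable_has_sum; now exists B.
Qed.

End UnorderedSums.

Lemma has_sum_reindex {I J : Type} (f : J -> I) (g : I -> J) (u : I -> C) S :
  (forall i, f (g i) = i) -> (forall j, g (f j) = j) ->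
  has_sum u S -> has_sum (fun j => u (f j)) S.
Proof.
intros fg gf; rewrite !has_sumP; intros H e He.
destruct (H e He) as (F0 & H0). exists (map g F0); intros F HF Hi.
rewrite <- list_sum_C_map. apply H0.
- apply FinFun.Injective_map_NoDup; [|easy]. intros x y E. now rewrite <- (gf x), E, gf.
- intros i Hi'. rewrite <- (fg i). apply in_map, Hi, in_map, Hi'.
Qed.

Lemma summable_reindex {I J : Type} (f : J -> I) (g : I -> J) (u : I -> C) :
  (forall j, g (f j) = j) -> summable u -> summable (fun j => u (f j)).
Proof.
intros gf (B & HB); exists B; intros F HF.
rewrite <- (list_sum_R_map f (fun i => Cmod (u i))). apply HB.
apply FinFun.Injective_map_NoDup; [|easy]. intros x y E. now rewrite <- (gf x), E, gf.
Qed.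

Lemma usum_reindex {I J : Type} (f : J -> I) (g : I -> J) (u : I -> C) :
  (forall i, f (g i) = i) -> (forall j, g (f j) = j) -> summable u ->
  usum (fun j => u (f j)) = usum u.
Proof.
intros fg gf H. apply usum_eq, (has_sum_reindex f g); auto. now apply summable_has_sum.
Qed.

(** * Summation by parts on the lattice *)

Definition mean_zero_mod7 (f : Z -> R) : Prop :=
  (forall j, f (j + 7)%Z = f j) /\ f 0%Z + f 1%Z + f 2%Z + f 3%Z + f 4%Z + f 5%Z + f 6%Z = 0.

(* A right inverse of f |-> (j |-> f j - f (j - c)) on the mean-zero functions
   on Z/7. *)
Definition antidiff (c : Z) (f : Z -> R) (j : Z) : R :=
  - / 7 * list_sum_R (fun i => INR i * f (j - Z.of_nat i * c)%Z) (seq 0 7).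

Fixpoint iter_antidiff (c : Z) (K : nat) (f : Z -> R) : Z -> R :=
  match K with 0%nat => f | S k => antidiff c (iter_antidiff c k f) end.

Ltac sum7 := cbn [seq list_sum_R fold_right] in *;
  change (Z.of_nat 0) with 0%Z in *; change (Z.of_nat 1) with 1%Z in *;
  change (Z.of_nat 2) with 2%Z in *; change (Z.of_nat 3) with 3%Z in *;
  change (Z.of_nat 4) with 4%Z in *; change (Z.of_nat 5) with 5%Z in *;
  change (Z.of_nat 6) with 6%Z in *; cbn [INR] in *.

Lemma periodic7_mod (f : Z -> R) j : (forall j, f (j + 7)%Z = f j) -> f j = f (j mod 7)%Z.
Proof.
intros H.
assert (Hn : forall n j, f (j + 7 * Z.of_nat n)%Z = f j).
{ induction n as [|n IH]; intros i; [f_equal; lia|].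
  rewrite <- (IH i), <- (H (i + 7 * Z.of_nat n)%Z); f_equal; lia. }
rewrite (Z.div_mod j 7) at 1 by lia. set (r := (j mod 7)%Z). set (q := (j / 7)%Z).
destruct (Z_le_gt_dec 0 q).
- rewrite <- (Hn (Z.to_nat q) r); f_equal; lia.
- rewrite <- (Hn (Z.to_nat (- q)) (7 * q + r)%Z); f_equal; lia.
Qed.

Lemma mod7_cases j : (j mod 7 = 0 \/ j mod 7 = 1 \/ j mod 7 = 2 \/ j mod 7 = 3
  \/ j mod 7 = 4 \/ j mod 7 = 5 \/ j mod 7 = 6)%Z.
Proof. pose proof (Z.mod_pos_bound j 7). lia. Qed.

(** As [c] is a unit modulo 7, the progression meets every residue class once. *)
Lemma mean_zero_progression f c j : mean_zero_mod7 f -> (c mod 7 <> 0)%Z ->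
  list_sum_R (fun i => f (j - Z.of_nat i * c)%Z) (seq 0 7) = 0.
Proof.
intros [Hp H0] Hc. sum7.
assert (E : forall i, f (j - i * c)%Z = f ((j mod 7 - i * (c mod 7)) mod 7)%Z).
{ intros i. rewrite (periodic7_mod f) by easy. f_equal.
  now rewrite Zminus_mod, <- Zmult_mod_idemp_r, <- Zminus_mod, Zminus_mod_idemp_l. }
rewrite !E.
destruct (mod7_cases j) as [->|[->|[->|[->|[->|[->| ->]]]]]];
destruct (mod7_cases c) as [E'|[E'|[E'|[E'|[E'|[E'|E']]]]]]; try contradiction; rewrite E';
repeat match goal with |- context [f ?t] =>
  let t' := eval vm_compute in t in progress change t with t' end;
lra.
Qed.

(** The weights i telescope: [f (j - i c)] is left with weight 1 for 1 <= i <= 6, and the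
    wrap-around term [f (j - 7 c) = f j] with weight -6. By mean zero the six terms add up to
    [- f j], so the total is -7 f j, whence the factor -1/7. *)
Lemma antidiff_diff f c j : mean_zero_mod7 f -> (c mod 7 <> 0)%Z ->
  antidiff c f j - antidiff c f (j - c)%Z = f j.
Proof.
intros H Hc. assert (Hs := mean_zero_progression f c j H Hc).
unfold antidiff. sum7.
destruct H as [Hp _].
replace (f (j - c - 6 * c)%Z) with (f j).
2:{ rewrite (periodic7_mod f j), (periodic7_mod f (j - c - 6 * c)) by easy. f_equal.
    replace (j - c - 6 * c)%Z with (j + (- c) * 7)%Z by ring. now rewrite Z_mod_plus_full. }
replace (j - c - 5 * c)%Z with (j - 6 * c)%Z by ring.
replace (j - c - 4 * c)%Z with (j - 5 * c)%Z by ring.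
replace (j - c - 3 * c)%Z with (j - 4 * c)%Z by ring.
replace (j - c - 2 * c)%Z with (j - 3 * c)%Z by ring.
replace (j - c - 1 * c)%Z with (j - 2 * c)%Z by ring.
replace (j - 0 * c)%Z with j in * by ring.
lra.
Qed.

Lemma antidiff_mean_zero f c : mean_zero_mod7 f -> mean_zero_mod7 (antidiff c f).
Proof.
intros [Hp H0]. split.
- intros j. unfold antidiff. f_equal. apply list_sum_R_ext; intros i _.
  rewrite <- (Hp (j - Z.of_nat i * c)%Z). do 2 f_equal; ring.
- unfold antidiff. rewrite <- !Rmult_plus_distr_l, <- !list_sum_R_plus.
  rewrite (list_sum_R_ext _ (fun _ => 0)); [rewrite list_sum_R_const; ring|].
  intros i _. rewrite <- !Rmult_plus_distr_l.
  set (t := (- (Z.of_nat i * c))%Z).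
  assert (E : forall u, f (u - Z.of_nat i * c)%Z = f ((u + t mod 7) mod 7)%Z).
  { intros u. rewrite (periodic7_mod f) by easy. f_equal. unfold t.
    rewrite Zplus_mod_idemp_r. f_equal; ring. }
  rewrite !E.
  destruct (mod7_cases t) as [->|[->|[->|[->|[->|[->| ->]]]]]];
  repeat match goal with |- context [f ?t] =>
    let t' := eval vm_compute in t in progress change t with t' end; nra.
Qed.

Lemma antidiff_comm f c d j : antidiff c (antidiff d f) j = antidiff d (antidiff c f) j.
Proof.
unfold antidiff. f_equal.
rewrite (list_sum_R_ext _ (fun i => - / 7 * list_sum_R (fun k =>
   INR i * (INR k * f (j - Z.of_nat i * c - Z.of_nat k * d)%Z)) (seq 0 7))).
2:{ intros i _; rewrite list_sum_R_scal; ring. }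
rewrite list_sum_R_scal, list_sum_R_exchange, <- list_sum_R_scal.
apply list_sum_R_ext; intros k _.
rewrite (Rmult_comm (INR k)), Rmult_assoc. f_equal.
rewrite Rmult_comm, <- list_sum_R_scal.
apply list_sum_R_ext; intros i _.
replace (j - Z.of_nat k * d - Z.of_nat i * c)%Z with (j - Z.of_nat i * c - Z.of_nat k * d)%Z by
  ring.
ring.
Qed.

(** The factor is 3 = (0 + 1 + ... + 6) / 7. *)
Lemma antidiff_bound f c b : (forall j, Rabs (f j) <= b) -> forall j, Rabs (antidiff c f j) <= 3
  * b.
Proof.
intros H j. unfold antidiff. sum7.
repeat match goal with |- context [f ?t] =>
  let x := fresh "x" in let Hx := fresh "Hx" in
  pose proof (H t) as Hx; apply Rabs_le_between in Hx; set (x := f t) in * end.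
apply Rabs_le. lra.
Qed.

Lemma iter_antidiff_mean_zero f c K : mean_zero_mod7 f -> mean_zero_mod7 (iter_antidiff c K f).
Proof. intros H; induction K; simpl; [easy|now apply antidiff_mean_zero]. Qed.

Lemma iter_antidiff_bound f c b K : (forall j, Rabs (f j) <= b) ->
  forall j, Rabs (iter_antidiff c K f j) <= 3 ^ K * b.
Proof.
intros H; induction K as [|K IH]; simpl; intros j; [specialize (H j); lra|].
rewrite Rmult_assoc. now apply antidiff_bound.
Qed.

Definition padd (p e : Z * Z) : Z * Z := (fst p + fst e, snd p + snd e)%Z.

Definition pdiff (e : Z * Z) (g : Z * Z -> C) (p : Z * Z) : C := (g p - g (padd p e))%C.

Fixpoint iter_pdiff (e : Z * Z) (K : nat) (g : Z * Z -> C) : Z * Z -> C :=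
  match K with 0%nat => g | S k => pdiff e (iter_pdiff e k g) end.

(* The residue of a + b eta modulo sqrt(-7), with eta = 1/2 = 4. *)
Definition residue (p : Z * Z) : Z := (fst p + 4 * snd p)%Z.

Lemma residue_padd p e : residue (padd p e) = (residue p + residue e)%Z.
Proof. unfold residue, padd; cbn [fst snd]; ring. Qed.

Lemma padd_sub p e : padd (padd p e) (- fst e, - snd e)%Z = p.
Proof. destruct p, e; unfold padd; cbn [fst snd]; f_equal; ring. Qed.

Lemma padd_sub' p e : padd (padd p (- fst e, - snd e)%Z) e = p.
Proof. destruct p, e; unfold padd; cbn [fst snd]; f_equal; ring. Qed.

Lemma summable_padd g e : summable g -> summable (fun p => g (padd p e)).
Proof.
apply (summable_reindex (fun p => padd p e) (fun p => padd p (- fst e, - snd e)%Z)).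
intros; apply padd_sub.
Qed.

Lemma usum_padd g e : summable g -> usum (fun p => g (padd p e)) = usum g.
Proof.
apply (usum_reindex (fun p => padd p e) (fun p => padd p (- fst e, - snd e)%Z));
intros; [apply padd_sub'|apply padd_sub].
Qed.

Lemma summable_pdiff g e : summable g -> summable (pdiff e g).
Proof. intros H; apply summable_minus; [easy|now apply summable_padd]. Qed.

Lemma summable_iter_pdiff g e K : summable g -> summable (iter_pdiff e K g).
Proof. intros H; induction K; simpl; [easy|now apply summable_pdiff]. Qed.

Lemma summable_bounded_mult (f : Z * Z -> R) (b : R) g :
  (forall p, Rabs (f p) <= b) -> summable g -> summable (fun p => f p * g p)%C.
Proof.
intros H Hg. apply (summable_le g _ b); [easy|]. intros p.
rewrite Cmod_mult, Cmod_R. apply Rmult_le_compat_r; [apply Cmod_ge_0|easy].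
Qed.

Lemma mean_zero_bounded f : mean_zero_mod7 f -> exists b, forall j, Rabs (f j) <= b.
Proof.
intros [Hp _].
exists (list_sum_R (fun i => Rabs (f (Z.of_nat i))) (seq 0 7)). intros j.
rewrite (periodic7_mod f) by easy. simpl.
assert (P : forall z, 0 <= Rabs (f z)) by (intros; apply Rabs_pos).
assert (P0 := P 0%Z); assert (P1 := P 1%Z); assert (P2 := P 2%Z); assert (P3 := P 3%Z);
assert (P4 := P 4%Z); assert (P5 := P 5%Z); assert (P6 := P 6%Z).
destruct (mod7_cases j) as [->|[->|[->|[->|[->|[->| ->]]]]]]; lra.
Qed.

(** Write [f] as a difference of its antidifference h, and translate p by [e] in the part that
    contains [h (residue p - residue e)]. *)
Lemma abel_summation f e g : mean_zero_mod7 f -> (residue e mod 7 <> 0)%Z -> summable g ->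
  usum (fun p => f (residue p) * g p)%C
  = usum (fun p => antidiff (residue e) f (residue p) * pdiff e g p)%C.
Proof.
intros Hf He Hg. set (h := antidiff (residue e) f).
destruct (mean_zero_bounded h) as (b & Hb); [now apply antidiff_mean_zero|].
assert (H1 : summable (fun p => h (residue p) * g p)%C)
  by (apply summable_bounded_mult with b; auto).
assert (H2 : summable (fun p => h (residue p) * g (padd p e))%C)
  by (apply summable_bounded_mult with b; auto; now apply summable_padd).
assert (H3 : summable (fun p => h (residue p - residue e)%Z * g p)%C)
  by (apply summable_bounded_mult with b; auto).
rewrite (usum_ext _ (fun p => h (residue p) * g p - h (residue p - residue e)%Z * g p)%C).
- rewrite usum_minus by easy.
  rewrite <- (usum_padd (fun p => h (residue p - residue e)%Z * g p)%C e) by easy.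
  rewrite <- usum_minus; [|easy|now apply (summable_padd (fun p => h (residue p - residue e)%Z *
    g p)%C)].
  apply usum_ext.
  + apply summable_minus; [easy|].
    now apply (summable_padd (fun p => h (residue p - residue e)%Z * g p)%C).
  + intros p; unfold pdiff. rewrite residue_padd.
    replace (residue p + residue e - residue e)%Z with (residue p) by ring. ring.
- destruct (mean_zero_bounded f Hf) as (b' & Hb').
  apply summable_bounded_mult with b'; auto.
- intros p. rewrite <- (antidiff_diff f (residue e) (residue p) Hf He).
  fold h. rewrite RtoC_minus. ring.
Qed.

(* The sum of f (residue p) * g p after K summations by parts in the direction
   e: it agrees with that sum when the latter converges (reg_sum_0), but also
   makes sense for g of slower decay. *)
Definition reg_sum (e : Z * Z) (K : nat) (f : Z -> R) (g : Z * Z -> C) : C :=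
  usum (fun p => iter_antidiff (residue e) K f (residue p) * iter_pdiff e K g p)%C.

Lemma reg_sum_S e K f g : mean_zero_mod7 f -> (residue e mod 7 <> 0)%Z ->
  summable (iter_pdiff e K g) -> reg_sum e (S K) f g = reg_sum e K f g.
Proof.
intros Hf He Hg. symmetry. apply abel_summation; auto. now apply iter_antidiff_mean_zero.
Qed.

Lemma reg_sum_0 e f g K : mean_zero_mod7 f -> (residue e mod 7 <> 0)%Z -> summable g ->
  reg_sum e K f g = usum (fun p => f (residue p) * g p)%C.
Proof.
intros Hf He Hg. induction K as [|K IH]; [easy|].
rewrite reg_sum_S; auto. now apply summable_iter_pdiff.
Qed.

Lemma iter_pdiff_comm e e' K K' g p :
  iter_pdiff e K (iter_pdiff e' K' g) p = iter_pdiff e' K' (iter_pdiff e K g) p.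
Proof.
assert (A : forall g p, pdiff e (pdiff e' g) p = pdiff e' (pdiff e g) p).
{ intros h q; unfold pdiff.
  replace (padd (padd q e') e) with (padd (padd q e) e')
    by (unfold padd; cbn [fst snd]; f_equal; ring). ring. }
assert (B : forall K' g p, pdiff e (iter_pdiff e' K' g) p = iter_pdiff e' K' (pdiff e g) p).
{ intros k h; induction k as [|k IH]; intros q; simpl; [easy|].
  rewrite A. unfold pdiff at 1 3. now rewrite !IH. }
revert p; induction K as [|K IH]; intros p; simpl; [easy|].
rewrite <- B. unfold pdiff. now rewrite !IH.
Qed.

Lemma iter_antidiff_comm c d K L f j :
  iter_antidiff c K (iter_antidiff d L f) j = iter_antidiff d L (iter_antidiff c K f) j.
Proof.
assert (A : forall f g c j, (forall i, f i = g i) -> antidiff c f j = antidiff c g j).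
{ intros h h' b i H. unfold antidiff. f_equal. apply list_sum_R_ext. intros; now rewrite H. }
assert (B : forall L f j, antidiff c (iter_antidiff d L f) j = iter_antidiff d L (antidiff c f) j).
{ intros l h; induction l as [|l IH]; intros i; simpl; [easy|].
  rewrite antidiff_comm. now apply A. }
revert j; induction K as [|K IH]; intros j; simpl; [easy|].
rewrite <- B. apply A, IH.
Qed.

(** Both sides equal the sum regularized in the two directions at once: the operators for [e] and
    [e'] commute, and regularizing a difference that is already summable does not change its sum.
    This freedom of direction is what permits a change of lattice basis later. *)
Lemma reg_sum_change e e' K K' f g : mean_zero_mod7 f ->
  (residue e mod 7 <> 0)%Z -> (residue e' mod 7 <> 0)%Z ->
  summable (iter_pdiff e K g) -> summable (iter_pdiff e' K' g) ->
  reg_sum e K f g = reg_sum e' K' f g.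
Proof.
intros Hf He He' Hg Hg'.
transitivity (reg_sum e' K' (iter_antidiff (residue e) K f) (iter_pdiff e K g)).
{ symmetry; apply reg_sum_0; auto. now apply iter_antidiff_mean_zero. }
transitivity (reg_sum e K (iter_antidiff (residue e') K' f) (iter_pdiff e' K' g)).
2:{ apply reg_sum_0; auto. now apply iter_antidiff_mean_zero. }
unfold reg_sum. f_equal. extensionality p.
rewrite iter_pdiff_comm. now rewrite iter_antidiff_comm.
Qed.

(** * Convergence of lattice sums *)

Lemma is_derive_Rpower_l a x : 0 < x ->
  is_derive (fun x => Rpower x a) x (a * Rpower x (a - 1)).
Proof.
intros Hx. unfold Rpower. evar_last.
- apply (is_derive_comp exp (fun x => a * ln x)); [apply is_derive_exp|].
  apply (is_derive_scal ln x a), is_derive_ln, Hx.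
- unfold scal; simpl; unfold mult; simpl.
  replace ((a - 1) * ln x) with (a * ln x + - ln x) by ring.
  rewrite exp_plus, exp_Ropp, exp_ln by easy. ring.
Qed.

(** Comparison with the integral of x^(-t), one unit step at a time by the mean value theorem; the
    bound is 1 + 1/(t - 1). *)
Lemma sum_Rpower_le t n : 1 < t ->
  list_sum_R (fun i => Rpower (1 + INR i) (- t)) (seq 0 n) <= t / (t - 1).
Proof.
intros Ht.
assert (Hstep : forall x, 1 <= x -> (t - 1) * Rpower (1 + x) (- t)
   <= Rpower x (1 - t) - Rpower (1 + x) (1 - t)).
{ intros x Hx.
  destruct (MVT_gen (fun y => Rpower y (1 - t)) x (1 + x)
    (fun y => (1 - t) * Rpower y (1 - t - 1))) as (c & Hc & E).
  - intros y Hy. rewrite Rmin_left in Hy by lra. apply is_derive_Rpower_l; lra.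
  - intros y Hy. rewrite Rmin_left in Hy by lra.
    apply continuity_pt_filterlim.
    apply (ex_derive_continuous (fun y => Rpower y (1 - t))).
    eexists; apply (is_derive_Rpower_l (1 - t) y); lra.
  - rewrite Rmin_left, Rmax_right in Hc by lra.
    replace (1 - t - 1) with (- t) in E by ring.
    assert (Rpower (1 + x) (- t) <= Rpower c (- t)).
    { rewrite !Rpower_Ropp. apply Rinv_le_contravar; [apply exp_pos|].
      apply Rle_Rpower_l; lra. }
    assert (0 < t - 1) by lra.
    pose proof (Rmult_le_compat_l (t - 1) _ _ (Rlt_le _ _ H0) H). lra. }
assert (Hind : forall n, (t - 1) * list_sum_R (fun i => Rpower (1 + INR i) (- t)) (seq 0 (S n))
  <= t - Rpower (1 + INR n) (1 - t)).
{ induction n0 as [|k IH].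
  - simpl. unfold Rpower. replace (1 + 0) with 1 by ring. rewrite ln_1, !Rmult_0_r, exp_0. lra.
  - rewrite seq_S, list_sum_R_app, Rmult_plus_distr_l. cbn [list_sum_R fold_right Nat.add].
    assert (H1 : 1 <= INR (S k)) by (rewrite S_INR; pose proof (pos_INR k); lra).
    specialize (Hstep (INR (S k)) H1).
    replace (1 + INR k) with (INR (S k)) in IH by (rewrite S_INR; ring). lra. }
destruct n as [|n].
- simpl. apply Rlt_le, Rdiv_lt_0_compat; lra.
- apply (Rmult_le_reg_l (t - 1)); [lra|]. specialize (Hind n).
  assert (0 < Rpower (1 + INR n) (1 - t)) by apply exp_pos.
  replace ((t - 1) * (t / (t - 1))) with t by (field; lra). lra.
Qed.

(** The entry 0 occurs twice, so that even functions sum to exactly twice their sum over 0, ..., n.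
    The list serves for upper bounds and membership, where the repetition is harmless. *)
Definition zbox (n : nat) : list Z :=
  map Z.of_nat (seq 0 (S n)) ++ map (fun i => - Z.of_nat i)%Z (seq 0 (S n)).

Lemma in_zbox n z : (Z.abs z <= Z.of_nat n)%Z -> In z (zbox n).
Proof.
intros H. apply in_or_app.
destruct (Z_le_gt_dec 0 z); [left|right]; apply in_map_iff.
- exists (Z.to_nat z); split; [lia|apply in_seq; lia].
- exists (Z.to_nat (- z)); split; [lia|apply in_seq; lia].
Qed.

Lemma list_sum_zbox (u : R -> R) n :
  list_sum_R (fun z => u (IZR (Z.abs z))) (zbox n)
  = 2 * list_sum_R (fun i => u (INR i)) (seq 0 (S n)).
Proof.
unfold zbox. rewrite list_sum_R_app, !list_sum_R_map, <- Rplus_diag.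
f_equal; apply list_sum_R_ext; intros i _; f_equal; rewrite INR_IZR_INZ; f_equal; lia.
Qed.

Lemma list_ZZ_bounded (F : list (Z * Z)) :
  exists n, incl F (list_prod (zbox n) (zbox n)).
Proof.
induction F as [|[a b] F [n IH]]; [exists 0%nat; intros p []|].
exists (n + Z.to_nat (Z.abs a) + Z.to_nat (Z.abs b))%nat.
assert (M : forall z m m', (m <= m')%nat -> In z (zbox m) -> In z (zbox m')).
{ intros z m m' Hm Hz. apply in_zbox. apply in_app_or in Hz.
  destruct Hz as [Hz|Hz]; apply in_map_iff in Hz as (i & <- & Hi); apply in_seq in Hi; lia. }
intros p [<-|Hp].
- apply in_prod; apply in_zbox; lia.
- apply IH in Hp. destruct p as [x y]. apply in_prod_iff in Hp as [Hx Hy].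
  apply in_prod; eapply M; try eassumption; lia.
Qed.

(** The summand 1 keeps negative powers meaningful at the origin and turns the triangle inequality
    into the multiplicative shift bound [psize_shift]. *)
Definition psize (p : Z * Z) : R := 1 + IZR (Z.abs (fst p)) + IZR (Z.abs (snd p)).

Lemma psize_ge_1 p : 1 <= psize p.
Proof.
unfold psize. assert (0 <= IZR (Z.abs (fst p))) by (apply IZR_le; lia).
assert (0 <= IZR (Z.abs (snd p))) by (apply IZR_le; lia). lra.
Qed.

Lemma psize_pos p : 0 < psize p.
Proof. pose proof (psize_ge_1 p); lra. Qed.

Lemma psize_shift p e : psize p <= psize (padd p e) * psize e.
Proof.
assert (psize p <= psize (padd p e) + psize e - 1).
{ unfold psize, padd. cbn [fst snd].
  pose proof (Z.abs_triangle (fst p + fst e) (- fst e)).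
  pose proof (Z.abs_triangle (snd p + snd e) (- snd e)).
  replace (fst p + fst e + - fst e)%Z with (fst p) in H by ring.
  replace (snd p + snd e + - snd e)%Z with (snd p) in H0 by ring.
  rewrite Z.abs_opp in H, H0. apply IZR_le in H, H0. rewrite plus_IZR in H, H0. lra. }
pose proof (psize_ge_1 (padd p e)). pose proof (psize_ge_1 e). nra.
Qed.

Lemma psize_double e : psize (padd e e) <= 2 * psize e.
Proof.
unfold psize, padd. cbn [fst snd].
pose proof (Z.abs_triangle (fst e) (fst e)). pose proof (Z.abs_triangle (snd e) (snd e)).
apply IZR_le in H, H0. rewrite plus_IZR in H, H0. lra.
Qed.

(** Since (1 + |a|)(1 + |b|) <= psize^2, the sum is dominated by the product of two one-dimensional
    sums with exponent t/2 > 1. *)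
Lemma sum_psize_bounded t : 2 < t -> exists B, 0 <= B /\ forall F : list (Z * Z), NoDup F ->
  list_sum_R (fun p => Rpower (psize p) (- t)) F <= B.
Proof.
intros Ht. set (h := t / 2). assert (Hh : 1 < h) by (unfold h; lra).
assert (H0 : 0 < 2 * (h / (h - 1))).
{ apply Rmult_lt_0_compat; [lra|apply Rdiv_lt_0_compat; lra]. }
exists ((2 * (h / (h - 1))) * (2 * (h / (h - 1)))). split; [nra|].
intros F HF. destruct (list_ZZ_bounded F) as (n & Hn).
eapply Rle_trans; [apply (list_sum_R_incl (fun p => Rpower (psize p) (- t)) F _ (fun p => Rlt_le
  _ _ (exp_pos _)) HF Hn)|].
apply Rle_trans with (list_sum_R (fun p : Z * Z =>
  Rpower (1 + IZR (Z.abs (fst p))) (- h) * Rpower (1 + IZR (Z.abs (snd p))) (- h))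
  (list_prod (zbox n) (zbox n))).
- apply list_sum_R_le; intros p _.
  assert (0 <= IZR (Z.abs (fst p))) by (apply IZR_le; lia).
  assert (0 <= IZR (Z.abs (snd p))) by (apply IZR_le; lia).
  rewrite Rpower_mult_distr by lra.
  replace (- t) with (2 * (- h)) by (unfold h; lra).
  rewrite <- Rpower_mult. replace 2 with (INR 2) by reflexivity.
  rewrite Rpower_pow by apply psize_pos. rewrite !Rpower_Ropp.
  apply Rinv_le_contravar; [apply exp_pos|]. apply Rle_Rpower_l; [lra|].
  split; [apply Rmult_lt_0_compat; lra|]. unfold psize. nra.
- rewrite list_sum_R_prod.
  set (A := list_sum_R (fun z => Rpower (1 + IZR (Z.abs z)) (- h)) (zbox n)).
  assert (HA : A <= 2 * (h / (h - 1))).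
  { unfold A. rewrite (list_sum_zbox (fun x => Rpower (1 + x) (- h))).
    apply Rmult_le_compat_l; [lra|]. now apply sum_Rpower_le. }
  assert (HA0 : 0 <= A).
  { apply list_sum_R_pos; intros; apply Rlt_le, exp_pos. }
  rewrite (list_sum_R_ext _ (fun z => A * Rpower (1 + IZR (Z.abs z)) (- h))).
  + rewrite list_sum_R_scal. fold A. nra.
  + intros z _. cbn [fst snd]. rewrite list_sum_R_scal. apply Rmult_comm.
Qed.

Lemma summable_psize t c (u : Z * Z -> C) : 2 < t ->
  (forall p, Cmod (u p) <= c * Rpower (psize p) (- t)) -> summable u.
Proof.
intros Ht H. destruct (sum_psize_bounded t Ht) as (B & HB0 & HB).
exists (Rabs c * B); intros F HF.
eapply Rle_trans; [|apply Rmult_le_compat_l; [apply Rabs_pos|exact (HB F HF)]].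
rewrite <- list_sum_R_scal. apply list_sum_R_le; intros i _.
eapply Rle_trans; [apply H|]. apply Rmult_le_compat_r; [apply Rlt_le, exp_pos|apply Rle_abs].
Qed.

Lemma Rpower_neg3 x : 0 < x -> Rpower x (- (3)) = / x ^ 3.
Proof.
intros Hx. rewrite Rpower_Ropp. f_equal. replace 3 with (INR 3) by (simpl; lra).
now apply Rpower_pow.
Qed.

Definition additive (U : Z * Z -> C) : Prop := forall p q, U (padd p q) = (U p + U q)%C.

(** With this default value, a sum of [/ U p] over all of Z^2 is the sum over the nonzero
    vectors. *)
Lemma Cinv_0 : (/ 0)%C = RtoC 0.
Proof. unfold Cinv, RtoC; simpl. unfold Rdiv. f_equal; ring. Qed.

Lemma Cinv_le U k : 0 < k -> (forall p, p <> (0, 0)%Z -> k * psize p <= Cmod (U p)) ->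
  U (0, 0)%Z = RtoC 0 -> forall p, Cmod (/ U p) <= / k * / psize p.
Proof.
intros Hk H H0 p. pose proof (psize_pos p).
destruct (excluded_middle_informative (p = (0, 0)%Z)) as [->|Hp].
- rewrite H0, Cinv_0, Cmod_0.
  apply Rlt_le, Rmult_lt_0_compat; apply Rinv_0_lt_compat; [easy|apply psize_pos].
- specialize (H p Hp). assert (0 < k * psize p) by (apply Rmult_lt_0_compat; easy).
  rewrite Cmod_inv by (apply Cmod_gt_0; lra).
  rewrite <- Rinv_mult. now apply Rinv_le_contravar.
Qed.

Lemma additive_0 U : additive U -> U (0, 0)%Z = RtoC 0.
Proof.
intros H. assert (E := H (0, 0)%Z (0, 0)%Z). change (padd (0, 0)%Z (0, 0)%Z) with (0, 0)%Z in E.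
replace (U (0, 0)%Z) with (U (0,0)%Z + U (0,0)%Z - U (0,0)%Z)%C at 1 by ring.
rewrite <- E. ring.
Qed.

Lemma iter_pdiff_2 e g p :
  iter_pdiff e 2 g p = (g p - 2 * g (padd p e) + g (padd p (padd e e)))%C.
Proof.
simpl; unfold pdiff. replace (padd (padd p e) e) with (padd p (padd e e)).
- ring.
- unfold padd; cbn [fst snd]; f_equal; ring.
Qed.

(** With x = U p and h = U e, the second difference is 2 h^2 / (x (x + h) (x + 2 h)), and each
    factor is at least a constant times [psize p]. The summand [4 * / k] of the constant covers the
    points for which one of the three vectors is zero. *)
Lemma second_diff_inv_le U e k : additive U -> 0 < k ->
  (forall p, p <> (0, 0)%Z -> k * psize p <= Cmod (U p)) -> forall p,
  Cmod (iter_pdiff e 2 (fun p => / U p)%C p)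
  <= ((2 * Cmod (U e) ^ 2 * (/ k) ^ 3 + 4 * / k) * (2 * psize e) ^ 3) * / psize p ^ 3.
Proof.
intros HU Hk H p.
assert (HI := Cinv_le U k Hk H (additive_0 U HU)).
pose proof (psize_ge_1 e) as He. pose proof (psize_pos p) as Hp.
assert (Hik := Rinv_0_lt_compat k Hk).
assert (Hs : forall q, (q = (0, 0)%Z \/ q = e \/ q = padd e e) ->
   Cmod (/ U (padd p q)) <= / k * (2 * psize e) * / psize p).
{ intros q Hq. eapply Rle_trans; [apply HI|].
  rewrite Rmult_assoc. apply Rmult_le_compat_l; [lra|].
  pose proof (psize_pos (padd p q)).
  apply (Rmult_le_reg_l (psize (padd p q))); [easy|]. rewrite Rinv_r by lra.
  apply (Rmult_le_reg_r (psize p)); [easy|].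
  replace (psize (padd p q) * (2 * psize e * / psize p) * psize p)
    with (psize (padd p q) * (2 * psize e)) by (field; lra).
  rewrite Rmult_1_l. eapply Rle_trans; [apply (psize_shift p q)|].
  apply Rmult_le_compat_l; [lra|].
  destruct Hq as [->|[->| ->]]; [|lra|apply psize_double].
  unfold psize; simpl. unfold psize in He. lra. }
assert (E0 : padd p (0, 0)%Z = p) by (destruct p; unfold padd; simpl; f_equal; ring).
assert (Hs0 := Hs (0, 0)%Z (or_introl eq_refl)). rewrite E0 in Hs0.
assert (Hs1 := Hs e (or_intror (or_introl eq_refl))).
assert (Hs2 := Hs (padd e e) (or_intror (or_intror eq_refl))). clear Hs.
assert (Hip := Rinv_0_lt_compat _ Hp).
set (X := / k * (2 * psize e) * / psize p) in *.
assert (HX : 0 < X) by (unfold X; repeat apply Rmult_lt_0_compat; lra).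
pose proof (Cmod_ge_0 (U e)) as HUe.
rewrite iter_pdiff_2.
destruct (excluded_middle_informative (U p <> 0 /\ U (padd p e) <> 0 /\ U (padd p (padd e e)) <> 0))
  as [(N0 & N1 & N2)|Hn].
- replace (/ U p - 2 * / U (padd p e) + / U (padd p (padd e e)))%C
    with (2 * U e * U e * (/ U p * / U (padd p e) * / U (padd p (padd e e))))%C.
  2:{ rewrite !HU in N2 |- *. rewrite HU in N1 |- *. field. auto. }
  rewrite !Cmod_mult, Cmod_R, (Rabs_right 2) by lra.
  assert (HP : Cmod (/ U p) * Cmod (/ U (padd p e)) * Cmod (/ U (padd p (padd e e))) <= X * X * X).
  { repeat apply Rmult_le_compat; try apply Cmod_ge_0; try easy.
    apply Rmult_le_pos; apply Cmod_ge_0. }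
  apply Rle_trans with (2 * Cmod (U e) ^ 2 * (X * X * X)).
  + replace (2 * Cmod (U e) * Cmod (U e)) with (2 * Cmod (U e) ^ 2) by ring.
    apply Rmult_le_compat_l; [nra|easy].
  + replace (2 * Cmod (U e) ^ 2 * (X * X * X)) with
     (2 * Cmod (U e) ^ 2 * (/ k) ^ 3 * (2 * psize e) ^ 3 * / psize p ^ 3)
     by (unfold X; field; lra).
    apply Rmult_le_compat_r; [apply Rlt_le, Rinv_0_lt_compat, pow_lt, Hp|].
    apply Rmult_le_compat_r; [apply pow_le; lra|]. lra.
(* One of the three points is the origin, so [p] is close to it. With [psize p] bounded, the three
   terms may be estimated separately. *)
- assert (Hsmall : psize p <= 2 * psize e).
  { destruct (Rle_dec (psize p) (2 * psize e)) as [|Hbig]; [easy|exfalso]. apply Hn.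
    assert (Hq : forall q, (q = (0, 0)%Z \/ q = e \/ q = padd e e) -> U (padd p q) <> 0).
    { intros q Hq. apply Cmod_gt_0.
      assert (padd p q <> (0, 0)%Z).
      { intros E. pose proof (psize_shift p q). rewrite E in H0.
        replace (psize (0, 0)%Z) with 1 in H0 by (unfold psize; simpl; ring).
        destruct Hq as [->|[->| ->]]; [|lra|pose proof (psize_double e); lra].
        replace (psize (0, 0)%Z) with 1 in H0 by (unfold psize; simpl; ring). lra. }
      apply H in H0. pose proof (psize_pos (padd p q)).
      assert (0 < k * psize (padd p q)) by (apply Rmult_lt_0_compat; easy). lra. }
    repeat split; [rewrite <- E0| |]; apply Hq; auto. }
  assert (HT : Cmod (/ U p - 2 * / U (padd p e) + / U (padd p (padd e e))) <= 4 * X).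
  { eapply Rle_trans; [apply Cmod_triangle|]. unfold Cminus.
    eapply Rle_trans; [apply Rplus_le_compat_r, Cmod_triangle|].
    rewrite Cmod_opp, Cmod_mult, Cmod_R, (Rabs_right 2) by lra. lra. }
  eapply Rle_trans; [exact HT|]. unfold X.
  assert (Hr : 1 <= 2 * psize e * / psize p).
  { apply (Rmult_le_reg_r (psize p)); [easy|].
    replace (2 * psize e * / psize p * psize p) with (2 * psize e) by (field; lra). lra. }
  replace (4 * (/ k * (2 * psize e) * / psize p)) with (4 * / k * (2 * psize e * / psize p)) by
    ring.
  replace ((2 * Cmod (U e) ^ 2 * (/ k) ^ 3 + 4 * / k) * (2 * psize e) ^ 3 * / psize p ^ 3)
    with ((2 * Cmod (U e) ^ 2 * (/ k) ^ 3 + 4 * / k) * (2 * psize e * / psize p) ^ 3)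
    by (field; lra).
  set (Y := 2 * psize e * / psize p) in *.
  apply Rmult_le_compat; [lra|lra| |].
  + assert (0 <= 2 * Cmod (U e) ^ 2 * (/ k) ^ 3).
    { apply Rmult_le_pos; [nra|apply pow_le; lra]. } lra.
  + simpl. nra.
Qed.

Lemma summable_second_diff_inv U e k : additive U -> 0 < k ->
  (forall p, p <> (0, 0)%Z -> k * psize p <= Cmod (U p)) ->
  summable (iter_pdiff e 2 (fun p => / U p)%C).
Proof.
intros HU Hk H.
apply (summable_psize 3 ((2 * Cmod (U e) ^ 2 * (/ k) ^ 3 + 4 * / k) * (2 * psize e) ^ 3)); [lra|].
intros p. rewrite Rpower_neg3 by apply psize_pos. now apply second_diff_inv_le.
Qed.

(** * Complex-valued functions of a real variable *)

Lemma C_ext (z w : C) : Re z = Re w -> Im z = Im w -> z = w.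
Proof. destruct z, w; simpl; intros; now f_equal. Qed.

Lemma im_le_Cmod z : Rabs (Im z) <= Cmod z.
Proof. eapply Rle_trans; [apply Rmax_r|apply Rmax_Cmod]. Qed.

Lemma Cmod_le_Re_Im z : Cmod z <= Rabs (Re z) + Rabs (Im z).
Proof.
assert (E : z = (Re z + Ci * Im z)%C)
  by (apply C_ext; destruct z; simpl; ring).
rewrite E at 1. eapply Rle_trans; [apply Cmod_triangle|].
rewrite Cmod_mult, !Cmod_R, Cmod_Ci. lra.
Qed.

Ltac ring_R := match goal with |- _ ?a ?b => change (@eq R a b) end; ring.

Definition cder (f : R -> C) (x : R) (l : C) : Prop :=
  is_derive (fun t => Re (f t)) x (Re l) /\ is_derive (fun t => Im (f t)) x (Im l).

Lemma cder_ext f g x l : (forall t, f t = g t) -> cder f x l -> cder g x l.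
Proof.
intros E [H H']; split.
- apply (is_derive_ext (fun t => Re (f t))); [intros; now rewrite E|easy].
- apply (is_derive_ext (fun t => Im (f t))); [intros; now rewrite E|easy].
Qed.

Lemma cder_eq f x l l' : cder f x l -> l = l' -> cder f x l'.
Proof. now intros H <-. Qed.

Lemma cder_const c x : cder (fun _ => c) x 0.
Proof. split; [exact (is_derive_const (Re c) x)|exact (is_derive_const (Im c) x)]. Qed.

Lemma cder_RtoC (f : R -> R) (x d : R) : is_derive f x d -> cder (fun t => RtoC (f t)) x (RtoC d).
Proof. intros H; split; [exact H|exact (is_derive_const 0 x)]. Qed.

Lemma cder_plus f g x l m : cder f x l -> cder g x m -> cder (fun t => f t + g t)%C x (l + m)%C.
Proof.
intros [H1 H2] [H3 H4]; split.
- exact (is_derive_plus _ _ _ _ _ H1 H3).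
- exact (is_derive_plus _ _ _ _ _ H2 H4).
Qed.

Lemma is_derive_mult_R (f g : R -> R) x l m : is_derive f x l -> is_derive g x m ->
  is_derive (fun t => f t * g t) x (l * g x + f x * m).
Proof. intros H H'; apply (is_derive_mult f g x l m H H'). intros; apply Rmult_comm. Qed.

Lemma cder_mult f g x l m : cder f x l -> cder g x m ->
  cder (fun t => f t * g t)%C x (l * g x + f x * m)%C.
Proof.
intros [H1 H2] [H3 H4]; split; simpl.
- evar_last; [apply (is_derive_minus _ _ _ _ _ (is_derive_mult_R _ _ _ _ _ H1 H3)
     (is_derive_mult_R _ _ _ _ _ H2 H4))|].
  unfold minus, plus, opp; simpl. unfold Re, Im; ring.
- evar_last; [apply (is_derive_plus _ _ _ _ _ (is_derive_mult_R _ _ _ _ _ H1 H4)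
     (is_derive_mult_R _ _ _ _ _ H2 H3))|].
  unfold plus; simpl. unfold Re, Im; ring.
Qed.

Lemma cder_scal c f x l : cder f x l -> cder (fun t => c * f t)%C x (c * l)%C.
Proof.
intros H. eapply cder_eq; [apply (cder_mult _ _ _ _ _ (cder_const c x) H)|]. ring.
Qed.

Lemma cder_minus f g x l m : cder f x l -> cder g x m -> cder (fun t => f t - g t)%C x (l - m)%C.
Proof.
intros H H'. apply (cder_ext (fun t => f t + (-1) * g t)%C); [intros; ring|].
eapply cder_eq; [apply (cder_plus _ _ _ _ _ H (cder_scal (-1) _ _ _ H'))|]. ring.
Qed.

Lemma cder_conj f x l : cder f x l -> cder (fun t => Cconj (f t)) x (Cconj l).
Proof.
intros [H H']; split; simpl; [easy|].
evar_last; [apply (is_derive_opp _ _ _ H')|]. easy.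
Qed.

Lemma cder_pow f x l n : cder f x l -> f x <> 0 ->
  cder (fun t => f t ^ n)%C x (INR n * (f x ^ n * / f x) * l)%C.
Proof.
intros H Hx. induction n as [|n IH].
- eapply cder_eq; [apply (cder_const 1)|]. simpl; ring.
- eapply cder_eq; [apply (cder_mult _ _ _ _ _ H IH)|].
  rewrite S_INR, RtoC_plus, Cpow_S. field. easy.
Qed.

Lemma is_derive_Cmod2 f x l : cder f x l ->
  is_derive (fun t => Re (f t) ^ 2 + Im (f t) ^ 2) x (2 * (Re (f x) * Re l + Im (f x) * Im l)).
Proof.
intros [H H'].
apply (is_derive_ext (fun t => Re (f t) * Re (f t) + Im (f t) * Im (f t))).
{ intros t; ring_R. }
evar_last; [apply (is_derive_plus _ _ _ _ _ (is_derive_mult_R _ _ _ _ _ H H)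
     (is_derive_mult_R _ _ _ _ _ H' H'))|]. unfold plus; simpl; ring.
Qed.

Lemma Cmod2_neq_0 (z : C) : z <> 0 -> 0 < Re z ^ 2 + Im z ^ 2.
Proof. intros H. rewrite <- Cmod2_alt. apply pow_lt. now apply Cmod_gt_0. Qed.

Lemma cder_inv f x l : cder f x l -> f x <> 0 -> cder (fun t => / f t)%C x (- (l * (/ f x * / f
  x)))%C.
Proof.
intros H Hx. pose proof (Cmod2_neq_0 _ Hx) as Hp.
pose proof (is_derive_inv _ _ _ (is_derive_Cmod2 f x l H) ltac:(lra)) as HI.
apply (cder_ext (fun t => Cconj (f t) * RtoC (/ (Re (f t) ^ 2 + Im (f t) ^ 2)))%C).
{ intros t. apply C_ext; unfold Cinv; simpl; unfold Rdiv, Re, Im; ring. }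
eapply cder_eq; [apply (cder_mult _ _ _ _ _ (cder_conj _ _ _ H) (cder_RtoC _ _ _ HI))|].
destruct (f x) as [a b], l as [c d].
unfold Re, Im in Hp |- *. cbn [fst snd] in *.
apply C_ext; unfold Cinv, Cmult, Cplus, Cconj, Copp, RtoC, Re, Im; cbn [fst snd]; field; lra.
Qed.

Lemma cder_comp f g x l d : cder f (g x) l -> is_derive g x d ->
  cder (fun t => f (g t)) x (d * l)%C.
Proof.
intros [H H'] Hg; split.
- evar_last; [apply (is_derive_comp (fun t => Re (f t)) g x _ _ H Hg)|].
  unfold scal; simpl; unfold mult, Re, Im; simpl; ring.
- evar_last; [apply (is_derive_comp (fun t => Im (f t)) g x _ _ H' Hg)|].
  unfold scal; simpl; unfold mult, Re, Im; simpl; ring.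
Qed.

(** The real mean value theorem is applied to the real and imaginary parts separately, hence the
    factor 2. *)
Lemma cder_mean_value f f' B : (forall x, 0 <= x <= 1 -> cder f x (f' x)) ->
  (forall x, 0 <= x <= 1 -> Cmod (f' x) <= B) -> Cmod (f 0 - f 1) <= 2 * B.
Proof.
intros H HB.
assert (M : forall g g' : R -> R, (forall x, 0 <= x <= 1 -> is_derive g x (g' x)) ->
  (forall x, 0 <= x <= 1 -> Rabs (g' x) <= B) -> Rabs (g 0 - g 1) <= B).
{ intros g g' Hg Hg'.
  destruct (MVT_gen g 0 1 g') as (c & Hc & E).
  - intros x Hx; rewrite Rmin_left, Rmax_right in Hx by lra. apply Hg; lra.
  - intros x Hx; rewrite Rmin_left, Rmax_right in Hx by lra.
    apply continuity_pt_filterlim, (ex_derive_continuous g). eexists. apply Hg; lra.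
  - rewrite Rmin_left, Rmax_right in Hc by lra.
    replace (g 0 - g 1) with (- g' c) by lra. rewrite Rabs_Ropp. auto. }
eapply Rle_trans; [apply Cmod_le_Re_Im|].
assert (Rabs (Re (f 0 - f 1)) <= B).
{ replace (Re (f 0 - f 1)%C) with (Re (f 0) - Re (f 1)) by (unfold Re; simpl; ring).
  apply (M (fun t => Re (f t)) (fun t => Re (f' t))).
  - intros x Hx; apply (H x Hx).
  - intros x Hx; eapply Rle_trans; [apply re_le_Cmod|auto]. }
assert (Rabs (Im (f 0 - f 1)) <= B).
{ replace (Im (f 0 - f 1)%C) with (Im (f 0) - Im (f 1)) by (unfold Im; simpl; ring).
  apply (M (fun t => Im (f t)) (fun t => Im (f' t))).
  - intros x Hx; apply (H x Hx).
  - intros x Hx; eapply Rle_trans; [apply im_le_Cmod|auto]. }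
lra.
Qed.

Definition cexp (z : C) : C := (exp (Re z) * cos (Im z), exp (Re z) * sin (Im z)).

Lemma cexp_plus z w : cexp (z + w) = (cexp z * cexp w)%C.
Proof.
unfold cexp. apply C_ext; simpl; unfold Re, Im;
rewrite exp_plus, ?cos_plus, ?sin_plus; ring.
Qed.

Lemma cexp_0 : cexp 0 = RtoC 1.
Proof. unfold cexp; apply C_ext; simpl; rewrite exp_0, ?cos_0, ?sin_0; ring. Qed.

Lemma Cmod_cexp z : Cmod (cexp z) = exp (Re z).
Proof.
unfold Cmod, cexp; simpl.
replace (_ + _) with ((exp (Re z)) ^ 2).
- rewrite sqrt_pow2; [easy|apply Rlt_le, exp_pos].
- pose proof (sin2_cos2 (Im z)) as E; unfold Rsqr in E.
  transitivity (exp (Re z) ^ 2 * (sin (Im z) * sin (Im z) + cos (Im z) * cos (Im z)));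
  [rewrite E|]; ring.
Qed.

Lemma cder_cexp z t : cder (fun t => cexp (t * z)) t (z * cexp (t * z))%C.
Proof.
assert (E : is_derive (fun t : R => exp (Re (t * z))) t (Re z * exp (Re (t * z)))).
{ apply (is_derive_ext (fun t : R => exp (Re z * t))); [intros; f_equal; simpl; unfold Re; ring|].
  replace (Re (t * z)%C) with (Re z * t) by (simpl; unfold Re; ring).
  auto_derive; [easy|ring]. }
assert (F : is_derive (fun t : R => cos (Im (t * z))) t (- Im z * sin (Im (t * z)))).
{ apply (is_derive_ext (fun t : R => cos (Im z * t))); [intros; f_equal; simpl; unfold Im; ring|].
  replace (Im (t * z)%C) with (Im z * t) by (simpl; unfold Im; ring).
  auto_derive; [easy|ring]. }
assert (G : is_derive (fun t : R => sin (Im (t * z))) t (Im z * cos (Im (t * z)))).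
{ apply (is_derive_ext (fun t : R => sin (Im z * t))); [intros; f_equal; simpl; unfold Im; ring|].
  replace (Im (t * z)%C) with (Im z * t) by (simpl; unfold Im; ring).
  auto_derive; [easy|ring]. }
split; (evar_last; [unfold cexp; simpl; apply is_derive_mult_R; [exact E|first [exact F|exact
  G]]|]);
unfold cexp, Re, Im; simpl; ring.
Qed.

Lemma exp_Re_le z t : 0 <= t <= 1 -> exp (Re (t * z)%C) <= exp (Cmod z).
Proof.
intros Ht. assert (Re (t * z)%C <= Cmod z).
{ eapply Rle_trans; [apply Rle_abs|]. eapply Rle_trans; [apply re_le_Cmod|].
  rewrite Cmod_mult, Cmod_R, Rabs_right by lra. pose proof (Cmod_ge_0 z). nra. }
destruct H; [now apply Rlt_le, exp_increasing|rewrite H; lra].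
Qed.

Lemma cexp_sub_1_le z : Cmod (cexp z - 1) <= 2 * (Cmod z * exp (Cmod z)).
Proof.
replace (cexp z - 1)%C with (- (cexp (0 * z) - cexp (1 * z)))%C.
2:{ rewrite Cmult_0_l, Cmult_1_l, cexp_0; ring. }
rewrite Cmod_opp.
apply (cder_mean_value (fun t => cexp (t * z)) (fun t => z * cexp (t * z))%C).
- intros x _; apply cder_cexp.
- intros x Hx. rewrite Cmod_mult, Cmod_cexp. apply Rmult_le_compat_l; [apply Cmod_ge_0|].
  now apply exp_Re_le.
Qed.

Lemma exp_le a b : a <= b -> exp a <= exp b.
Proof. intros [H| ->]; [now apply Rlt_le, exp_increasing|lra]. Qed.

(** Along the segment t z the derivative is z (cexp (t z) - 1), to which [cexp_sub_1_le] applies. *)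
Lemma cexp_taylor2_le z : Cmod (cexp z - 1 - z) <= 4 * (Cmod z ^ 2 * exp (Cmod z)).
Proof.
replace (cexp z - 1 - z)%C with (- ((cexp (0 * z) - 0 * z) - (cexp (1 * z) - 1 * z)))%C.
2:{ rewrite !Cmult_0_l, !Cmult_1_l, cexp_0; ring. }
rewrite Cmod_opp. replace (4 * (Cmod z ^ 2 * exp (Cmod z)))
  with (2 * (Cmod z * (2 * (Cmod z * exp (Cmod z))))) by ring.
apply (cder_mean_value (fun t => cexp (t * z) - t * z)%C (fun t => z * (cexp (t * z) - 1))%C).
- intros x _. eapply cder_eq; [apply cder_minus; [apply cder_cexp|]|].
  + apply (cder_mult _ _ _ _ _ (cder_RtoC _ _ _ (is_derive_id x)) (cder_const z x)).
  + unfold one; simpl. ring.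
- intros x Hx. rewrite Cmod_mult. apply Rmult_le_compat_l; [apply Cmod_ge_0|].
  eapply Rle_trans; [apply cexp_sub_1_le|].
  assert (Cmod (x * z) <= Cmod z).
  { rewrite Cmod_mult, Cmod_R, Rabs_right by lra. pose proof (Cmod_ge_0 z). nra. }
  apply Rmult_le_compat_l; [lra|].
  apply Rmult_le_compat; [apply Cmod_ge_0|apply Rlt_le, exp_pos|easy|now apply exp_le].
Qed.

(** * Differences of monomials *)

(** The function z^(m-i) conj(z)^(-j) a(log |z|^2). Keeping m apart from i means that
    differentiation only raises i and j, so the family stays closed with natural exponents; the
    amplitude a carries the complex power of |z|. *)
Definition monomial (m i j : nat) (a : R -> C) (z : C) : C :=
  (z ^ m * (/ z) ^ i * (/ Cconj z) ^ j * a (ln (Re z ^ 2 + Im z ^ 2)))%C.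

Lemma Cconj_neq_0 (z : C) : z <> 0 -> Cconj z <> 0.
Proof. intros H. apply Cmod_gt_0. rewrite Cmod_conj. now apply Cmod_gt_0. Qed.

Lemma Cinv_neq_0 (z : C) : z <> 0 -> (/ z)%C <> 0.
Proof.
intros H E. assert (E' := Cinv_r z H). rewrite E, Cmult_0_r in E'. now apply C1_nz.
Qed.

(** In the real direction log |w|^2 has derivative 1/w + 1/conj(w), so differentiating the amplitude
    again yields members of the family. *)
Lemma cder_monomial m i j a a' (z : C) (x : R) : (z + x)%C <> 0 -> (forall L, cder a L (a' L)) ->
  cder (fun t => monomial m i j a (z + t)) x
    ((INR m - INR i) * monomial m (S i) j a (z + x)
     - INR j * monomial m i (S j) a (z + x)
     + monomial m (S i) j a' (z + x) + monomial m i (S j) a' (z + x))%C.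
Proof.
intros Hz Ha.
set (w := (z + x)%C) in *.
assert (Hw := Cconj_neq_0 w Hz). assert (Hp := Cmod2_neq_0 w Hz).
assert (D : cder (fun t => (z + t)%C) x 1).
{ eapply cder_eq; [apply cder_plus; [apply cder_const|apply cder_RtoC, is_derive_id]|].
  unfold one; simpl; ring. }
assert (D2 := is_derive_Cmod2 _ _ _ D). cbv beta in D2.
assert (D3 : is_derive (fun t : R => ln (Re (z + t)%C ^ 2 + Im (z + t)%C ^ 2)) x
   (2 * Re w / (Re w ^ 2 + Im w ^ 2))).
{ evar_last; [apply (is_derive_comp ln (fun t : R => Re (z + t)%C ^ 2 + Im (z + t)%C ^ 2) x _ _
    (is_derive_ln _ Hp) D2)|].
  unfold scal; simpl; unfold mult; simpl. fold w. unfold Re, Im in *; simpl in *. field. lra. }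
assert (D4 := cder_comp a _ x _ _ (Ha _) D3). cbv beta in D4. fold w in D4.
assert (I1 := cder_inv _ _ _ D Hz).
assert (I2 := cder_inv _ _ _ (cder_conj _ _ _ D) Hw).
assert (P0 := cder_pow _ _ _ m D Hz).
assert (P1 := cder_pow _ _ _ i I1 (Cinv_neq_0 _ Hz)).
assert (P2 := cder_pow _ _ _ j I2 (Cinv_neq_0 _ Hw)).
eapply cder_eq.
{ unfold monomial. apply (cder_mult _ _ _ _ _ (cder_mult _ _ _ _ _ (cder_mult _ _ _ _ _ P0 P1)
  P2) D4). }
fold w. unfold monomial.
assert (E : RtoC (2 * Re w / (Re w ^ 2 + Im w ^ 2)) = (/ w + / Cconj w)%C).
{ destruct w as [u v]; unfold Re, Im in *; cbn [fst snd] in *.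
  apply C_ext; unfold Cinv, Cplus, Cconj, RtoC, Re, Im; cbn [fst snd]; field; lra. }
rewrite E.
replace (Cconj 1) with (RtoC 1) by (apply C_ext; simpl; ring).
set (A := a _). set (A' := a' _).
assert (N1 := Cinv_neq_0 _ Hz). assert (N2 := Cinv_neq_0 _ Hw).
rewrite !Cpow_S.
set (p := (w ^ m)%C). set (q := ((/ w) ^ i)%C). set (r := ((/ Cconj w) ^ j)%C).
set (wc := Cconj w) in *.
field. auto.
Qed.

Definition cdiff (f : C -> C) (z : C) : C := (f z - f (z + 1))%C.

Fixpoint iter_cdiff (K : nat) (f : C -> C) : C -> C :=
  match K with 0%nat => f | S k => cdiff (iter_cdiff k f) end.

Lemma cder_iter_cdiff K (f f' : C -> C) :
  (forall (z : C) (x : R), (z + x)%C <> 0 -> cder (fun t => f (z + t)%C) x (f' (z + x)%C)) ->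
  forall (z : C) (x : R), (forall y : R, 0 <= y <= INR K -> (z + x + y)%C <> 0) ->
  cder (fun t => iter_cdiff K f (z + t)) x (iter_cdiff K f' (z + x)).
Proof.
intros Hf. induction K as [|K IH]; intros z x Hz.
- apply Hf. specialize (Hz 0). simpl in Hz.
  replace (z + x)%C with (z + x + 0)%C by ring. apply Hz; lra.
- simpl. unfold cdiff. apply cder_minus.
  + apply IH. intros y Hy. apply Hz. rewrite S_INR. lra.
  + apply (cder_ext (fun t => iter_cdiff K f (z + 1 + t))).
    { intros t; f_equal; ring. }
    replace (z + x + 1)%C with (z + 1 + x)%C by ring.
    apply IH. intros y Hy. replace (z + 1 + x + y)%C with (z + x + (1 + y)%R)%C.
    * apply Hz. rewrite S_INR. lra.
    * rewrite RtoC_plus. ring.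
Qed.

Lemma iter_cdiff_plus K f g z :
  iter_cdiff K (fun w => f w + g w)%C z = (iter_cdiff K f z + iter_cdiff K g z)%C.
Proof. revert z; induction K; intros z; simpl; [easy|]. unfold cdiff; rewrite !IHK; ring. Qed.

Lemma iter_cdiff_scal K c f z : iter_cdiff K (fun w => c * f w)%C z = (c * iter_cdiff K f z)%C.
Proof. revert z; induction K; intros z; simpl; [easy|]. unfold cdiff; rewrite !IHK; ring. Qed.

Lemma iter_cdiff_minus K f g z :
  iter_cdiff K (fun w => f w - g w)%C z = (iter_cdiff K f z - iter_cdiff K g z)%C.
Proof. revert z; induction K; intros z; simpl; [easy|]. unfold cdiff; rewrite !IHK; ring. Qed.

(** This bound uses no derivative; it serves near the origin, where the segment of differencing may
    cross the singularity. *)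
Lemma iter_cdiff_crude K f B : forall z, (forall i, (i <= K)%nat -> Cmod (f (z + INR i)%C) <= B) ->
  Cmod (iter_cdiff K f z) <= 2 ^ K * B.
Proof.
induction K as [|K IH]; intros z H; simpl.
- specialize (H 0%nat (le_n _)). simpl in H. replace (z + 0)%C with z in H by ring. lra.
- unfold cdiff. unfold Cminus. eapply Rle_trans; [apply Cmod_triangle|]. rewrite Cmod_opp.
  assert (Cmod (iter_cdiff K f z) <= 2 ^ K * B) by (apply IH; intros i Hi; apply H; lia).
  assert (Cmod (iter_cdiff K f (z + 1)) <= 2 ^ K * B).
  { apply IH; intros i Hi. replace (z + 1 + INR i)%C with (z + INR (S i))%C.
    - apply H; lia.
    - rewrite S_INR, RtoC_plus; ring. }
  lra.
Qed.

(* Differentiating a monomial raises its total order i + j by one, so a K-fold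
   difference gains K powers of z. *)
Lemma iter_cdiff_monomial_le m K : forall i j, exists c, 0 <= c /\
  forall (a : nat -> R -> C) l (z : C) B,
  (forall l L, cder (a l) L (a (S l) L)) ->
  (forall x : R, 0 <= x <= INR K -> (z + x)%C <> 0) ->
  (forall (x : R) i' j' l', 0 <= x <= INR K -> (i' + j' = i + j + K)%nat -> (l' <= l + K)%nat ->
     Cmod (monomial m i' j' (a l') (z + x)) <= B) ->
  Cmod (iter_cdiff K (monomial m i j (a l)) z) <= c * B.
Proof.
induction K as [|K IH]; intros i j.
- exists 1; split; [lra|]. intros a l z B _ _ HB. simpl.
  replace z with (z + 0)%C by ring. rewrite Rmult_1_l. apply HB; try lia. simpl; lra.
- destruct (IH (S i) j) as (c1 & Hc1 & H1). destruct (IH i (S j)) as (c2 & Hc2 & H2).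
  (* One term for each of the four monomials of [cder_monomial]; the 2 below is that of
     [cder_mean_value]. *)
  set (k := (Rabs (INR m - INR i) * c1 + INR j * c2 + c1 + c2)).
  assert (Hk : 0 <= k).
  { unfold k. pose proof (Rabs_pos (INR m - INR i)). pose proof (pos_INR j). nra. }
  exists (2 * k). split; [lra|]. intros a l z B Ha Hz HB.
  replace (2 * k * B) with (2 * (k * B)) by ring.
  simpl. unfold cdiff.
  set (f' := fun w => ((INR m - INR i) * monomial m (S i) j (a l) w
     - INR j * monomial m i (S j) (a l) w
     + monomial m (S i) j (a (S l)) w + monomial m i (S j) (a (S l)) w)%C).
  replace (iter_cdiff K (monomial m i j (a l)) z)
    with (iter_cdiff K (monomial m i j (a l)) (z + 0)) by (f_equal; ring).
  apply (cder_mean_value (fun t => iter_cdiff K (monomial m i j (a l)) (z + t))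
    (fun t => iter_cdiff K f' (z + t))).
  + intros x Hx. apply cder_iter_cdiff.
    * intros w y Hw. apply cder_monomial; auto.
    * intros y Hy. rewrite <- Cplus_assoc, <- RtoC_plus. apply Hz. rewrite S_INR; lra.
  + intros x Hx. unfold f'.
    rewrite !iter_cdiff_plus, iter_cdiff_minus, !iter_cdiff_scal.
    assert (Hz' : forall y : R, 0 <= y <= INR K -> (z + x + y)%C <> 0).
    { intros y Hy. rewrite <- Cplus_assoc, <- RtoC_plus. apply Hz. rewrite S_INR; lra. }
    assert (HB' : forall (y : R) i' j' l', 0 <= y <= INR K -> (i' + j' = i + j + S K)%nat ->
      (l' <= l + S K)%nat -> Cmod (monomial m i' j' (a l') (z + x + y)) <= B).
    { intros y i' j' l' Hy E El. rewrite <- Cplus_assoc, <- RtoC_plus. apply HB; auto.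
      rewrite S_INR; lra. }
    assert (A1 : Cmod (iter_cdiff K (monomial m (S i) j (a l)) (z + x)) <= c1 * B).
    { apply H1; auto. intros; apply HB'; auto; lia. }
    assert (A2 : Cmod (iter_cdiff K (monomial m i (S j) (a l)) (z + x)) <= c2 * B).
    { apply H2; auto. intros; apply HB'; auto; lia. }
    assert (A3 : Cmod (iter_cdiff K (monomial m (S i) j (a (S l))) (z + x)) <= c1 * B).
    { apply H1; auto. intros; apply HB'; auto; lia. }
    assert (A4 : Cmod (iter_cdiff K (monomial m i (S j) (a (S l))) (z + x)) <= c2 * B).
    { apply H2; auto. intros; apply HB'; auto; lia. }
    eapply Rle_trans; [apply Cmod_triangle|].
    eapply Rle_trans; [apply Rplus_le_compat_r, Cmod_triangle|]. unfold Cminus at 1.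
    eapply Rle_trans; [apply Rplus_le_compat_r, Rplus_le_compat_r, Cmod_triangle|].
    rewrite Cmod_opp, !Cmod_mult, <- RtoC_minus, !Cmod_R, (Rabs_right (INR j))
      by (apply Rle_ge, pos_INR).
    pose proof (Rmult_le_compat_l _ _ _ (Rabs_pos (INR m - INR i)) A1).
    pose proof (Rmult_le_compat_l _ _ _ (pos_INR j) A2).
    unfold k. lra.
Qed.

(** The l-th derivative in L of exp(-W L). At L = log |z|^2 and l = 0 it is |z|^(-2W). *)
Definition amp (l : nat) (W : C) (L : R) : C := ((- W) ^ l * cexp (L * (- W)))%C.

(** The derivative of [amp l W L] with respect to W, obtained by differentiating the relation
    [amp_S]. *)
Fixpoint damp (l : nat) (W : C) (L : R) : C :=
  match l with
  | 0%nat => (- L * cexp (L * (- W)))%C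
  | S k => (- amp k W L - W * damp k W L)%C
  end.

(** The remainder of the first-order Taylor expansion of [amp l] in W with increment h. *)
Definition rem2 (W h : C) (l : nat) (L : R) : C :=
  (amp l (W + h) L - amp l W L - h * damp l W L)%C.

Lemma cder_amp W l L : cder (amp l W) L (amp (S l) W L).
Proof.
unfold amp. eapply cder_eq; [apply cder_scal, cder_cexp|]. rewrite Cpow_S; ring.
Qed.

Lemma cder_damp W l L : cder (damp l W) L (damp (S l) W L).
Proof.
revert L; induction l as [|l IH]; intros L.
- eapply cder_eq.
  + simpl. apply cder_mult; [|apply cder_cexp].
    apply (cder_ext (fun t => (-1) * t)%C); [intros; ring|].
    apply cder_scal, (cder_RtoC _ _ _ (is_derive_id L)).
  + unfold one; simpl. unfold amp; simpl. ring.
- change (cder (fun t => - amp l W t - W * damp l W t)%C L (- amp (S l) W L - W * damp (S l) W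
  L)%C).
  apply cder_minus; [|now apply cder_scal].
  apply (cder_ext (fun t => (-1) * amp l W t)%C); [intros; ring|].
  eapply cder_eq; [apply cder_scal, cder_amp|ring].
Qed.

Lemma cder_rem2 W h l L : cder (rem2 W h l) L (rem2 W h (S l) L).
Proof.
apply cder_minus; [apply cder_minus|apply cder_scal]; auto using cder_amp, cder_damp.
Qed.

Lemma amp_S l W L : amp (S l) W L = (- W * amp l W L)%C.
Proof. unfold amp; rewrite Cpow_S; ring. Qed.

Lemma Cmod_amp l W L : Cmod (amp l W L) = Cmod W ^ l * exp (- L * Re W).
Proof.
unfold amp. rewrite Cmod_mult, Cmod_pow, Cmod_opp, Cmod_cexp. do 2 f_equal.
destruct W; unfold Re; simpl; ring.
Qed.

Lemma Re_plus (z w : C) : Re (z + w) = Re z + Re w.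
Proof. easy. Qed.

Lemma amp_shift_le l W h L r : 0 <= L -> Cmod W <= r -> Cmod h <= 1 ->
  Cmod (amp l (W + h) L) <= (r + 1) ^ l * exp (- L * Re W + L * Cmod h).
Proof.
intros HL HW Hh. rewrite Cmod_amp. pose proof (Cmod_ge_0 W).
apply Rmult_le_compat; [apply pow_le, Cmod_ge_0|apply Rlt_le, exp_pos| |].
- apply pow_incr. split; [apply Cmod_ge_0|]. pose proof (Cmod_triangle W h). lra.
- apply exp_le. rewrite Re_plus. pose proof (re_le_Cmod h). apply Rabs_le_between in H0.
  assert (0 <= L * (Cmod h + Re h)) by (apply Rmult_le_pos; lra). lra.
Qed.

Lemma amp_diff_le l W h L r : 0 <= L -> Cmod W <= r -> Cmod h <= 1 ->
  Cmod (amp l (W + h) L - amp l W L)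
  <= (INR l + 2) * (r + 1) ^ l * Cmod h * (1 + L) * exp (- L * Re W + L * Cmod h).
Proof.
intros HL HW Hh. assert (HW0 := Cmod_ge_0 W). assert (Hh0 := Cmod_ge_0 h).
set (E := exp (- L * Re W + L * Cmod h)). assert (HE : 0 < E) by apply exp_pos.
induction l as [|l IH].
- unfold amp. replace (L * - (W + h))%C with (L * - W + L * - h)%C by ring.
  rewrite cexp_plus. simpl Cpow.
  replace (1 * (cexp (L * - W) * cexp (L * - h)) - 1 * cexp (L * - W))%C
    with (cexp (L * - W) * (cexp (L * - h) - 1))%C by ring.
  rewrite Cmod_mult, Cmod_cexp.
  assert (HM : Cmod (L * - h) = L * Cmod h)
    by (rewrite Cmod_mult, Cmod_opp, Cmod_R, Rabs_right by lra; ring).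
  pose proof (cexp_sub_1_le (L * - h)) as H1. rewrite HM in H1.
  replace (Re (L * - W)%C) with (- L * Re W) by (destruct W; unfold Re; simpl; ring).
  apply Rle_trans with (exp (- L * Re W) * (2 * (L * Cmod h * exp (L * Cmod h)))).
  { apply Rmult_le_compat_l; [apply Rlt_le, exp_pos|easy]. }
  replace E with (exp (- L * Re W) * exp (L * Cmod h)) by (symmetry; apply exp_plus).
  simpl INR. simpl pow.
  set (e := exp (- L * Re W) * exp (L * Cmod h)) in *.
  replace (exp (- L * Re W) * (2 * (L * Cmod h * exp (L * Cmod h)))) with (2 * Cmod h * L * e)
    by (unfold e; ring).
  apply Rmult_le_compat_r; [unfold e; apply Rlt_le, Rmult_lt_0_compat; apply exp_pos|]. nra.
- rewrite !amp_S.
  replace (- (W + h) * amp l (W + h) L - - W * amp l W L)%C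
    with (- (W * (amp l (W + h) L - amp l W L)) + - (h * amp l (W + h) L))%C by ring.
  eapply Rle_trans; [apply Cmod_triangle|]. rewrite !Cmod_opp, !Cmod_mult.
  pose proof (amp_shift_le l W h L r HL HW Hh) as HA. fold E in HA.
  set (P := (r + 1) ^ l) in *. assert (HP : 0 < P) by (apply pow_lt; lra).
  rewrite S_INR. simpl pow. fold P.
  set (D := (INR l + 2) * P * Cmod h * (1 + L) * E) in *.
  assert (HD : 0 <= D).
  { unfold D. pose proof (pos_INR l). repeat apply Rmult_le_pos; lra. }
  assert (Cmod W * Cmod (amp l (W + h) L - amp l W L) <= (r + 1) * D).
  { apply Rmult_le_compat; try apply Cmod_ge_0; lra. }
  assert (Cmod h * Cmod (amp l (W + h) L) <= Cmod h * (P * E))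
    by (apply Rmult_le_compat_l; easy).
  assert (Cmod h * (P * E) <= (r + 1) * P * Cmod h * (1 + L) * E).
  { replace (Cmod h * (P * E)) with (1 * 1 * (P * Cmod h * E)) by ring.
    replace ((r + 1) * P * Cmod h * (1 + L) * E) with ((r + 1) * (1 + L) * (P * Cmod h * E)) by
      ring.
    apply Rmult_le_compat_r; [repeat apply Rmult_le_pos; lra|]. nra. }
  replace ((INR l + 1 + 2) * ((r + 1) * P) * Cmod h * (1 + L) * E)
    with ((r + 1) * D + (r + 1) * P * Cmod h * (1 + L) * E) by (unfold D; ring). lra.
Qed.

Lemma rem2_S W h l L :
  rem2 W h (S l) L = (- W * rem2 W h l L - h * (amp l (W + h) L - amp l W L))%C.
Proof. unfold rem2. rewrite !amp_S. cbn [damp]. ring. Qed.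

(** Induction on l through [rem2_S]. The factor |h|^2 is what yields complex differentiability; the
    powers of 1 + L are logarithms of |z|, to be absorbed by one more power of |z|. *)
Lemma rem2_le l r : 0 <= r -> exists c, 0 <= c /\ forall W h L, 0 <= L -> Cmod W <= r -> Cmod h
  <= 1 ->
  Cmod (rem2 W h l L) <= c * Cmod h ^ 2 * (1 + L) ^ 2 * exp (- L * Re W + L * Cmod h).
Proof.
intros Hr. induction l as [|l (c & Hc & IH)].
- exists 4. split; [lra|]. intros W h L HL HW Hh. unfold rem2, damp, amp.
  replace (L * - (W + h))%C with (L * - W + L * - h)%C by ring.
  rewrite cexp_plus. simpl Cpow.
  replace (1 * (cexp (L * - W) * cexp (L * - h)) - 1 * cexp (L * - W) - h * (- L * cexp (L * -
    W)))%C
    with (cexp (L * - W) * (cexp (L * - h) - 1 - L * - h))%C by ring.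
  rewrite Cmod_mult, Cmod_cexp.
  assert (HM : Cmod (L * - h) = L * Cmod h)
    by (rewrite Cmod_mult, Cmod_opp, Cmod_R, Rabs_right by lra; ring).
  pose proof (cexp_taylor2_le (L * - h)) as H1. rewrite HM in H1.
  replace (Re (L * - W)%C) with (- L * Re W) by (destruct W; unfold Re; simpl; ring).
  eapply Rle_trans; [apply Rmult_le_compat_l; [apply Rlt_le, exp_pos|exact H1]|].
  rewrite exp_plus. set (e := exp (- L * Re W)). set (e' := exp (L * Cmod h)).
  assert (0 < e * e') by (apply Rmult_lt_0_compat; apply exp_pos).
  replace (e * (4 * ((L * Cmod h) ^ 2 * e'))) with (4 * Cmod h ^ 2 * L ^ 2 * (e * e')) by ring.
  apply Rmult_le_compat_r; [lra|]. apply Rmult_le_compat_l; [|nra].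
  pose proof (pow2_ge_0 (Cmod h)); lra.
- exists (r * c + (INR l + 2) * (r + 1) ^ l).
  assert (HP : 0 <= (INR l + 2) * (r + 1) ^ l).
  { apply Rmult_le_pos; [pose proof (pos_INR l); lra|apply pow_le; lra]. }
  split; [nra|]. intros W h L HL HW Hh.
  rewrite rem2_S. unfold Cminus at 1. eapply Rle_trans; [apply Cmod_triangle|].
  rewrite Cmod_opp, !Cmod_mult, Cmod_opp.
  specialize (IH W h L HL HW Hh). pose proof (amp_diff_le l W h L r HL HW Hh) as HD.
  set (E := exp (- L * Re W + L * Cmod h)) in *. assert (HE : 0 < E) by apply exp_pos.
  assert (Hh0 := Cmod_ge_0 h).
  set (Q := (INR l + 2) * (r + 1) ^ l) in *.
  assert (Cmod W * Cmod (rem2 W h l L) <= r * (c * Cmod h ^ 2 * (1 + L) ^ 2 * E))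
    by (apply Rmult_le_compat; try apply Cmod_ge_0; easy).
  assert (Cmod h * Cmod (amp l (W + h) L - amp l W L) <= Cmod h * (Q * Cmod h * (1 + L) * E))
    by (apply Rmult_le_compat_l; easy).
  assert (Cmod h * (Q * Cmod h * (1 + L) * E) <= Q * Cmod h ^ 2 * (1 + L) ^ 2 * E).
  { replace (Cmod h * (Q * Cmod h * (1 + L) * E)) with (Q * Cmod h ^ 2 * E * (1 + L)) by ring.
    replace (Q * Cmod h ^ 2 * (1 + L) ^ 2 * E) with (Q * Cmod h ^ 2 * E * (1 + L) ^ 2) by ring.
    apply Rmult_le_compat_l; [|nra].
    apply Rmult_le_pos; [apply Rmult_le_pos; [easy|apply pow2_ge_0]|lra]. }
  lra.
Qed.

(** * The lattice Z[eta] and its character *)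

Definition alpha (p : Z * Z) : C := qint (fst p) (snd p).

Lemma eta_eq : eta = (1 / 2, sqrt 7 / 2).
Proof. unfold eta. apply C_ext; unfold Cdiv, Cinv, Cmult, Cplus, Ci, RtoC, Re, Im; cbn [fst snd];
  field. Qed.

Lemma Re_alpha p : Re (alpha p) = IZR (fst p) + IZR (snd p) / 2.
Proof. unfold alpha, qint. rewrite eta_eq. unfold Re; simpl; field. Qed.

Lemma Im_alpha p : Im (alpha p) = IZR (snd p) * sqrt 7 / 2.
Proof. unfold alpha, qint. rewrite eta_eq. unfold Im; simpl; field. Qed.

Lemma alpha_additive : additive alpha.
Proof.
intros p q. apply C_ext.
- rewrite Re_plus, !Re_alpha. unfold padd; cbn [fst snd]. rewrite !plus_IZR. field.
- change (Im (alpha (padd p q)) = Im (alpha p) + Im (alpha q)).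
  rewrite !Im_alpha. unfold padd; cbn [fst snd]. rewrite !plus_IZR. field.
Qed.

Lemma alpha_int k : alpha (k, 0%Z) = RtoC (IZR k).
Proof. apply C_ext; [rewrite Re_alpha|rewrite Im_alpha]; simpl; field. Qed.

Lemma alpha_norm p : Re (alpha p) ^ 2 + Im (alpha p) ^ 2 = IZR (qnorm (fst p) (snd p)).
Proof.
rewrite Re_alpha, Im_alpha. unfold qnorm.
replace (fst p ^ 2 + fst p * snd p + 2 * snd p ^ 2)%Z
  with (fst p * fst p + fst p * snd p + 2 * (snd p * snd p))%Z by ring.
rewrite !plus_IZR, !mult_IZR.
replace ((IZR (snd p) * sqrt 7 / 2) ^ 2) with (IZR (snd p) ^ 2 * (sqrt 7 * sqrt 7) / 4) by field.
rewrite sqrt_sqrt by lra. field.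
Qed.

Lemma Cmod2_alpha p : Cmod (alpha p) ^ 2 = IZR (qnorm (fst p) (snd p)).
Proof. now rewrite Cmod2_alt, alpha_norm. Qed.

Lemma qnorm_pos p : p <> (0, 0)%Z -> (1 <= qnorm (fst p) (snd p))%Z.
Proof.
intros H. unfold qnorm. destruct p as [a b]; cbn [fst snd].
assert (a <> 0 \/ b <> 0)%Z by (destruct (Z.eq_dec a 0), (Z.eq_dec b 0); subst; intuition).
nia.
Qed.

Lemma Cmod_alpha_ge_1 p : p <> (0, 0)%Z -> 1 <= Cmod (alpha p).
Proof.
intros H. apply qnorm_pos, IZR_le in H. rewrite <- Cmod2_alpha in H.
pose proof (Cmod_ge_0 (alpha p)). nra.
Qed.

Lemma alpha_psize p : p <> (0, 0)%Z -> psize p / 4 <= Cmod (alpha p).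
Proof.
intros H. pose proof (qnorm_pos p H) as H1.
apply Rsqr_incr_0_var; [|apply Cmod_ge_0]. unfold Rsqr.
replace (Cmod (alpha p) * Cmod (alpha p)) with (Cmod (alpha p) ^ 2) by ring.
rewrite Cmod2_alpha.
assert (((1 + Z.abs (fst p) + Z.abs (snd p)) * (1 + Z.abs (fst p) + Z.abs (snd p))
   <= 16 * qnorm (fst p) (snd p))%Z).
{ unfold qnorm in *. destruct p as [a b]; cbn [fst snd] in *. nia. }
apply IZR_le in H0. rewrite !mult_IZR, !plus_IZR in H0. fold (psize p) in H0. lra.
Qed.

Lemma Cmod_alpha_le p : Cmod (alpha p) <= 2 * psize p.
Proof.
apply Rsqr_incr_0_var; [|pose proof (psize_pos p); lra]. unfold Rsqr.
replace (Cmod (alpha p) * Cmod (alpha p)) with (Cmod (alpha p) ^ 2) by ring.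
rewrite Cmod2_alpha.
assert ((qnorm (fst p) (snd p) <=
  4 * ((1 + Z.abs (fst p) + Z.abs (snd p)) * (1 + Z.abs (fst p) + Z.abs (snd p))))%Z).
{ unfold qnorm in *. destruct p as [a b]; cbn [fst snd] in *. nia. }
apply IZR_le in H. rewrite !mult_IZR, !plus_IZR in H. fold (psize p) in H. lra.
Qed.

Lemma alpha_neq_0 p : p <> (0, 0)%Z -> alpha p <> 0.
Proof. intros H. apply Cmod_gt_0. pose proof (Cmod_alpha_ge_1 p H). lra. Qed.

Definition e1 : Z * Z := (1, 0)%Z.

Lemma iter_pdiff_alpha K (f : C -> C) p :
  iter_pdiff e1 K (fun q => f (alpha q)) p = iter_cdiff K f (alpha p).
Proof.
revert p; induction K as [|K IH]; intros p; simpl; [easy|].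
unfold pdiff, cdiff. rewrite !IH, alpha_additive. unfold e1 at 1. now rewrite alpha_int.
Qed.

Definition chi7 (j : Z) : R := IZR (legendre j 7).

Lemma legendre_mod j : legendre j 7 = legendre (j mod 7) 7.
Proof. unfold legendre. now rewrite Zmod_mod. Qed.

Lemma chi7_mean_zero : mean_zero_mod7 chi7.
Proof.
split.
- intros j. unfold chi7. rewrite legendre_mod, (legendre_mod j). do 2 f_equal.
  replace (j + 7)%Z with (j + 1 * 7)%Z by ring. apply Z_mod_plus_full.
- unfold chi7. change (IZR 0 + IZR 1 + IZR 1 + IZR (-1) + IZR 1 + IZR (-1) + IZR (-1) = 0). ring.
Qed.

Lemma chi7_bound j : Rabs (chi7 j) <= 1.
Proof.
unfold chi7. rewrite legendre_mod.
destruct (mod7_cases j) as [->|[->|[->|[->|[->|[->| ->]]]]]];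
match goal with |- Rabs (IZR ?x) <= 1 => let y := eval vm_compute in x in change x with y end;
apply Rabs_le; lra.
Qed.

(** Modulo 7 the cubic form is the cube of the residue a + 4 b, and a cube has the same Legendre
    symbol as its root. *)
Lemma eps_residue p : eps (fst p) (snd p) = legendre (residue p) 7.
Proof.
unfold eps. rewrite legendre_mod, (legendre_mod (residue p)).
replace (fst p ^ 3 - 2 * fst p ^ 2 * snd p - fst p * snd p ^ 2 + snd p ^ 3)%Z
  with (residue p ^ 3 + (- 2 * fst p ^ 2 * snd p - 7 * fst p * snd p ^ 2 - 9 * snd p ^ 3) * 7)%Z
  by (unfold residue; ring).
rewrite Z_mod_plus_full.
replace ((residue p ^ 3) mod 7)%Z with (((residue p mod 7) ^ 3) mod 7)%Z by apply Z.mod_pow_l.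
destruct (mod7_cases (residue p)) as [->|[->|[->|[->|[->|[->| ->]]]]]]; reflexivity.
Qed.

Lemma Rpower_neg_le x y a : 0 < x -> x <= y -> 0 <= a -> Rpower y (- a) <= Rpower x (- a).
Proof.
intros Hx Hy Ha. rewrite !Rpower_Ropp. apply Rinv_le_contravar; [apply exp_pos|].
apply Rle_Rpower_l; lra.
Qed.

Lemma Cmod_monomial m i j a (z : C) : z <> 0 ->
  Cmod (monomial m i j a z)
  = Rpower (Cmod z) (INR m - INR (i + j)) * Cmod (a (ln (Re z ^ 2 + Im z ^ 2))).
Proof.
intros Hz. unfold monomial. assert (H := Hz). apply Cmod_gt_0 in H.
rewrite !Cmod_mult, !Cmod_pow, !Cmod_inv, Cmod_conj by auto using Cconj_neq_0.
f_equal. rewrite plus_INR. unfold Rminus. rewrite Rpower_plus, Rpower_Ropp, Rpower_plus.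
rewrite !Rpower_pow by easy. rewrite !pow_inv, Rinv_mult. ring.
Qed.

Lemma Cmod_triangle_rev (z w : C) : Cmod z - Cmod w <= Cmod (z + w).
Proof.
pose proof (Cmod_triangle (z + w) (- w)). rewrite Cmod_opp in H.
replace (z + w + - w)%C with z in H by ring. lra.
Qed.

(** The growth assumed of the amplitudes is the one for which monomials of total order K have size
    |z|^(-t). Far from the origin [iter_cdiff_monomial_le] applies; near it the crude bound does,
    and there m >= 1 makes the monomial vanish at 0. *)
Lemma iter_pdiff_monomial_le m K t : (1 <= m)%nat -> 0 <= t -> exists c, 0 <= c /\
  forall (a : nat -> R -> C) A, (forall l L, cder (a l) L (a (S l) L)) -> 0 <= A ->
  (forall l (z : C), (l <= K)%nat -> 1 <= Cmod z ->
     Cmod (a l (ln (Re z ^ 2 + Im z ^ 2))) <= A * Rpower (Cmod z) (INR K - INR m - t)) ->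
  forall p, Cmod (iter_pdiff e1 K (fun q => monomial m 0 0 (a 0%nat) (alpha q)) p)
    <= c * A * Rpower (psize p) (- t).
Proof.
intros Hm Ht. destruct (iter_cdiff_monomial_le m K 0 0) as (c1 & Hc1 & H1).
(* Beyond this threshold |alpha p + x| >= psize p / 4 - K stays above psize p / 8, hence above 1,
   for all 0 <= x <= K. *)
set (S0 := 8 * (INR K + 2)).
assert (HK := pos_INR K). assert (HS0 : 1 <= S0) by (unfold S0; lra).
set (c2 := 2 ^ K * Rpower (2 * (S0 * (1 + INR K))) (INR K)).
assert (Hc2 : 0 <= c2).
{ apply Rmult_le_pos; [apply pow_le; lra|apply Rlt_le, exp_pos]. }
assert (E8 : 0 < Rpower 8 t) by apply exp_pos.
assert (ES : 0 < Rpower S0 t) by apply exp_pos.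
exists (c1 * Rpower 8 t + c2 * Rpower S0 t). split; [nra|].
intros a A Ha HA Hbd p.
assert (Hmon : forall z : C, 1 <= Cmod z -> forall i' j' l', (l' <= K)%nat -> (i' + j' = K)%nat ->
  Cmod (monomial m i' j' (a l') z) <= A * Rpower (Cmod z) (- t)).
{ intros z Hz i' j' l' Hl E. rewrite Cmod_monomial by (apply Cmod_gt_0; lra).
  rewrite E. eapply Rle_trans; [apply Rmult_le_compat_l; [apply Rlt_le, exp_pos|exact (Hbd l' z
    Hl Hz)]|].
  rewrite <- Rmult_assoc, (Rmult_comm _ A), Rmult_assoc, <- Rpower_plus.
  right; do 2 f_equal; ring. }
rewrite iter_pdiff_alpha. pose proof (psize_pos p) as Hp.
assert (EP : 0 < Rpower (psize p) (- t)) by apply exp_pos.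
destruct (Rle_dec (psize p) S0) as [Hnear|Hfar].
- apply Rle_trans with (c2 * A).
  + unfold c2. rewrite Rmult_assoc. apply iter_cdiff_crude. intros i Hi.
    rewrite INR_IZR_INZ, <- (alpha_int (Z.of_nat i)), <- alpha_additive.
    set (q := padd p (Z.of_nat i, 0%Z)).
    destruct (excluded_middle_informative (q = (0, 0)%Z)) as [->|Hq].
    * unfold monomial. rewrite (additive_0 _ alpha_additive).
      destruct m; [lia|]. rewrite Cpow_S, !Cmult_0_l, Cmod_0.
      apply Rmult_le_pos; [apply Rlt_le, exp_pos|easy].
    * pose proof (Cmod_alpha_ge_1 q Hq) as Hq1.
      rewrite Cmod_monomial by (now apply alpha_neq_0).
      eapply Rle_trans; [apply Rmult_le_compat_l;
         [apply Rlt_le, exp_pos|exact (Hbd 0%nat _ (Nat.le_0_l _) Hq1)]|].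
      rewrite <- Rmult_assoc, (Rmult_comm _ A), Rmult_assoc, <- Rpower_plus, Rmult_comm.
      apply Rmult_le_compat_r; [easy|]. simpl INR.
      apply Rle_trans with (Rpower (Cmod (alpha q)) (INR K)).
      { apply Rle_Rpower; [easy|]. lra. }
      apply Rle_Rpower_l; [easy|]. split; [lra|].
      eapply Rle_trans; [apply Cmod_alpha_le|]. apply Rmult_le_compat_l; [lra|].
      assert (psize q <= psize p + INR K).
      { unfold q, psize, padd; cbn [fst snd]. rewrite Z.add_0_r.
        pose proof (Z.abs_triangle (fst p) (Z.of_nat i)). apply IZR_le in H.
        rewrite plus_IZR in H. replace (Z.abs (Z.of_nat i)) with (Z.of_nat i) in H by lia.
        rewrite <- INR_IZR_INZ in H. apply le_INR in Hi. lra. }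
      nra.
  + assert (1 <= Rpower S0 t * Rpower (psize p) (- t)).
    { apply Rle_trans with (Rpower S0 t * Rpower S0 (- t)).
      - rewrite <- Rpower_plus, Rplus_opp_r, Rpower_O by lra. lra.
      - apply Rmult_le_compat_l; [lra|]. apply Rpower_neg_le; lra. }
    assert (0 <= c2 * A) by nra. assert (0 <= c1 * A) by nra.
    replace ((c1 * Rpower 8 t + c2 * Rpower S0 t) * A * Rpower (psize p) (- t))
      with (c1 * A * (Rpower 8 t * Rpower (psize p) (- t))
        + c2 * A * (Rpower S0 t * Rpower (psize p) (- t))) by ring.
    assert (0 <= c1 * A * (Rpower 8 t * Rpower (psize p) (- t))).
    { apply Rmult_le_pos; [easy|]. nra. }
    nra.
- assert (Hp0 : p <> (0, 0)%Z).
  { intros ->. unfold psize in Hfar; simpl in Hfar. lra. }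
  assert (Hz : psize p / 4 <= Cmod (alpha p)) by now apply alpha_psize.
  assert (Hzx : forall x : R, 0 <= x <= INR K -> psize p / 8 <= Cmod (alpha p + x)).
  { intros x Hx. pose proof (Cmod_triangle_rev (alpha p) x) as HT.
    rewrite Cmod_R, Rabs_right in HT by lra. unfold S0 in Hfar. lra. }
  apply Rle_trans with (c1 * (A * (Rpower 8 t * Rpower (psize p) (- t)))).
  + apply H1; [easy| |].
    * intros x Hx. apply Cmod_gt_0. specialize (Hzx x Hx). lra.
    * intros x i' j' l' Hx Ei El. specialize (Hzx x Hx).
      eapply Rle_trans; [apply Hmon; [unfold S0 in Hfar; lra|lia|lia]|].
      apply Rmult_le_compat_l; [easy|].
      apply Rle_trans with (Rpower (psize p / 8) (- t)).
      { apply Rpower_neg_le; lra. }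
      unfold Rdiv. rewrite <- Rpower_mult_distr by lra.
      assert (Hi : Rpower (/ 8) (- t) = Rpower 8 t).
      { unfold Rpower. rewrite ln_Rinv by lra. f_equal; ring. }
      rewrite Hi. lra.
  + assert (0 <= c2 * A) by nra.
    replace ((c1 * Rpower 8 t + c2 * Rpower S0 t) * A * Rpower (psize p) (- t))
      with (c1 * (A * (Rpower 8 t * Rpower (psize p) (- t)))
        + c2 * A * (Rpower S0 t * Rpower (psize p) (- t))) by ring.
    assert (0 <= c2 * A * (Rpower S0 t * Rpower (psize p) (- t))).
    { apply Rmult_le_pos; [easy|]. nra. } lra.
Qed.

(** * Regularized L-series *)

(** The function alpha^m |alpha|^(-2W), that is, a term of the L-series without its sign. *)
Definition gterm (m : nat) (W : C) (p : Z * Z) : C := monomial m 0 0 (amp 0 W) (alpha p).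

Lemma ln_norm_ge_0 (z : C) : 1 <= Cmod z -> 0 <= ln (Re z ^ 2 + Im z ^ 2).
Proof.
intros H. rewrite <- Cmod2_alt. rewrite <- ln_1. apply ln_le; [lra|]. nra.
Qed.

Lemma exp_ln_norm (z : C) a : 1 <= Cmod z -> exp (- ln (Re z ^ 2 + Im z ^ 2) * a) = Rpower (Cmod
  z) (- (2 * a)).
Proof.
intros H. rewrite <- Cmod2_alt. unfold Rpower. f_equal.
replace (Cmod z ^ 2) with (Cmod z * Cmod z) by ring. rewrite ln_mult by lra. ring.
Qed.

Lemma gterm_diff_le m K W : (1 <= m)%nat -> 0 <= INR K + 2 * Re W - INR m -> exists c,
  forall p, Cmod (iter_pdiff e1 K (gterm m W) p) <= c * Rpower (psize p) (- (INR K + 2 * Re W -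
    INR m)).
Proof.
intros Hm Ht. set (t := INR K + 2 * Re W - INR m) in *.
destruct (iter_pdiff_monomial_le m K t Hm Ht) as (c & Hc & H).
exists (c * (1 + Cmod W) ^ K). intros p.
pose proof (Cmod_ge_0 W) as HW.
apply (H (fun l => amp l W)).
- intros l L; apply cder_amp.
- apply pow_le; lra.
- intros l z Hl Hz. rewrite Cmod_amp, exp_ln_norm by easy.
  replace (- (2 * Re W)) with (INR K - INR m - t) by (unfold t; ring).
  apply Rmult_le_compat_r; [apply Rlt_le, exp_pos|].
  apply Rle_trans with ((1 + Cmod W) ^ l); [apply pow_incr; lra|].
  apply Rle_pow; [lra|easy].
Qed.

Lemma summable_gterm m K W : (1 <= m)%nat -> 2 < INR K + 2 * Re W - INR m ->
  summable (iter_pdiff e1 K (gterm m W)).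
Proof.
intros Hm Ht. destruct (gterm_diff_le m K W Hm) as (c & H); [lra|].
now apply (summable_psize _ c _ Ht).
Qed.

Definition gterm' (m : nat) (W : C) (p : Z * Z) : C := monomial m 0 0 (damp 0 W) (alpha p).

Definition grem (m : nat) (W h : C) (p : Z * Z) : C :=
  (gterm m (W + h) p - gterm m W p - h * gterm' m W p)%C.

Lemma grem_monomial m W h p : grem m W h p = monomial m 0 0 (rem2 W h 0) (alpha p).
Proof. unfold grem, gterm, gterm', monomial, rem2. ring. Qed.

Lemma sqr_1_plus_le L : 0 <= L -> (1 + L) ^ 2 <= 16 * exp (L / 2).
Proof.
intros H. pose proof (exp_ineq1_le (L / 4)).
replace (L / 2) with (L / 4 + L / 4) by field. rewrite exp_plus. nra.
Qed.

(** The margin 5 is 3 for summability, 1 for the factor (1 + L)^2 <= 16 exp(L/2) = 16 |z|, and 1 for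
    exp(L |h|) <= |z|, which uses |h| <= 1/2. *)
Lemma grem_diff_le m K W : (1 <= m)%nat -> 5 <= INR K + 2 * Re W - INR m -> exists c, 0 <= c /\
  forall h p, Cmod h <= / 2 ->
  Cmod (iter_pdiff e1 K (grem m W h) p) <= c * Cmod h ^ 2 * Rpower (psize p) (- (3)).
Proof.
intros Hm Ht.
destruct (iter_pdiff_monomial_le m K 3 Hm) as (c & Hc & H); [lra|].
assert (HW := Cmod_ge_0 W).
assert (Hcs : exists c', 0 <= c' /\ forall l h L, (l <= K)%nat -> 0 <= L -> Cmod h <= 1 ->
  Cmod (rem2 W h l L) <= c' * Cmod h ^ 2 * (1 + L) ^ 2 * exp (- L * Re W + L * Cmod h)).
{ clear. induction K as [|K (c & Hc & IH)].
  - destruct (rem2_le 0 (Cmod W) (Cmod_ge_0 W)) as (c & Hc & H). exists c; split; [easy|].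
    intros l h L Hl HL Hh. replace l with 0%nat by lia. apply H; auto; lra.
  - destruct (rem2_le (S K) (Cmod W) (Cmod_ge_0 W)) as (c' & Hc' & H). exists (c + c'); split;
    [lra|].
    intros l h L Hl HL Hh.
    assert (HE : 0 <= Cmod h ^ 2 * (1 + L) ^ 2 * exp (- L * Re W + L * Cmod h)).
    { apply Rmult_le_pos; [|apply Rlt_le, exp_pos]. apply Rmult_le_pos; apply pow2_ge_0. }
    destruct (Nat.eq_dec l (S K)) as [->|Hl'].
    + specialize (H W h L HL ltac:(lra) Hh). nra.
    + specialize (IH l h L ltac:(lia) HL Hh). nra. }
destruct Hcs as (c' & Hc' & Hrem).
exists (c * (16 * c')). split; [nra|]. intros h p Hh.
replace (c * (16 * c') * Cmod h ^ 2) with (c * (16 * c' * Cmod h ^ 2)) by ring.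
replace (grem m W h) with (fun q => monomial m 0 0 (rem2 W h 0) (alpha q))
  by (extensionality q; now rewrite grem_monomial).
apply (H (fun l => rem2 W h l)).
- intros l L; apply cder_rem2.
- pose proof (pow2_ge_0 (Cmod h)). nra.
- intros l z Hl Hz. set (L := ln (Re z ^ 2 + Im z ^ 2)).
  assert (HL : 0 <= L) by now apply ln_norm_ge_0.
  eapply Rle_trans; [apply (Hrem l h L Hl HL); lra|].
  assert (Hh2 := pow2_ge_0 (Cmod h)).
  replace (16 * c' * Cmod h ^ 2 * Rpower (Cmod z) (INR K - INR m - 3))
    with (c' * Cmod h ^ 2 * (16 * Rpower (Cmod z) (INR K - INR m - 3))) by ring.
  rewrite Rmult_assoc. apply Rmult_le_compat_l; [nra|].
  apply Rle_trans with (16 * exp (L / 2) * exp (- L * Re W + L * Cmod h)).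
  { apply Rmult_le_compat_r; [apply Rlt_le, exp_pos|now apply sqr_1_plus_le]. }
  rewrite Rmult_assoc, <- exp_plus. apply Rmult_le_compat_l; [lra|].
  apply Rle_trans with (exp (- L * (Re W - 1))).
  { apply exp_le. assert (L * Cmod h <= L * / 2) by (apply Rmult_le_compat_l; easy). lra. }
  unfold L; rewrite exp_ln_norm by easy. apply Rle_Rpower; lra.
Qed.

Definition Lreg (K m : nat) (W : C) : C := reg_sum e1 K chi7 (gterm m W).

Lemma residue_e1 : (residue e1 mod 7 <> 0)%Z.
Proof. easy. Qed.

Lemma Lreg_indep K K' m W : (1 <= m)%nat -> 2 < INR K + 2 * Re W - INR m ->
  2 < INR K' + 2 * Re W - INR m -> Lreg K m W = Lreg K' m W.
Proof.
intros Hm HK HK'.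
apply reg_sum_change; auto using chi7_mean_zero, residue_e1, summable_gterm.
Qed.

Lemma iter_pdiff_minus e K f g p :
  iter_pdiff e K (fun q => f q - g q)%C p = (iter_pdiff e K f p - iter_pdiff e K g p)%C.
Proof. revert p; induction K; intros p; simpl; [easy|]. unfold pdiff; rewrite !IHK; ring. Qed.

Lemma iter_pdiff_scal e K c g p : iter_pdiff e K (fun q => c * g q)%C p = (c * iter_pdiff e K g
  p)%C.
Proof. revert p; induction K; intros p; simpl; [easy|]. unfold pdiff; rewrite !IHK; ring. Qed.

Lemma iter_pdiff_grem e K m W h p : iter_pdiff e K (grem m W h) p =
  (iter_pdiff e K (gterm m (W + h)) p - iter_pdiff e K (gterm m W) p - h * iter_pdiff e K (gterm'
    m W) p)%C.
Proof. unfold grem. now rewrite !iter_pdiff_minus, iter_pdiff_scal. Qed.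

Lemma summable_weighted e K f g : mean_zero_mod7 f -> summable (iter_pdiff e K g) ->
  summable (fun p => iter_antidiff (residue e) K f (residue p) * iter_pdiff e K g p)%C.
Proof.
intros Hf Hg. destruct (mean_zero_bounded (iter_antidiff (residue e) K f)) as (b & Hb).
{ now apply iter_antidiff_mean_zero. }
apply summable_bounded_mult with b; auto.
Qed.

Lemma Lreg_derivative K m W : (1 <= m)%nat -> 5 <= INR K + 2 * Re W - INR m -> exists d c, 0 <= c /\
  forall h, Cmod h <= / 2 -> Cmod (Lreg K m (W + h) - Lreg K m W - h * d) <= c * Cmod h ^ 2.
Proof.
intros Hm Ht. destruct (grem_diff_le m K W Hm Ht) as (c & Hc & Hrem).
destruct (sum_psize_bounded 3) as (B & HB0 & HB); [lra|].
assert (Hsr : forall h, Cmod h <= / 2 -> summable (iter_pdiff e1 K (grem m W h))).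
{ intros h Hh. apply (summable_psize 3 (c * Cmod h ^ 2)); [lra|]. intros p; now apply Hrem. }
assert (Hsg : forall h, Cmod h <= / 2 -> summable (iter_pdiff e1 K (gterm m (W + h)))).
{ intros h Hh. apply summable_gterm; [easy|]. rewrite Re_plus.
  pose proof (re_le_Cmod h). apply Rabs_le_between in H. lra. }
assert (Hs0 : summable (iter_pdiff e1 K (gterm m W))) by (apply summable_gterm; [easy|lra]).
(* Summability for the derivative is read off from the expansion at the single increment h = 1/4,
   all of whose other terms are summable. *)
assert (Hs' : summable (iter_pdiff e1 K (gterm' m W))).
{ assert (Hh : Cmod (/ 4)%R <= / 2) by (rewrite Cmod_R, Rabs_right; lra).
  apply summable_ext with (fun p => 4 * (iter_pdiff e1 K (gterm m (W + (/ 4)%R)) p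
     - iter_pdiff e1 K (gterm m W) p - iter_pdiff e1 K (grem m W (/ 4)%R) p))%C.
  - intros p. rewrite iter_pdiff_grem. rewrite RtoC_inv by lra. field.
  - apply summable_scal, summable_minus; auto using summable_minus. }
set (psi := iter_antidiff (residue e1) K chi7).
assert (Hpsi : forall j, Rabs (psi j) <= 3 ^ K * 1) by (apply iter_antidiff_bound, chi7_bound).
exists (reg_sum e1 K chi7 (gterm' m W)), (3 ^ K * 1 * c * B).
assert (H3 : 0 <= 3 ^ K) by (apply pow_le; lra).
split; [repeat apply Rmult_le_pos; try lra|]. intros h Hh.
assert (Hcz := chi7_mean_zero).
unfold Lreg, reg_sum.
rewrite <- usum_minus by auto using summable_weighted.
rewrite <- usum_scal by auto using summable_weighted.
rewrite <- usum_minus by auto using summable_weighted, summable_minus, summable_scal.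
fold psi. apply usum_Cmod_le. intros F HF.
apply Rle_trans with (list_sum_R (fun p => 3 ^ K * 1 * c * Cmod h ^ 2 * Rpower (psize p) (- (3)))
  F).
- apply list_sum_R_le. intros p _.
  replace (psi (residue p) * iter_pdiff e1 K (gterm m (W + h)) p -
    psi (residue p) * iter_pdiff e1 K (gterm m W) p -
    h * (psi (residue p) * iter_pdiff e1 K (gterm' m W) p))%C
   with (psi (residue p) * iter_pdiff e1 K (grem m W h) p)%C by (rewrite iter_pdiff_grem; ring).
  rewrite Cmod_mult, Cmod_R, !Rmult_assoc. rewrite <- (Rmult_assoc (3 ^ K)).
  apply Rmult_le_compat; [apply Rabs_pos|apply Cmod_ge_0|apply Hpsi|].
  rewrite <- Rmult_assoc. now apply Hrem.
- rewrite list_sum_R_scal.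
  replace (3 ^ K * 1 * c * B * Cmod h ^ 2) with (3 ^ K * 1 * c * Cmod h ^ 2 * B) by ring.
  apply Rmult_le_compat_l; [|now apply HB].
  apply Rmult_le_pos; [apply Rmult_le_pos; lra|apply pow2_ge_0].
Qed.

Lemma is_derive_C_taylor (f : C -> C) s d c :
  (forall h, Cmod h <= / 2 -> Cmod (f (s + h)%C - f s - h * d) <= c * Cmod h ^ 2) ->
  @is_derive C_AbsRing C_NormedModule f s d.
Proof.
intros H. split; [apply is_linear_scal_l|].
intros x Hx. rewrite <- (is_filter_lim_locally_unique (V := AbsRing_NormedModule C_AbsRing) s x Hx).
intros eps.
set (c' := Rmax c 1). assert (Hc' : 1 <= c') by apply Rmax_r.
assert (Hd : 0 < Rmin (/ 2) (eps / c')).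
{ apply Rmin_glb_lt; [lra|]. apply Rdiv_lt_0_compat; [apply cond_pos|lra]. }
apply (filter_imp (fun y => Cmod (y - s)%C < Rmin (/ 2) (eps / c'))).
- intros y Hy. set (h := (y - s)%C) in *.
  assert (Hy1 := Rlt_le_trans _ _ _ Hy (Rmin_l _ _)). assert (Hy2 := Rlt_le_trans _ _ _ Hy
    (Rmin_r _ _)).
  change (Cmod (f y - f s - h * d)%C <= eps * Cmod h).
  replace y with (s + h)%C by (unfold h; ring).
  eapply Rle_trans; [apply H; lra|].
  assert (Hh := Cmod_ge_0 h).
  assert (c <= c') by apply Rmax_l.
  assert (c' * Cmod h <= eps).
  { apply Rlt_le in Hy2. apply (Rmult_le_compat_l c') in Hy2; [|lra].
    replace (c' * (eps / c')) with (pos eps) in Hy2 by (field; lra). easy. }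
  nra.
- apply (locally_le_locally_norm (V := AbsRing_NormedModule C_AbsRing)).
  exists (mkposreal _ Hd). intros y Hy. exact Hy.
Qed.

(** * Analytic continuation and central values *)

Definition Wexp (n : nat) (s : C) : C := (s + (2 * INR n - 3 / 2)%R)%C.

(** Any number of differences large enough for convergence at [s] gives the same value, by
    [Lreg_indep]; this one leaves the margin that [Lreg_derivative] needs. *)
Definition Lorder (s : C) : nat := Z.to_nat (up (6 + 2 * Rabs (Re s))).

Definition Lfun (n : nat) (s : C) : C := (/ 2 * Lreg (Lorder s) (4 * n - 3) (Wexp n s))%C.

Lemma Lorder_spec s : 6 <= INR (Lorder s) + 2 * Re s.
Proof.
unfold Lorder. destruct (archimed (6 + 2 * Rabs (Re s))) as [H _].
assert (Ha := Rabs_pos (Re s)).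
rewrite INR_IZR_INZ, Z2Nat.id.
- pose proof (Rle_abs (- Re s)) as H1. rewrite Rabs_Ropp in H1. lra.
- apply le_IZR. lra.
Qed.

Lemma Wexp_Re n s : (1 <= n)%nat -> 2 * Re (Wexp n s) - INR (4 * n - 3) = 2 * Re s.
Proof.
intros Hn. unfold Wexp. rewrite Re_plus, re_RtoC, minus_INR, mult_INR by lia.
simpl (INR 4); simpl (INR 3). field.
Qed.

Lemma Lfun_eq n K s : (1 <= n)%nat -> 2 < INR K + 2 * Re s ->
  Lfun n s = (/ 2 * Lreg K (4 * n - 3) (Wexp n s))%C.
Proof.
intros Hn HK. unfold Lfun. f_equal. pose proof (Wexp_Re n s Hn). pose proof (Lorder_spec s).
apply Lreg_indep; [lia|lra|lra].
Qed.

(** [Lorder] jumps as s varies. Independence of the order allows it to be frozen at [Lorder s] on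
    the disc of radius 1/2 around [s], where the quadratic remainder estimate gives the
    derivative. *)
Lemma Lfun_entire n : (1 <= n)%nat -> entire (Lfun n).
Proof.
intros Hn s. pose proof (Wexp_Re n s Hn) as HW. pose proof (Lorder_spec s) as HK.
destruct (Lreg_derivative (Lorder s) (4 * n - 3) (Wexp n s)) as (d & c & Hc & H); [lia|lra|].
exists (/ 2 * d)%C. apply (is_derive_C_taylor _ _ _ c). intros h Hh.
rewrite (Lfun_eq n (Lorder s) (s + h)) by
 (easy || (rewrite Re_plus; pose proof (re_le_Cmod h) as Hre; apply Rabs_le_between in Hre; lra)).
unfold Lfun at 1.
replace (Wexp n (s + h)) with (Wexp n s + h)%C by (unfold Wexp; ring).
match goal with |- Cmod ?x <= _ => replace x with
 (/ 2 * (Lreg (Lorder s) (4 * n - 3) (Wexp n s + h) - Lreg (Lorder s) (4 * n - 3) (Wexp n s) - h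
   * d))%C
 by ring end.
rewrite Cmod_mult.
assert (E : Cmod (/ 2) = / 2).
{ rewrite <- RtoC_inv by lra. rewrite Cmod_R, Rabs_right; lra. }
rewrite E. specialize (H h Hh).
pose proof (Cmod_ge_0 (Lreg (Lorder s) (4 * n - 3) (Wexp n s + h) - Lreg (Lorder s) (4 * n - 3)
  (Wexp n s) - h * d)).
lra.
Qed.

Lemma Rcpow_cexp x s : Rcpow x s = cexp (ln x * s).
Proof.
unfold Rcpow, cexp. destruct s as [a b]. unfold Re, Im; simpl.
f_equal; f_equal; f_equal; ring.
Qed.

Lemma cexp_opp z : cexp (- z) = (/ cexp z)%C.
Proof.
assert (H : (cexp z * cexp (- z))%C = RtoC 1).
{ rewrite <- cexp_plus, Cplus_opp_r. apply cexp_0. }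
assert (N : cexp z <> 0).
{ intros E. rewrite E, Cmult_0_l in H. now apply C1_nz. }
rewrite <- (Cmult_1_l (cexp (- z))), <- (Cinv_l _ N), <- Cmult_assoc, H. ring.
Qed.

Lemma alpha_0 : alpha (0, 0)%Z = RtoC 0.
Proof. apply (additive_0 _ alpha_additive). Qed.

Lemma L_term_gterm n s p :
  L_term n s p = (chi7 (residue p) * gterm (4 * n - 3) (Wexp n s) p)%C.
Proof.
unfold L_term, gterm, monomial. rewrite eps_residue. fold (alpha p). fold (chi7 (residue p)).
rewrite alpha_norm. fold (Wexp n s). rewrite Rcpow_cexp. unfold amp; simpl Cpow.
replace (ln (IZR (qnorm (fst p) (snd p))) * - Wexp n s)%C
  with (- (ln (IZR (qnorm (fst p) (snd p))) * Wexp n s))%C by ring.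
rewrite cexp_opp. unfold Cdiv. ring.
Qed.

Lemma is_unordered_sum_restrict {I : Type} (P : I -> Prop) (u : I -> C) (S : C) :
  (forall i, ~ P i -> u i = RtoC 0) -> has_sum u S -> is_unordered_sum P u S.
Proof.
intros Hu H e. destruct (H e) as (F0 & _ & HF0).
set (dec := fun i => if excluded_middle_informative (P i) then true else false).
assert (Hdec : forall i, dec i = true <-> P i).
{ intros i; unfold dec; destruct (excluded_middle_informative (P i)); now split. }
exists (filter dec F0). split.
- intros i Hi. apply filter_In in Hi. now apply Hdec.
- intros F HF HP Hincl.
  set (eqd := fun i j : I => excluded_middle_informative (i = j)).
  (* The indices of [F0] outside [P] are put back so that the unrestricted sum applies; [u] vanishes
     on them. *)
  set (G := filter (fun i => negb (dec i)) (nodup eqd F0)).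
  replace (list_sum_C u F) with (list_sum_C u (F ++ G)).
  + apply HF0; [|easy|].
    * apply NoDup_app; [easy|apply NoDup_filter, NoDup_nodup|].
      intros i Hi Hi'. apply filter_In in Hi' as [_ Hi'].
      apply HP, Hdec in Hi. now rewrite Hi in Hi'.
    * intros i Hi. apply in_or_app. destruct (dec i) eqn:E.
      -- left. apply Hincl, filter_In. now split.
      -- right. apply filter_In. split; [now apply nodup_In|now rewrite E].
  + rewrite list_sum_C_app, (list_sum_C_ext u (fun _ => RtoC 0) G).
    * rewrite list_sum_C_0; ring.
    * intros i Hi. apply Hu. rewrite <- Hdec. apply filter_In in Hi as [_ Hi].
      intros E. now rewrite E in Hi.
Qed.

Lemma Lfun_is_L_function n : (1 <= n)%nat -> is_L_function n (Lfun n).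
Proof.
intros Hn. split; [now apply Lfun_entire|]. intros s Hs.
pose proof (Wexp_Re n s Hn) as HW.
assert (Hsum : summable (gterm (4 * n - 3) (Wexp n s))).
{ apply (summable_gterm (4 * n - 3) 0); [lia|]. change (INR 0) with 0; lra. }
exists (Lreg 0 (4 * n - 3) (Wexp n s)). split.
- apply is_unordered_sum_restrict.
  + intros p Hp. apply NNPP in Hp. subst p. rewrite L_term_gterm. unfold gterm, monomial.
    rewrite alpha_0. replace (4 * n - 3)%nat with (S (4 * n - 4)) by lia.
    rewrite Cpow_S. ring.
  + apply has_sum_ext with (fun p => chi7 (residue p) * gterm (4 * n - 3) (Wexp n s) p)%C.
    { intros p; now rewrite L_term_gterm. }
    apply (summable_has_sum (fun p => chi7 (residue p) * gterm (4 * n - 3) (Wexp n s) p)%C).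
    apply summable_bounded_mult with 1; [intros; apply chi7_bound|easy].
- apply Lfun_eq; [easy|]. simpl INR; lra.
Qed.

Definition coef_term (h : nat) (p : Z * Z) : C := (alpha p ^ h * (/ Cconj (alpha p)) ^ S h)%C.

(* For even h this is 2 L(1/2, chi^(2h+1)). *)
Definition coef (h : nat) : C := reg_sum e1 2 chi7 (coef_term h).

(** At s = 1/2 the exponent W is 2n - 1, and alpha^(4n-3) / (alpha conj(alpha))^(2n-1) =
    alpha^(2n-2) / conj(alpha)^(2n-1). At the origin both sides are 0. *)
Lemma gterm_central n p : (1 <= n)%nat ->
  gterm (4 * n - 3) (Wexp n (1 / 2)%R) p = coef_term (2 * n - 2) p.
Proof.
intros Hn. unfold gterm, monomial, coef_term.
destruct (excluded_middle_informative (p = (0, 0)%Z)) as [->|Hp].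
- rewrite alpha_0. replace (Cconj 0) with (RtoC 0) by (apply C_ext; simpl; ring).
  replace (4 * n - 3)%nat with (S (4 * n - 4)) by lia. rewrite Cinv_0, !Cpow_S. ring.
- set (z := alpha p). assert (Hz : z <> 0) by now apply alpha_neq_0.
  assert (Hzc := Cconj_neq_0 z Hz).
  assert (E : amp 0 (Wexp n (1 / 2)%R) (ln (Re z ^ 2 + Im z ^ 2))
    = ((/ z) ^ (2 * n - 1) * (/ Cconj z) ^ (2 * n - 1))%C).
  { unfold amp. simpl Cpow at 1. rewrite Cmult_1_l.
    replace (Wexp n (1 / 2)%R) with (RtoC (INR (2 * n - 1))).
    2:{ unfold Wexp. rewrite <- RtoC_plus. f_equal. rewrite minus_INR, mult_INR by lia.
        simpl (INR 2); simpl (INR 1). field. }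
    rewrite <- RtoC_opp, <- RtoC_mult.
    unfold cexp. rewrite re_RtoC, im_RtoC, cos_0, sin_0, Rmult_0_r, Rmult_1_r.
    rewrite <- Cpow_mult_l, <- Cmod2_alt.
    replace (/ z * / Cconj z)%C with (RtoC (/ Cmod z ^ 2)).
    2:{ assert (Hm : 0 < Cmod z) by now apply Cmod_gt_0.
        rewrite RtoC_inv by (apply pow_nonzero; lra).
        rewrite Cmod2_conj. field. split; auto. }
    rewrite <- RtoC_pow. unfold RtoC. f_equal.
    assert (Hm : 0 < Cmod z ^ 2) by (apply pow_lt; now apply Cmod_gt_0).
    rewrite pow_inv, <- (Rpower_pow (2 * n - 1) (Cmod z ^ 2)) by easy.
    unfold Rpower. rewrite <- exp_Ropp. f_equal; ring. }
  rewrite E. simpl (Cpow _ 0).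
  replace (4 * n - 3)%nat with ((2 * n - 2) + (2 * n - 1))%nat by lia.
  replace (S (2 * n - 2)) with (2 * n - 1)%nat by lia.
  rewrite Cpow_add_r, !Cpow_inv by auto. field.
  split; apply Cpow_nz; easy.
Qed.

Lemma L_central_nonzero_coef n : (1 <= n)%nat -> coef (2 * n - 2) <> 0 -> L_central_nonzero n.
Proof.
intros Hn H. exists (Lfun n). split; [now apply Lfun_is_L_function|].
(* Two differences suffice at the centre, because 2 + 2 * (1/2) exceeds 2. *)
rewrite (Lfun_eq n 2) by (easy || (rewrite re_RtoC; simpl INR; lra)).
unfold Lreg. replace (gterm (4 * n - 3) (Wexp n (1 / 2)%R)) with (coef_term (2 * n - 2)).
- fold (coef (2 * n - 2)). apply Cmult_neq_0; [|easy].
  apply Cinv_neq_0. intros E. apply RtoC_inj in E. lra.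
- extensionality p. now rewrite gterm_central.
Qed.

(** * Row sums over a reduced lattice *)

Definition zseg (A : Z) (n : nat) : list Z := map (fun i => A + Z.of_nat i)%Z (seq 0 n).

Definition zsym (X : nat) : list Z := zseg (- Z.of_nat X) (2 * X + 1).

Lemma zseg_S A n : zseg A (S n) = zseg A n ++ [(A + Z.of_nat n)%Z].
Proof. unfold zseg. now rewrite seq_S, map_app. Qed.

Lemma in_zsym X z : In z (zsym X) <-> (Z.abs z <= Z.of_nat X)%Z.
Proof.
unfold zsym, zseg. rewrite in_map_iff. split.
- intros (i & <- & Hi). apply in_seq in Hi. lia.
- intros H. exists (Z.to_nat (z + Z.of_nat X)). rewrite in_seq. lia.
Qed.

Lemma NoDup_zsym X : NoDup (zsym X).
Proof.
apply FinFun.Injective_map_NoDup; [|apply seq_NoDup]. intros i j H. lia.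
Qed.

Lemma zsym_opp (f : Z -> C) X : list_sum_C (fun n => f (- n)%Z) (zsym X) = list_sum_C f (zsym X).
Proof.
rewrite <- list_sum_C_map. apply list_sum_C_perm. apply NoDup_Permutation.
- apply FinFun.Injective_map_NoDup; [|apply NoDup_zsym]. intros i j H. lia.
- apply NoDup_zsym.
- intros z. rewrite in_map_iff, in_zsym. split.
  + intros (y & <- & Hy). apply in_zsym in Hy. lia.
  + intros H. exists (- z)%Z. rewrite in_zsym. lia.
Qed.

Lemma zseg_by_parts (a : Z -> R) (d : Z -> C) A n :
  list_sum_C (fun m => a m * (d m - d (m + 1)%Z))%C (zseg A n)
  = (list_sum_C (fun m => (a m - a (m - 1)%Z)%R * d m)%C (zseg A n)
     + a (A - 1)%Z * d A - a (A + Z.of_nat n - 1)%Z * d (A + Z.of_nat n)%Z)%C.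
Proof.
induction n as [|n IH].
- unfold zseg; simpl. rewrite Z.add_0_r. ring.
- rewrite zseg_S, !list_sum_C_app, IH. cbn [list_sum_C fold_right].
  replace (A + Z.of_nat (S n) - 1)%Z with (A + Z.of_nat n)%Z by lia.
  replace (A + Z.of_nat (S n))%Z with (A + Z.of_nat n + 1)%Z by lia.
  rewrite RtoC_minus. ring.
Qed.

Lemma zsym_by_parts (a : Z -> R) (d : Z -> C) Y :
  list_sum_C (fun m => a m * (d m - d (m + 1)%Z))%C (zsym Y)
  = (list_sum_C (fun m => (a m - a (m - 1)%Z)%R * d m)%C (zsym Y)
     + a (- Z.of_nat Y - 1)%Z * d (- Z.of_nat Y)%Z
     - a (Z.of_nat Y) * d (Z.of_nat Y + 1)%Z)%C.
Proof.
unfold zsym. rewrite zseg_by_parts.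
replace (- Z.of_nat Y + Z.of_nat (2 * Y + 1))%Z with (Z.of_nat Y + 1)%Z by lia.
now replace (Z.of_nat Y + 1 - 1)%Z with (Z.of_nat Y) by lia.
Qed.

Lemma NoDup_list_prod {I J : Type} (F : list I) (G : list J) :
  NoDup F -> NoDup G -> NoDup (list_prod F G).
Proof.
intros HF HG. induction HF as [|i F Hi _ IH]; simpl; [constructor|].
apply NoDup_app; [|easy|].
- apply FinFun.Injective_map_NoDup; [|easy]. intros x y E. now inversion E.
- intros p Hp Hp'. apply in_map_iff in Hp as (j & <- & _).
  now apply in_prod_iff in Hp' as [Hi' _].
Qed.

(** The two sides of the box are independent, so that Y can be fixed first and X made large
    afterwards. *)
Lemma box_limit (u : Z * Z -> C) e : summable u -> 0 < e -> exists n0, forall X Y,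
  (n0 <= X)%nat -> (n0 <= Y)%nat ->
  Cmod (list_sum_C (fun m => list_sum_C (fun n => u (n, m)) (zsym X)) (zsym Y) - usum u) < e.
Proof.
intros Hu He. destruct (proj1 (has_sumP _ _) (summable_has_sum u Hu) e He) as (F0 & H0).
destruct (list_ZZ_bounded F0) as (n0 & Hn0). exists n0. intros X Y HX HY.
rewrite list_sum_C_exchange. rewrite <- (list_sum_C_prod u (zsym X) (zsym Y)). apply H0.
- apply NoDup_list_prod; apply NoDup_zsym.
- intros [x y] Hp. apply Hn0 in Hp. apply in_prod_iff in Hp as [Hx Hy].
  assert (M : forall z, In z (zbox n0) -> (Z.abs z <= Z.of_nat n0)%Z).
  { intros z Hz. apply in_app_or in Hz.
    destruct Hz as [Hz|Hz]; apply in_map_iff in Hz as (i & <- & Hi); apply in_seq in Hi; lia. }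
  apply in_prod; apply in_zsym; apply M in Hx, Hy; lia.
Qed.

(** The standard fundamental domain of the modular group with its boundary, together with its mirror
    image in the lower half-plane. *)
Definition reduced (v : C) : Prop := Rabs (Re v) <= / 2 /\ 1 <= Cmod v.

(** The cross term 2 x s Re v is at most |x s| <= (x^2 + s^2)/2 in absolute value, which is half of
    the diagonal part. *)
Lemma reduced_quadratic v x s : reduced v ->
  (x ^ 2 + s ^ 2 * Cmod v ^ 2) / 2 <= Cmod (x + s * v)%C ^ 2.
Proof.
intros [H1 H2]. rewrite !Cmod2_alt.
assert (Hv : 1 <= Re v ^ 2 + Im v ^ 2) by (rewrite <- Cmod2_alt; nra).
replace (Re (x + s * v)%C) with (x + s * Re v) by (destruct v; unfold Re; simpl; ring).
replace (Im (x + s * v)%C) with (s * Im v) by (destruct v; unfold Im; simpl; ring).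
set (p := Re v) in *. set (q := Im v) in *. apply Rabs_le_between in H1.
assert (- (x ^ 2 + s ^ 2) / 2 <= 2 * (x * s) * p).
{ pose proof (pow2_ge_0 (x + s)). pose proof (pow2_ge_0 (x - s)).
  assert (x * s <= (x ^ 2 + s ^ 2) / 2) by lra. assert (- (x ^ 2 + s ^ 2) / 2 <= x * s) by lra.
  nra. }
assert (0 <= s ^ 2) by apply pow2_ge_0. nra.
Qed.

Definition latU (v : C) (p : Z * Z) : C := (IZR (fst p) + IZR (snd p) * v)%C.

Lemma latU_additive v : additive (latU v).
Proof.
intros p q. unfold latU, padd; cbn [fst snd]. rewrite !plus_IZR, !RtoC_plus. ring.
Qed.

Lemma abs_IZR a : IZR (Z.abs a) = Rabs (IZR a).
Proof. symmetry; apply Rabs_Zabs. Qed.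

Lemma pow_IZR_abs a : IZR a ^ 2 = IZR (Z.abs a) ^ 2.
Proof. rewrite abs_IZR. now rewrite pow2_abs. Qed.

Lemma latU_psize v p : reduced v -> p <> (0, 0)%Z -> / 4 * psize p <= Cmod (latU v p).
Proof.
intros Hv Hp. pose proof (reduced_quadratic v (IZR (fst p)) (IZR (snd p)) Hv) as H.
fold (latU v p) in H. destruct Hv as [_ Hv].
apply Rsqr_incr_0_var; [|apply Cmod_ge_0]. unfold Rsqr.
assert (H2 : 2 <= psize p).
{ unfold psize. destruct p as [a b]; cbn [fst snd].
  assert (a <> 0 \/ b <> 0)%Z by (destruct (Z.eq_dec a 0), (Z.eq_dec b 0); subst; intuition).
  assert (1 <= Z.abs a + Z.abs b)%Z by lia. apply IZR_le in H1. rewrite plus_IZR in H1. lra. }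
rewrite (pow_IZR_abs (fst p)), (pow_IZR_abs (snd p)) in H. unfold psize in *.
assert (0 <= IZR (Z.abs (fst p))) by (apply IZR_le; lia).
assert (0 <= IZR (Z.abs (snd p))) by (apply IZR_le; lia).
set (a := IZR (Z.abs (fst p))) in *. set (b := IZR (Z.abs (snd p))) in *.
assert (1 <= Cmod v ^ 2) by nra.
assert (b ^ 2 <= b ^ 2 * Cmod v ^ 2) by (pose proof (pow2_ge_0 b); nra).
assert ((1 + a + b) ^ 2 <= 4 * (a + b) ^ 2) by nra.
assert ((a + b) ^ 2 / 4 <= (a ^ 2 + b ^ 2) / 2) by (pose proof (pow2_ge_0 (a - b)); lra).
nra.
Qed.

(** With w = i + y one has i^2 + y^2 >= w^2 / 2, so the terms are dominated by the telescoping 2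
    (1/(w - 1/2) - 1/(w + 1/2)). *)
Lemma sum_inv_quadratic_le y n : 1 <= y ->
  list_sum_R (fun i => / (INR i ^ 2 + y ^ 2)) (seq 0 n) <= 4 / y.
Proof.
intros Hy.
assert (H : forall n, list_sum_R (fun i => / (INR i ^ 2 + y ^ 2)) (seq 0 n)
   <= 2 * (/ (y - / 2) - / (INR n + y - / 2))).
{ induction n0 as [|k IH].
  - simpl. rewrite Rplus_0_l. lra.
  - rewrite seq_S, list_sum_R_app. cbn [list_sum_R fold_right Nat.add].
    pose proof (pos_INR k) as Hk. rewrite S_INR.
    assert (/ (INR k ^ 2 + y ^ 2) <= 2 * (/ (INR k + y - / 2) - / (INR k + 1 + y - / 2))).
    { set (w := INR k + y).
      replace (2 * (/ (w - / 2) - / (INR k + 1 + y - / 2))) with (/ ((w ^ 2 - / 4) / 2))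
        by (unfold w; field; unfold w; nra).
      apply Rinv_le_contravar; [unfold w; nra|]. unfold w. pose proof (pow2_ge_0 (INR k - y)).
        nra. }
    lra. }
eapply Rle_trans; [apply H|].
pose proof (pos_INR n).
assert (0 < / (INR n + y - / 2)) by (apply Rinv_0_lt_compat; lra).
assert (/ (y - / 2) <= 2 / y).
{ apply (Rmult_le_reg_r (y - / 2)); [lra|]. rewrite Rinv_l by lra.
  apply (Rmult_le_reg_r y); [lra|]. field_simplify; lra. }
lra.
Qed.

Lemma list_sum_zsym_le (u : R -> R) X : (forall x, 0 <= u x) ->
  list_sum_R (fun z => u (IZR (Z.abs z))) (zsym X) <= 2 * list_sum_R (fun i => u (INR i)) (seq 0
    (S X)).
Proof.
intros Hu. rewrite <- list_sum_zbox.
apply list_sum_R_incl; [auto|apply NoDup_zsym|].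
intros z Hz. apply in_zsym in Hz. now apply in_zbox.
Qed.

Lemma sum_zsym_inv_quadratic_le y X : 1 <= y ->
  list_sum_R (fun n => / (IZR n ^ 2 + y ^ 2)) (zsym X) <= 8 / y.
Proof.
intros Hy.
rewrite (list_sum_R_ext _ (fun n => / (IZR (Z.abs n) ^ 2 + y ^ 2)))
  by (intros; now rewrite pow_IZR_abs).
eapply Rle_trans; [apply (list_sum_zsym_le (fun x => / (x ^ 2 + y ^ 2)))|].
- intros x. apply Rlt_le, Rinv_0_lt_compat. nra.
- pose proof (sum_inv_quadratic_le y (S X) Hy). lra.
Qed.

Lemma row_neq_0 v (x s : R) : reduced v -> 1 <= s -> (x + s * v)%C <> 0.
Proof.
intros Hv Hs E. pose proof (reduced_quadratic v x s Hv) as H. rewrite E, Cmod_0 in H.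
destruct Hv as [_ Hv]. assert (1 <= s ^ 2) by nra. assert (1 <= Cmod v ^ 2) by nra.
assert (1 * 1 <= s ^ 2 * Cmod v ^ 2) by (apply Rmult_le_compat; lra).
pose proof (pow2_ge_0 x). lra.
Qed.

Lemma Cinv_Cmod_le (z : C) b : 0 < b -> b <= Cmod z -> Cmod (/ z) <= / b.
Proof.
intros Hb H. rewrite Cmod_inv by (apply Cmod_gt_0; lra). now apply Rinv_le_contravar.
Qed.

(* 1/w^2 differs from the telescoping 1/(w - 1/2) - 1/(w + 1/2) by O(1/w^4). *)
Lemma row_sum_inv2_le v s X : reduced v -> 1 <= s ->
  Cmod (list_sum_C (fun n => / (IZR n + s * v) * / (IZR n + s * v))%C (zsym X))
  <= 4 / (INR X + / 2) + 16 / (s ^ 2 * Cmod v ^ 2).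
Proof.
intros Hv Hs. assert (Hv1 : 1 <= Cmod v) by apply Hv.
set (y := s * Cmod v). assert (Hy : 1 <= y) by (unfold y; nra).
assert (Q : forall x : R, (x ^ 2 + y ^ 2) / 2 <= Cmod (x + s * v)%C ^ 2).
{ intros x. unfold y. rewrite Rpow_mult_distr. now apply reduced_quadratic. }
set (t := fun n : Z => (/ (IZR n + s * v - (/ 2)%R))%C).
assert (N : forall x : R, (x + s * v)%C <> 0) by (intros; now apply row_neq_0).
assert (Etel : forall A n, list_sum_C (fun n => t n - t (n + 1)%Z)%C (zseg A n)
   = (t A - t (A + Z.of_nat n)%Z)%C).
{ intros A n. induction n as [|n IH].
  - unfold zseg; simpl. rewrite Z.add_0_r; ring.
  - rewrite zseg_S, list_sum_C_app, IH. cbn [list_sum_C fold_right].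
    replace (A + Z.of_nat (S n))%Z with (A + Z.of_nat n + 1)%Z by lia. ring. }
rewrite (list_sum_C_ext _ (fun n => (t n - t (n + 1)%Z)
   - (/ 4)%R * (/ (IZR n + s * v) * / (IZR n + s * v) * (t n * t (n + 1)%Z)))%C).
2:{ intros n _. unfold t. rewrite plus_IZR, RtoC_plus.
  assert (N0 := N (IZR n)). assert (N1 := N (IZR n - / 2)). assert (N2 := N (IZR n + / 2)).
  rewrite RtoC_minus in N1. rewrite RtoC_plus in N2. rewrite RtoC_inv in * by lra.
  replace (IZR n + s * v - / 2)%C with (IZR n - / 2 + s * v)%C by ring.
  replace (IZR n + 1 + s * v - / 2)%C with (IZR n + / 2 + s * v)%C by field.
  rewrite RtoC_inv by lra.
  field. repeat split; intros E;
  first [now apply N0 | apply N1; rewrite <- (Cmult_0_l (/ 2)), <- E; field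
    | apply N2; rewrite <- (Cmult_0_l (/ 2)), <- E; field]. }
rewrite list_sum_C_minus, list_sum_C_scal.
unfold Cminus at 1. eapply Rle_trans; [apply Cmod_triangle|]. rewrite Cmod_opp.
apply Rplus_le_compat.
(* The telescoping part leaves its two endpoints, with real coordinates -(X + 1/2) and X + 1/2. *)
- unfold zsym. rewrite Etel. unfold Cminus at 1. eapply Rle_trans; [apply Cmod_triangle|].
  rewrite Cmod_opp. pose proof (pos_INR X) as HX.
  assert (B : forall x : R, Rabs x = INR X + / 2 -> Cmod (/ (x + s * v)) <= 2 / (INR X + / 2)).
  { intros x Hx. replace (2 / (INR X + / 2)) with (/ ((INR X + / 2) / 2)) by (field; lra).
    apply Cinv_Cmod_le; [lra|]. apply Rsqr_incr_0_var; [|apply Cmod_ge_0]. unfold Rsqr.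
    specialize (Q x). rewrite <- pow2_abs, Hx in Q. nra. }
  replace (4 / (INR X + / 2)) with (2 / (INR X + / 2) + 2 / (INR X + / 2)) by (field; lra).
  unfold t. apply Rplus_le_compat.
  + replace (IZR (- Z.of_nat X) + s * v - (/ 2)%R)%C with ((- (INR X + / 2))%R + s * v)%C.
    * apply B. rewrite Rabs_Ropp. apply Rabs_right; lra.
    * rewrite opp_IZR, <- INR_IZR_INZ, !RtoC_opp, RtoC_plus. ring.
  + replace (IZR (- Z.of_nat X + Z.of_nat (2 * X + 1)) + s * v - (/ 2)%R)%C
      with ((INR X + / 2)%R + s * v)%C.
    * apply B. apply Rabs_right; lra.
    * replace (- Z.of_nat X + Z.of_nat (2 * X + 1))%Z with (Z.of_nat X + 1)%Z by lia.
      rewrite plus_IZR, <- INR_IZR_INZ, !RtoC_plus, !RtoC_inv by lra. field.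
(* In the quartic remainder one factor |w|^2 supplies y^2 / 2 and the other (n^2 + 1) / 2, which
   makes the sum over n converge. *)
- rewrite Cmod_mult, Cmod_R, Rabs_right by lra.
  apply Rle_trans with (/ 4 * list_sum_R (fun n => 8 / y ^ 2 * / (IZR n ^ 2 + 1 ^ 2)) (zsym X)).
  + apply Rmult_le_compat_l; [lra|]. eapply Rle_trans; [apply Cmod_list_sum|].
    apply list_sum_R_le. intros n _. set (w := (IZR n + s * v)%C).
    assert (Hw := N (IZR n)). fold w in Hw. assert (Qw := Q (IZR n)). fold w in Qw.
    assert (Hw0 : 0 < Cmod w) by now apply Cmod_gt_0.
    assert (Hn2 : 0 <= IZR n ^ 2) by apply pow2_ge_0.
    assert (Et : (t n * t (n + 1)%Z)%C = (/ (w * w - (/ 4)%R))%C).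
    { unfold t. rewrite plus_IZR, RtoC_plus.
      assert (N1 := N (IZR n - / 2)). assert (N2 := N (IZR n + / 2)).
      rewrite RtoC_minus in N1. rewrite RtoC_plus in N2. rewrite !RtoC_inv in * by lra.
      replace (IZR n + s * v - / 2)%C with (IZR n - / 2 + s * v)%C by ring.
      replace (IZR n + 1 + s * v - / 2)%C with (IZR n + / 2 + s * v)%C by field.
      replace (w * w - / 4)%C with ((IZR n - / 2 + s * v) * (IZR n + / 2 + s * v))%C
        by (unfold w; field).
      field. repeat split; intros E;
      first [apply N1; rewrite <- (Cmult_0_l (/ 2)), <- E; field
        | apply N2; rewrite <- (Cmult_0_l (/ 2)), <- E; field]. }
    rewrite Et, !Cmod_mult.
    assert (H4 : Cmod w ^ 2 / 2 <= Cmod (w * w - (/ 4)%R)).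
    { pose proof (Cmod_triangle_rev (w * w) (- (/ 4)%R)) as HT.
      rewrite Cmod_opp, Cmod_mult, Cmod_R, Rabs_right in HT by lra.
      unfold Cminus. nra. }
    assert (Hi : Cmod (/ (w * w - (/ 4)%R)) <= / (Cmod w ^ 2 / 2))
      by (apply Cinv_Cmod_le; [nra|easy]).
    rewrite Cmod_inv by easy.
    apply Rle_trans with (/ Cmod w * / Cmod w * / (Cmod w ^ 2 / 2)).
    { apply Rmult_le_compat_l; [|easy].
      apply Rmult_le_pos; apply Rlt_le, Rinv_0_lt_compat, Hw0. }
    replace (/ Cmod w * / Cmod w * / (Cmod w ^ 2 / 2)) with (/ (Cmod w ^ 2 * Cmod w ^ 2 / 2))
      by (field; lra).
    replace (8 / y ^ 2 * / (IZR n ^ 2 + 1 ^ 2)) with (/ (y ^ 2 * (IZR n ^ 2 + 1) / 8))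
      by (field; nra).
    apply Rinv_le_contravar; [nra|].
    assert (y ^ 2 / 2 <= Cmod w ^ 2) by lra.
    assert ((IZR n ^ 2 + 1) / 2 <= Cmod w ^ 2) by nra.
    assert (y ^ 2 / 2 * ((IZR n ^ 2 + 1) / 2) <= Cmod w ^ 2 * Cmod w ^ 2)
      by (apply Rmult_le_compat; nra). lra.
  + rewrite list_sum_R_scal. pose proof (sum_zsym_inv_quadratic_le 1 X (Rle_refl 1)) as HS.
    replace (s ^ 2 * Cmod v ^ 2) with (y ^ 2) by (unfold y; ring).
    assert (H8 : 0 < 8 / y ^ 2) by (apply Rdiv_lt_0_compat; nra).
    apply (Rmult_le_compat_l (8 / y ^ 2)) in HS; [|lra].
    replace (16 / y ^ 2) with (/ 4 * (8 / y ^ 2 * (8 / 1))) by (field; nra). lra.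
Qed.

(** * Regularized sums over a reduced lattice *)

Definition e2 : Z * Z := (0, 1)%Z.

(** For m <> 0 and v not real this is a symmetric partial sum of the series for pi cot(pi m v). *)
Definition row (v : C) (X : nat) (m : Z) : C :=
  list_sum_C (fun n => / latU v (n, m))%C (zsym X).

Lemma row_opp v X m : row v X (- m) = (- row v X m)%C.
Proof.
unfold row. rewrite <- zsym_opp.
transitivity ((-1) * list_sum_C (fun n => / latU v (n, m))%C (zsym X))%C; [|ring].
rewrite <- list_sum_C_scal. apply list_sum_C_ext. intros n _.
unfold latU; cbn [fst snd]. rewrite !opp_IZR, !RtoC_opp.
set (z := (IZR n + IZR m * v)%C). replace (- IZR n + - IZR m * v)%C with (- z)%C by (unfold z;
  ring).
destruct (excluded_middle_informative (z = 0)) as [->|Hz].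
- replace (- (0))%C with (RtoC 0) by ring. rewrite Cinv_0; ring.
- field; easy.
Qed.

Lemma row_0 v X : row v X 0 = RtoC 0.
Proof.
assert (H := row_opp v X 0). simpl in H.
replace (row v X 0) with ((row v X 0 + row v X 0) / 2)%C by field.
rewrite H at 1. field.
Qed.

Definition row_diff (v : C) (X : nat) (m : Z) : C := (row v X m - row v X (m + 1))%C.

(** Rows are odd in m. The reflection folds negative indices onto m >= 0, and exchanges the
    exceptional indices 0 and -1. *)
Lemma row_diff_reflect v X m : row_diff v X (- 1 - m) = row_diff v X m.
Proof.
unfold row_diff. replace (- 1 - m + 1)%Z with (- m)%Z by ring.
replace (- 1 - m)%Z with (- (m + 1))%Z by ring. rewrite !row_opp. ring.
Qed.

Lemma cder_list_sum {I : Type} (f f' : I -> R -> C) x F :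
  (forall i, In i F -> cder (f i) x (f' i x)) ->
  cder (fun t => list_sum_C (fun i => f i t) F) x (list_sum_C (fun i => f' i x) F).
Proof.
induction F as [|i F IH]; intros H; simpl; [apply cder_const|].
apply cder_plus; [apply H; now left|apply IH; intros; apply H; now right].
Qed.

(** Mean value bound in a real row index t: the derivative of a row is -v times the sum of 1/(n + t
    v)^2, controlled by [row_sum_inv2_le]. *)
Lemma row_diff_le v X m : reduced v -> (1 <= m)%Z ->
  Cmod (row_diff v X m) <= 8 * Cmod v / (INR X + / 2) + 32 / (IZR m ^ 2 * Cmod v).
Proof.
intros Hv Hm. assert (Hv1 : 1 <= Cmod v) by apply Hv. apply IZR_le in Hm.
pose proof (pos_INR X) as HX.
set (g := fun t : R => list_sum_C (fun n => / (IZR n + (IZR m + t)%R * v))%C (zsym X)).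
replace (row_diff v X m) with (g 0 - g 1)%C.
2:{ unfold row_diff, g, row. f_equal; apply list_sum_C_ext; intros n _;
    unfold latU; cbn [fst snd]; rewrite ?plus_IZR, ?Rplus_0_r; easy. }
replace (8 * Cmod v / (INR X + / 2) + 32 / (IZR m ^ 2 * Cmod v))
  with (2 * (Cmod v * (4 / (INR X + / 2) + 16 / (IZR m ^ 2 * Cmod v ^ 2)))).
2:{ field. repeat split; try lra. }
apply (cder_mean_value g (fun t => - v * list_sum_C (fun n =>
   / (IZR n + (IZR m + t)%R * v) * / (IZR n + (IZR m + t)%R * v)) (zsym X))%C).
- intros x Hx. rewrite <- list_sum_C_scal.
  apply (cder_list_sum (fun n t => / (IZR n + (IZR m + t)%R * v))%C
    (fun n t => - v * (/ (IZR n + (IZR m + t)%R * v) * / (IZR n + (IZR m + t)%R * v)))%C).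
  intros n _. eapply cder_eq.
  + apply (cder_inv (fun t : R => (IZR n + (IZR m + t)%R * v)%C)); [|apply row_neq_0; [easy|lra]].
    apply (cder_plus (fun _ => RtoC (IZR n))); [apply cder_const|].
    apply (cder_mult (fun t : R => RtoC (IZR m + t)) (fun _ => v)); [|apply cder_const].
    apply cder_RtoC. apply (is_derive_plus (fun _ => IZR m) (fun t => t)).
    * apply is_derive_const.
    * apply (is_derive_id x).
  + unfold plus, zero, one; simpl. rewrite Rplus_0_l. ring.
- intros x Hx. rewrite Cmod_mult, Cmod_opp. apply Rmult_le_compat_l; [apply Cmod_ge_0|].
  eapply Rle_trans; [apply row_sum_inv2_le; [easy|lra]|].
  apply Rplus_le_compat_l. unfold Rdiv. apply Rmult_le_compat_l; [lra|].
  apply Rinv_le_contravar; [apply Rmult_lt_0_compat; apply pow_lt; lra|].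
  apply Rmult_le_compat_r; [apply pow_le; lra|]. apply pow_incr; lra.
Qed.

(** Pairing n with -n gives 2 v / ((n + v)(-n + v)), which decays quadratically; the bound is
    uniform in X and in [v]. *)
Lemma row_1_le v X : reduced v -> Cmod (row v X 1) <= 16.
Proof.
intros Hv. assert (Hv1 : 1 <= Cmod v) by apply Hv.
replace (row v X 1) with (/ 2 * list_sum_C (fun n =>
  / (IZR n + v) + / (IZR (- n) + v)) (zsym X))%C.
2:{ rewrite list_sum_C_plus, (zsym_opp (fun n => / (IZR n + v))%C).
    unfold row. rewrite (list_sum_C_ext (fun n => / latU v (n, 1%Z))%C (fun n => / (IZR n + v))%C).
    - field.
    - intros n _. unfold latU; cbn [fst snd]. do 2 f_equal. ring. }
rewrite Cmod_mult. replace (Cmod (/ 2)) with (/ 2).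
2:{ rewrite <- RtoC_inv by lra. rewrite Cmod_R, Rabs_right; lra. }
apply Rle_trans with (/ 2 * list_sum_R (fun n => 4 * Cmod v * / (IZR n ^ 2 + Cmod v ^ 2)) (zsym X)).
- apply Rmult_le_compat_l; [lra|]. eapply Rle_trans; [apply Cmod_list_sum|].
  apply list_sum_R_le. intros n _.
  assert (Q1 := reduced_quadratic v (IZR n) 1 Hv). assert (Q2 := reduced_quadratic v (- IZR n) 1
    Hv).
  assert (N1 := row_neq_0 v (IZR n) 1 Hv (Rle_refl 1)).
  assert (N2 := row_neq_0 v (- IZR n) 1 Hv (Rle_refl 1)).
  rewrite opp_IZR. rewrite Cmult_1_l in *.
  replace (/ (IZR n + v) + / ((- IZR n)%R + v))%C
    with (2 * v * (/ (IZR n + v) * / ((- IZR n)%R + v)))%C.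
  2:{ rewrite RtoC_opp in *. field. auto. }
  rewrite !Cmod_mult, Cmod_R, (Rabs_right 2), !Cmod_inv by (auto; lra).
  apply Cmod_gt_0 in N1, N2.
  replace (4 * Cmod v * / (IZR n ^ 2 + Cmod v ^ 2))
    with (2 * Cmod v * / ((IZR n ^ 2 + Cmod v ^ 2) / 2)) by (field; nra).
  apply Rmult_le_compat_l; [lra|]. rewrite <- Rinv_mult.
  assert (HP : 0 < (IZR n ^ 2 + Cmod v ^ 2) / 2) by nra.
  apply Rinv_le_contravar; [easy|].
  apply Rsqr_incr_0_var; [|apply Rlt_le, Rmult_lt_0_compat; easy]. unfold Rsqr.
  replace (Cmod (IZR n + v) * Cmod ((- IZR n)%R + v) * (Cmod (IZR n + v) * Cmod ((- IZR n)%R + v)))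
   with (Cmod (IZR n + v) ^ 2 * Cmod ((- IZR n)%R + v) ^ 2) by ring.
  apply Rmult_le_compat; nra.
- rewrite list_sum_R_scal. pose proof (sum_zsym_inv_quadratic_le (Cmod v) X Hv1) as HS.
  apply (Rmult_le_compat_l (4 * Cmod v)) in HS; [|lra].
  replace (4 * Cmod v * (8 / Cmod v)) with 32 in HS by (field; lra). lra.
Qed.

Lemma sum_inv_sq_le Y : list_sum_R (fun i => / (1 + INR i) ^ 2) (seq 0 Y) <= 2.
Proof.
eapply Rle_trans; [|pose proof (sum_Rpower_le 2 Y ltac:(lra)) as H; replace (2 / (2 - 1)) with 2
  in H by field; exact H].
right. apply list_sum_R_ext. intros i _. pose proof (pos_INR i).
rewrite Rpower_Ropp. f_equal. replace 2 with (INR 2) by reflexivity. rewrite Rpower_pow; [easy|lra].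
Qed.

Definition weight (K : nat) (c m : Z) : R := iter_antidiff c K chi7 (c * m)%Z.

Lemma weight_bound K c m : Rabs (weight K c m) <= 3 ^ K.
Proof.
rewrite <- (Rmult_1_r (3 ^ K)). apply iter_antidiff_bound, chi7_bound.
Qed.

Lemma weight_S K c m : (c mod 7 <> 0)%Z -> weight (S K) c m - weight (S K) c (m - 1) = weight K c m.
Proof.
intros Hc. unfold weight. simpl iter_antidiff.
replace (c * (m - 1))%Z with (c * m - c)%Z by ring.
apply antidiff_diff; [|easy]. apply iter_antidiff_mean_zero, chi7_mean_zero.
Qed.

(* The sum of chi7 (c m) / (n + m v): the case in which the character is trivial
   on the shortest vector 1. *)
Definition kernel_sum (v : C) (c : Z) : C :=
  usum (fun p => weight 2 c (snd p) * iter_pdiff e2 2 (fun p => / latU v p) p)%C.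

Lemma kernel_sum_summable v c : reduced v ->
  summable (fun p => weight 2 c (snd p) * iter_pdiff e2 2 (fun p => / latU v p) p)%C.
Proof.
intros Hv. apply summable_bounded_mult with (3 ^ 2); [intros; apply weight_bound|].
apply summable_second_diff_inv with (/ 4); [apply latU_additive|lra|].
intros p; now apply latU_psize.
Qed.

(** The weight depends on m alone, so the sum over n collapses to second differences of rows.
    Undoing one of the two summations by parts leaves weight 1, first differences, and boundary
    terms at both ends. *)
Lemma kernel_box v c X Y : (c mod 7 <> 0)%Z ->
  list_sum_C (fun m => list_sum_C (fun n =>
     weight 2 c m * iter_pdiff e2 2 (fun p => / latU v p) (n, m))%C (zsym X)) (zsym Y)
  = (list_sum_C (fun m => weight 1 c m * row_diff v X m)%C (zsym Y)
     + weight 2 c (- Z.of_nat Y - 1)%Z * row_diff v X (- Z.of_nat Y)%Z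
     - weight 2 c (Z.of_nat Y) * row_diff v X (Z.of_nat Y + 1)%Z)%C.
Proof.
intros Hc. rewrite <- (list_sum_C_ext (fun m => ((weight 2 c m - weight 2 c (m - 1)%Z)%R *
  row_diff v X m)%C)
  (fun m => weight 1 c m * row_diff v X m)%C)
  by (intros m _; now rewrite weight_S).
rewrite <- zsym_by_parts. apply list_sum_C_ext. intros m _.
rewrite list_sum_C_scal. f_equal. unfold row_diff, row. rewrite <- !list_sum_C_minus.
apply list_sum_C_ext. intros n _. rewrite iter_pdiff_2. unfold padd, e2; cbn [fst snd].
rewrite !Z.add_0_r, Z.add_assoc. ring.
Qed.

(* Rows m = 0 and m = -1 carry the main term; the others decay like 1/m^2. *)
Lemma row_diff_sum_le v c X Y : reduced v -> (1 <= Y)%nat ->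
  Cmod (list_sum_C (fun m => weight 1 c m * row_diff v X m)%C (zsym Y)
        + (weight 1 c 0 + weight 1 c (-1))%R * row v X 1)%C
  <= 48 * Cmod v * INR Y / (INR X + / 2) + 480 / Cmod v.
Proof.
intros Hv HY. assert (Hv1 : 1 <= Cmod v) by apply Hv. pose proof (pos_INR X) as HX.
(* The range -(n + 1), ..., n is stable under m -> -1 - m and folds onto 0, ..., n. The segment
   [zsym] has one more row, m = Y, which is split off below. *)
assert (HE : forall n, list_sum_C (fun m => weight 1 c m * row_diff v X m)%C (zseg (- Z.of_nat (S
  n)) (2 * (S n)))
  = (list_sum_C (fun i => (weight 1 c (Z.of_nat i) + weight 1 c (- 1 - Z.of_nat i))%R
        * row_diff v X (Z.of_nat i))%C (seq 0 (S n)))%C).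
{ induction n as [|n IH].
  - unfold zseg; cbn [seq map Nat.mul Nat.add list_sum_C fold_right].
    change (- Z.of_nat 1 + Z.of_nat 0)%Z with (-1 - Z.of_nat 0)%Z.
    rewrite row_diff_reflect. change (- Z.of_nat 1 + Z.of_nat 1)%Z with (Z.of_nat 0).
    rewrite RtoC_plus. ring.
  - replace (2 * S (S n))%nat with (S (S (2 * S n))) by lia.
    rewrite zseg_S, (seq_S (S n)), !list_sum_C_app, <- IH.
    replace (list_sum_C (fun m => weight 1 c m * row_diff v X m)%C (zseg (- Z.of_nat (S (S n)))
      (S (2 * S n))))
     with (weight 1 c (- Z.of_nat (S (S n))) * row_diff v X (- Z.of_nat (S (S n)))
       + list_sum_C (fun m => weight 1 c m * row_diff v X m) (zseg (- Z.of_nat (S n)) (2 * S n)))%C.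
    + cbn [list_sum_C fold_right Nat.add].
      replace (- Z.of_nat (S (S n)) + Z.of_nat (S (2 * S n)))%Z with (Z.of_nat (S n)) by lia.
      replace (- Z.of_nat (S (S n)))%Z with (- 1 - Z.of_nat (S n))%Z by lia.
      rewrite row_diff_reflect, RtoC_plus. ring.
    + unfold zseg. cbn [seq map list_sum_C fold_right]. rewrite Z.add_0_r. f_equal.
      rewrite <- seq_shift, map_map. unfold list_sum_C. f_equal. apply map_ext. intros i. lia. }
destruct Y as [|Y]; [lia|].
replace (zsym (S Y)) with (zseg (- Z.of_nat (S Y)) (2 * S Y) ++ [Z.of_nat (S Y)]).
2:{ unfold zsym. replace (2 * S Y + 1)%nat with (S (2 * S Y)) by lia. rewrite zseg_S.
    do 2 f_equal. lia. }
rewrite list_sum_C_app, HE.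
replace (seq 0 (S Y)) with (0%nat :: map S (seq 0 Y)) by (rewrite seq_shift; reflexivity).
cbn [list_sum_C fold_right]. fold (@list_sum_C nat).
(* As row 0 vanishes, the folded term at 0 is exactly the main term, with opposite sign. *)
assert (E0 : row_diff v X (Z.of_nat 0) = (- row v X 1)%C).
{ unfold row_diff. change (Z.of_nat 0) with 0%Z. rewrite row_0. change (0 + 1)%Z with 1%Z. ring. }
rewrite E0. change (Z.of_nat 0) with 0%Z. change (-1 - 0)%Z with (-1)%Z.
set (T := fold_right _ _ (map S (seq 0 Y))).
replace (((weight 1 c 0 + weight 1 c (-1))%R * - row v X 1 + T +
    (weight 1 c (Z.of_nat (S Y)) * row_diff v X (Z.of_nat (S Y)) + 0) +
    (weight 1 c 0 + weight 1 c (-1))%R * row v X 1)%C)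
  with (T + weight 1 c (Z.of_nat (S Y)) * row_diff v X (Z.of_nat (S Y)))%C by ring.
eapply Rle_trans; [apply Cmod_triangle|].
set (A := 8 * Cmod v / (INR X + / 2)).
assert (HA : 0 <= A) by (apply Rlt_le, Rdiv_lt_0_compat; lra).
assert (HB : forall i, (1 <= i)%nat -> Cmod (row_diff v X (Z.of_nat i)) <= A + 32 / Cmod v * /
  INR i ^ 2).
{ intros i Hi. eapply Rle_trans; [apply row_diff_le; [easy|lia]|]. unfold A. apply
  Rplus_le_compat_l.
  rewrite <- INR_IZR_INZ. apply le_INR in Hi. simpl (INR 1) in Hi. right. field. lra. }
assert (Hw : forall m, Rabs (weight 1 c m) <= 3).
{ intros m. pose proof (weight_bound 1 c m). simpl in H. lra. }
assert (HT : Cmod T <= 6 * (A * INR Y + 32 / Cmod v * 2)).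
{ unfold T. change (fold_right _ _ (map S (seq 0 Y))) with
   (list_sum_C (fun i => (weight 1 c (Z.of_nat i) + weight 1 c (- 1 - Z.of_nat i))%R
        * row_diff v X (Z.of_nat i))%C (map S (seq 0 Y))).
  rewrite list_sum_C_map. eapply Rle_trans; [apply Cmod_list_sum|].
  apply Rle_trans with (list_sum_R (fun i => 6 * (A + 32 / Cmod v * / (1 + INR i) ^ 2)) (seq 0 Y)).
  - apply list_sum_R_le. intros i _. rewrite Cmod_mult, Cmod_R.
    apply Rmult_le_compat; [apply Rabs_pos|apply Cmod_ge_0| |].
    + eapply Rle_trans; [apply Rabs_triang|].
      pose proof (Hw (Z.of_nat (S i))). pose proof (Hw (- 1 - Z.of_nat (S i))%Z). lra.
    + replace (1 + INR i) with (INR (S i)) by (rewrite S_INR; ring). apply HB. lia.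
  - rewrite list_sum_R_scal, list_sum_R_plus, list_sum_R_const, list_sum_R_scal, length_seq.
    pose proof (sum_inv_sq_le Y). assert (0 < 32 / Cmod v) by (apply Rdiv_lt_0_compat; lra).
    apply (Rmult_le_compat_l (32 / Cmod v)) in H; [|lra]. lra. }
assert (HL : Cmod (weight 1 c (Z.of_nat (S Y)) * row_diff v X (Z.of_nat (S Y))) <= 3 * (A + 32 /
  Cmod v * / INR (S Y) ^ 2)).
{ rewrite Cmod_mult, Cmod_R. apply Rmult_le_compat; [apply Rabs_pos|apply Cmod_ge_0|apply Hw|].
  apply HB; lia. }
assert (H1 : / INR (S Y) ^ 2 <= 1).
{ rewrite S_INR. pose proof (pos_INR Y). rewrite <- Rinv_1. apply Rinv_le_contravar; [lra|nra]. }
assert (0 < 32 / Cmod v) by (apply Rdiv_lt_0_compat; lra).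
apply (Rmult_le_compat_l (32 / Cmod v)) in H1; [|lra].
(* Folded weights are at most 6 and the weight of the extra row at most 3, while the sum of 1/(1 +
   i)^2 is at most 2: 48 = 6 * 8, and 480 = 15 * 32 with 15 = 6 * 2 + 3. *)
replace (48 * Cmod v * INR (S Y) / (INR X + / 2)) with (6 * (A * (INR Y + 1)))
  by (unfold A; rewrite S_INR; field; lra).
replace (480 / Cmod v) with (15 * (32 / Cmod v)) by (field; lra) . lra.
Qed.

(** Fix Y from [box_limit] and let X grow: every error with denominator X + 1/2 disappears, and 1056
    = 480 + 2 * 9 * 32 includes the two boundary rows. The main term stays a partial row because
    only its size and the sign of its imaginary part are used later. *)
Lemma kernel_sum_approx v c d : reduced v -> (c mod 7 <> 0)%Z -> 0 < d ->
  exists X0, forall X, (X0 <= X)%nat ->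
  Cmod (kernel_sum v c + (weight 1 c 0 + weight 1 c (-1))%R * row v X 1)%C <= 1056 / Cmod v + d.
Proof.
intros Hv Hc Hd. assert (Hv1 : 1 <= Cmod v) by apply Hv.
destruct (box_limit _ (d / 2) (kernel_sum_summable v c Hv)) as (n0 & Hn0); [lra|].
set (Y := S (S n0)).
(* All errors with denominator X + 1/2 together; 144 = 2 * 9 * 8 comes from the boundary rows. *)
set (M := (48 * INR Y + 144) * Cmod v).
assert (HM : 0 < M) by (pose proof (pos_INR Y); unfold M; nra).
destruct (archimed (2 * M / d)) as [Hup _].
exists (n0 + Z.to_nat (up (2 * M / d)))%nat. intros X HX. pose proof (pos_INR X) as HX0.
assert (HXM : M / (INR X + / 2) <= d / 2).
{ assert (2 * M / d <= INR X).
  { apply Rle_trans with (IZR (up (2 * M / d))); [lra|]. rewrite INR_IZR_INZ. apply IZR_le. lia. }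
  apply (Rmult_le_reg_r (INR X + / 2)); [lra|].
  replace (M / (INR X + / 2) * (INR X + / 2)) with M by (field; lra).
  apply (Rmult_le_compat_r d) in H; [|lra].
  replace (2 * M / d * d) with (2 * M) in H by (field; lra). nra. }
specialize (Hn0 X Y ltac:(lia) ltac:(unfold Y; lia)). cbn [snd] in Hn0.
fold (kernel_sum v c) in Hn0. rewrite kernel_box in Hn0 by easy.
set (S1 := list_sum_C (fun m => weight 1 c m * row_diff v X m)%C (zsym Y)) in *.
set (B1 := (weight 2 c (- Z.of_nat Y - 1)%Z * row_diff v X (- Z.of_nat Y))%C) in *.
set (B2 := (weight 2 c (Z.of_nat Y) * row_diff v X (Z.of_nat Y + 1))%C) in *.
pose proof (row_diff_sum_le v c X Y Hv ltac:(unfold Y; lia)) as HS. fold S1 in HS.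
assert (HB : forall m j, (1 <= j)%Z -> Cmod (weight 2 c m * row_diff v X j) <= 9 * (8 * Cmod v /
  (INR X + / 2) + 32 / Cmod v)).
{ intros m j Hj. rewrite Cmod_mult, Cmod_R. apply Rmult_le_compat; [apply Rabs_pos|apply
  Cmod_ge_0| |].
  - pose proof (weight_bound 2 c m). simpl in H. lra.
  - eapply Rle_trans; [now apply row_diff_le|]. apply Rplus_le_compat_l.
    unfold Rdiv. apply Rmult_le_compat_l; [lra|]. apply IZR_le in Hj.
    apply Rinv_le_contravar; [lra|]. assert (1 <= IZR j ^ 2) by nra. nra. }
assert (HB2 : Cmod B2 <= 9 * (8 * Cmod v / (INR X + / 2) + 32 / Cmod v)) by (apply HB; lia).
assert (HB1 : Cmod B1 <= 9 * (8 * Cmod v / (INR X + / 2) + 32 / Cmod v)).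
{ unfold B1. replace (- Z.of_nat Y)%Z with (- 1 - (Z.of_nat (S n0)))%Z by (unfold Y; lia).
  rewrite row_diff_reflect. apply HB; lia. }
set (K := ((weight 1 c 0 + weight 1 c (-1))%R * row v X 1)%C) in *.
replace (kernel_sum v c + K)%C
  with (- (S1 + B1 - B2 - kernel_sum v c) + (S1 + K) + (B1 - B2))%C by ring.
eapply Rle_trans; [apply Cmod_triangle|].
eapply Rle_trans; [apply Rplus_le_compat_r, Cmod_triangle|]. rewrite Cmod_opp.
assert (HB12 : Cmod (B1 - B2) <= Cmod B1 + Cmod B2).
{ unfold Cminus. eapply Rle_trans; [apply Cmod_triangle|]. rewrite Cmod_opp. lra. }
replace (M / (INR X + / 2)) with (48 * Cmod v * INR Y / (INR X + / 2) + 18 * (8 * Cmod v / (INR X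
  + / 2)))
  in HXM by (unfold M; field; lra).
replace (1056 / Cmod v) with (480 / Cmod v + 18 * (32 / Cmod v)) by (field; lra).
lra.
Qed.

(** The total is at most 1056 + 1 + 6 * 16, the last product bounding the main term. *)
Lemma kernel_sum_bound v c : reduced v -> (c mod 7 <> 0)%Z -> Cmod (kernel_sum v c) <= 1200.
Proof.
intros Hv Hc. assert (Hv1 : 1 <= Cmod v) by apply Hv.
destruct (kernel_sum_approx v c 1 Hv Hc) as (X0 & HX0); [lra|].
specialize (HX0 X0 (le_n _)). pose proof (row_1_le v X0 Hv) as HR.
set (k := weight 1 c 0 + weight 1 c (-1)) in *.
assert (Hk : Rabs k <= 6).
{ unfold k. eapply Rle_trans; [apply Rabs_triang|].
  pose proof (weight_bound 1 c 0). pose proof (weight_bound 1 c (-1)). simpl in *. lra. }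
replace (kernel_sum v c) with ((kernel_sum v c + k * row v X0 1) + - (k * row v X0 1))%C by ring.
eapply Rle_trans; [apply Cmod_triangle|]. rewrite Cmod_opp, Cmod_mult, Cmod_R.
assert (Rabs k * Cmod (row v X0 1) <= 6 * 16)
  by (apply Rmult_le_compat; [apply Rabs_pos|apply Cmod_ge_0|easy|easy]).
assert (1056 / Cmod v <= 1056).
{ apply (Rmult_le_reg_r (Cmod v)); [lra|]. unfold Rdiv. rewrite Rmult_assoc, Rinv_l by lra. nra. }
lra.
Qed.

(* The sum of chi7 (c1 n + c2 m) / (n + m v), for c1 prime to 7. *)
Definition generic_sum (v : C) (c1 c2 : Z) : C :=
  usum (fun p => iter_antidiff c1 2 chi7 (c1 * fst p + c2 * snd p)%Z
     * iter_pdiff e1 2 (fun p => / latU v p) p)%C.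

(** The bound is uniform because the differences are taken along [e1], where [latU v] equals 1 for
    every v, and [latU_psize] has the same constant for all reduced v. *)
Lemma generic_sum_bound : exists B, 0 <= B /\ forall v c1 c2, reduced v -> Cmod (generic_sum v c1
  c2) <= B.
Proof.
destruct (sum_psize_bounded 3) as (B & HB0 & HB); [lra|].
set (k := (2 * 1 ^ 2 * (/ / 4) ^ 3 + 4 * / / 4) * (2 * psize e1) ^ 3).
assert (Hk : 0 <= k).
{ unfold k. rewrite Rinv_inv. pose proof (psize_ge_1 e1).
  apply Rmult_le_pos; [lra|apply pow_le; lra]. }
exists (9 * k * B). split; [apply Rmult_le_pos; lra|].
intros v c1 c2 Hv. apply usum_Cmod_le. intros F HF.
apply Rle_trans with (list_sum_R (fun p => 9 * k * Rpower (psize p) (- (3))) F).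
- apply list_sum_R_le. intros p _. rewrite Cmod_mult, Cmod_R, Rmult_assoc.
  apply Rmult_le_compat; [apply Rabs_pos|apply Cmod_ge_0| |].
  + pose proof (iter_antidiff_bound chi7 c1 1 2 chi7_bound (c1 * fst p + c2 * snd p)%Z). lra.
  + rewrite Rpower_neg3 by apply psize_pos.
    eapply Rle_trans; [apply (second_diff_inv_le (latU v) e1 (/ 4));
       [apply latU_additive|lra|intros q; now apply latU_psize]|].
    right. unfold k. do 5 f_equal. unfold latU, e1; cbn [fst snd].
    rewrite Cmult_0_l, Cplus_0_r. now rewrite Cmod_1.
- rewrite list_sum_R_scal. apply Rmult_le_compat_l; [lra|]. now apply HB.
Qed.

(** * Change of basis and lattice reduction *)

Definition comb (b1 b2 q : Z * Z) : Z * Z :=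
  (fst q * fst b1 + snd q * fst b2, fst q * snd b1 + snd q * snd b2)%Z.

Definition pdet (b1 b2 : Z * Z) : Z := (fst b1 * snd b2 - snd b1 * fst b2)%Z.

(** Cramer's rule, multiplying by the determinant instead of dividing: a determinant 1 or -1 is its
    own inverse, so both orientations are covered. *)
Definition comb_inv (b1 b2 p : Z * Z) : Z * Z :=
  (pdet b1 b2 * (fst p * snd b2 - snd p * fst b2),
   pdet b1 b2 * (snd p * fst b1 - fst p * snd b1))%Z.

Lemma comb_inv_r b1 b2 p : (pdet b1 b2 * pdet b1 b2 = 1)%Z -> comb b1 b2 (comb_inv b1 b2 p) = p.
Proof.
intros H. destruct p as [x y]. unfold comb, comb_inv; cbn [fst snd].
f_equal; [transitivity (pdet b1 b2 * pdet b1 b2 * x)%Z|transitivity (pdet b1 b2 * pdet b1 b2 *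
  y)%Z];
 try (rewrite H; ring); unfold pdet; ring.
Qed.

Lemma comb_inv_l b1 b2 q : (pdet b1 b2 * pdet b1 b2 = 1)%Z -> comb_inv b1 b2 (comb b1 b2 q) = q.
Proof.
intros H. destruct q as [x y]. unfold comb, comb_inv; cbn [fst snd].
f_equal; [transitivity (pdet b1 b2 * pdet b1 b2 * x)%Z|transitivity (pdet b1 b2 * pdet b1 b2 *
  y)%Z];
 try (rewrite H; ring); unfold pdet; ring.
Qed.

Lemma additive_opp U p : additive U -> U (- fst p, - snd p)%Z = (- U p)%C.
Proof.
intros H. assert (E := H p (- fst p, - snd p)%Z).
replace (padd p (- fst p, - snd p)%Z) with (0, 0)%Z in E
  by (unfold padd; cbn [fst snd]; f_equal; ring).
rewrite additive_0 in E by easy.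
replace (U (- fst p, - snd p)%Z) with (U p + U (- fst p, - snd p)%Z - U p)%C by ring.
rewrite <- E; ring.
Qed.

Lemma additive_scal U p k : additive U -> U (k * fst p, k * snd p)%Z = (IZR k * U p)%C.
Proof.
intros H.
assert (N : forall n p, U (Z.of_nat n * fst p, Z.of_nat n * snd p)%Z = (IZR (Z.of_nat n) * U p)%C).
{ induction n as [|n IH]; intros q.
  - simpl. rewrite additive_0 by easy. ring.
  - replace (Z.of_nat (S n) * fst q, Z.of_nat (S n) * snd q)%Z
      with (padd (Z.of_nat n * fst q, Z.of_nat n * snd q)%Z q)
      by (unfold padd; cbn [fst snd]; f_equal; lia).
    rewrite H, IH. replace (Z.of_nat (S n)) with (Z.of_nat n + 1)%Z by lia.
    rewrite plus_IZR, RtoC_plus. ring. }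
destruct (Z_le_gt_dec 0 k).
- replace k with (Z.of_nat (Z.to_nat k)) by lia. apply N.
- replace k with (- Z.of_nat (Z.to_nat (- k)))%Z by lia.
  set (n := Z.to_nat (- k)).
  replace (- Z.of_nat n * fst p, - Z.of_nat n * snd p)%Z
    with (- fst (Z.of_nat n * fst p, Z.of_nat n * snd p), - snd (Z.of_nat n * fst p, Z.of_nat n *
      snd p))%Z
    by (cbn [fst snd]; f_equal; ring).
  rewrite additive_opp, N by easy. rewrite opp_IZR, RtoC_opp. ring.
Qed.

Lemma additive_comb U b1 b2 q : additive U ->
  U (comb b1 b2 q) = (IZR (fst q) * U b1 + IZR (snd q) * U b2)%C.
Proof.
intros H. rewrite <- !additive_scal by easy. now rewrite <- H.
Qed.

Lemma comb_padd b1 b2 q e : comb b1 b2 (padd q e) = padd (comb b1 b2 q) (comb b1 b2 e).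
Proof. unfold comb, padd; cbn [fst snd]; f_equal; ring. Qed.

Lemma comb_e1 b1 b2 : comb b1 b2 e1 = b1.
Proof. destruct b1, b2. unfold comb, e1; cbn [fst snd]; f_equal; ring. Qed.

Lemma comb_e2 b1 b2 : comb b1 b2 e2 = b2.
Proof. destruct b1, b2. unfold comb, e2; cbn [fst snd]; f_equal; ring. Qed.

Lemma residue_comb b1 b2 q :
  residue (comb b1 b2 q) = (residue b1 * fst q + residue b2 * snd q)%Z.
Proof. unfold residue, comb; cbn [fst snd]; ring. Qed.

Lemma iter_pdiff_comb b1 b2 e K g q :
  iter_pdiff (comb b1 b2 e) K g (comb b1 b2 q) = iter_pdiff e K (fun q => g (comb b1 b2 q)) q.
Proof.
revert q; induction K as [|K IH]; intros q; simpl; [easy|].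
unfold pdiff. now rewrite <- comb_padd, !IH.
Qed.

Lemma Cinv_mult (z w : C) : (/ (z * w))%C = (/ z * / w)%C.
Proof.
destruct (excluded_middle_informative (z = 0)) as [->|Hz].
{ rewrite Cmult_0_l, Cinv_0; ring. }
destruct (excluded_middle_informative (w = 0)) as [->|Hw].
{ rewrite Cmult_0_r, Cinv_0; ring. }
field. auto.
Qed.

Section Lattice.
Variables (U : Z * Z -> C) (k : R).
Hypotheses (HU : additive U) (Hk : 0 < k)
  (HUk : forall p, p <> (0, 0)%Z -> k * psize p <= Cmod (U p)).

Lemma lattice_neq_0 p : p <> (0, 0)%Z -> U p <> 0.
Proof.
intros H. apply Cmod_gt_0. apply HUk in H. pose proof (psize_pos p).
assert (0 < k * psize p) by (apply Rmult_lt_0_compat; easy). lra.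
Qed.

Definition latG : C := reg_sum e1 2 chi7 (fun p => / U p)%C.

(** [reg_sum_change] moves the differences to the image of [e]; then the lattice is reindexed by the
    new basis, and U b1 is factored out of U(comb q) = U b1 * latU (U b2 / U b1) q. *)
Lemma latG_basis b1 b2 e : (pdet b1 b2 * pdet b1 b2 = 1)%Z -> U b1 <> 0 ->
  (residue (comb b1 b2 e) mod 7 <> 0)%Z ->
  latG = (/ U b1 * usum (fun q =>
      iter_antidiff (residue (comb b1 b2 e)) 2 chi7 (residue b1 * fst q + residue b2 * snd q)%Z
      * iter_pdiff e 2 (fun q => / latU (U b2 / U b1) q) q))%C.
Proof.
intros Hd Hb1 Hr. set (b := comb b1 b2 e) in *.
assert (Hs : forall e, summable (iter_pdiff e 2 (fun p => / U p)%C))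
  by (intros; now apply summable_second_diff_inv with k).
unfold latG. rewrite (reg_sum_change e1 b 2 2) by auto using chi7_mean_zero, residue_e1.
unfold reg_sum.
assert (Hw : summable (fun p => iter_antidiff (residue b) 2 chi7 (residue p) *
     iter_pdiff b 2 (fun p0 => / U p0) p)%C)
  by (apply summable_weighted; auto using chi7_mean_zero).
assert (E : forall q, (iter_antidiff (residue b) 2 chi7 (residue (comb b1 b2 q)) *
     iter_pdiff b 2 (fun p0 => / U p0) (comb b1 b2 q))%C
   = (/ U b1 * (iter_antidiff (residue b) 2 chi7 (residue b1 * fst q + residue b2 * snd q)%Z
      * iter_pdiff e 2 (fun q => / latU (U b2 / U b1) q) q))%C).
{ intros q. rewrite residue_comb. unfold b at 2. rewrite iter_pdiff_comb.
  replace (fun q => / U (comb b1 b2 q))%C with (fun q => / U b1 * / latU (U b2 / U b1) q)%C.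
  - rewrite iter_pdiff_scal. ring.
  - extensionality x. rewrite additive_comb by easy. rewrite <- Cinv_mult. f_equal.
    unfold latU. field. easy. }
rewrite <- (usum_reindex (comb b1 b2) (comb_inv b1 b2)
  (fun p => iter_antidiff (residue b) 2 chi7 (residue p) * iter_pdiff b 2 (fun p0 => / U p0) p)%C);
 auto using comb_inv_r, comb_inv_l.
assert (Hw' := summable_reindex (comb b1 b2) (comb_inv b1 b2) _ (fun q => comb_inv_l b1 b2 q Hd)
  Hw).
cbv beta in Hw'.
rewrite (usum_ext _ _ Hw' E). apply usum_scal.
apply summable_ext with (fun q => U b1 * (/ U b1 * (iter_antidiff (residue b) 2 chi7 (residue b1
  * fst q + residue b2 * snd q)%Z
      * iter_pdiff e 2 (fun q => / latU (U b2 / U b1) q) q)))%C.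
- intros q. field. easy.
- apply summable_scal. now apply (summable_ext _ _ E).
Qed.

Lemma latG_generic b1 b2 : (pdet b1 b2 * pdet b1 b2 = 1)%Z -> U b1 <> 0 ->
  (residue b1 mod 7 <> 0)%Z ->
  latG = (/ U b1 * generic_sum (U b2 / U b1) (residue b1) (residue b2))%C.
Proof.
intros Hd Hb Hr. rewrite (latG_basis b1 b2 e1) by (now rewrite ?comb_e1).
now rewrite comb_e1.
Qed.

(** A step along [b1] does not change the character, so the differences are taken along [b2]. By
    periodicity modulo 7 the weight then depends on the second coordinate only. *)
Lemma latG_kernel b1 b2 : (pdet b1 b2 * pdet b1 b2 = 1)%Z -> U b1 <> 0 ->
  (residue b1 mod 7 = 0)%Z -> (residue b2 mod 7 <> 0)%Z ->
  latG = (/ U b1 * kernel_sum (U b2 / U b1) (residue b2))%C.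
Proof.
intros Hd Hb Hr1 Hr. rewrite (latG_basis b1 b2 e2) by (now rewrite ?comb_e2).
rewrite comb_e2. f_equal. unfold kernel_sum, weight. f_equal. extensionality q. do 2 f_equal.
set (f := iter_antidiff (residue b2) 2 chi7).
assert (Hf : forall j, f (j + 7)%Z = f j)
  by (apply iter_antidiff_mean_zero, chi7_mean_zero).
rewrite (periodic7_mod f _ Hf), (periodic7_mod f (residue b2 * snd q) Hf). f_equal.
rewrite Zplus_mod, <- Zmult_mod_idemp_l, Hr1. simpl Z.mul. now rewrite Zmod_0_l, Z.add_0_l,
  Zmod_mod.
Qed.

Lemma list_argmin {I : Type} (f : I -> R) (L : list I) : L <> [] ->
  exists i, In i L /\ forall j, In j L -> f i <= f j.
Proof.
induction L as [|x L IH]; [easy|]. intros _.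
destruct L as [|y L].
- exists x; split; [now left|]. intros j [->|[]]; lra.
- destruct IH as (i & Hi & H); [easy|].
  destruct (Rle_dec (f x) (f i)).
  + exists x; split; [now left|]. intros j [->|Hj]; [lra|]. specialize (H j Hj). lra.
  + exists i; split; [now right|]. intros j [->|Hj]; [lra|auto].
Qed.

(** A vector no longer than U e1 has [psize] at most |U e1| / k, so a finite search suffices. *)
Lemma shortest_vector : exists b, b <> (0, 0)%Z /\
  forall p, p <> (0, 0)%Z -> Cmod (U b) <= Cmod (U p).
Proof.
set (A := Cmod (U e1)).
destruct (archimed (A / k)) as [Hup _]. set (n := Z.to_nat (up (A / k))).
set (nz := fun p : Z * Z => negb ((fst p =? 0)%Z && (snd p =? 0)%Z)).
assert (Hnz : forall p, nz p = true <-> p <> (0, 0)%Z).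
{ intros [x y]. unfold nz; cbn [fst snd].
  destruct (Z.eqb_spec x 0), (Z.eqb_spec y 0); subst; simpl; split; try easy; try (intros _ E;
    inversion E; contradiction). }
set (L := e1 :: filter nz (list_prod (zbox n) (zbox n))).
destruct (list_argmin (fun p => Cmod (U p)) L) as (b & Hb & Hmin); [easy|].
assert (Hbe : Cmod (U b) <= A) by (apply Hmin; now left).
exists b. split.
- destruct Hb as [<-|Hb]; [easy|]. apply filter_In in Hb. now apply Hnz.
- intros p Hp. destruct (Rle_dec (Cmod (U p)) A) as [H|H]; [|lra].
  apply Hmin. right. apply filter_In. split; [|now apply Hnz].
  specialize (HUk p Hp).
  assert (HA : psize p <= A / k).
  { apply (Rmult_le_reg_l k); [easy|]. replace (k * (A / k)) with A by (field; lra). lra. }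
  assert (psize p < IZR (up (A / k))) by lra. unfold psize in H0.
  rewrite <- !plus_IZR in H0. apply lt_IZR in H0.
  destruct p as [x y]; cbn [fst snd] in *. apply in_prod; apply in_zbox; unfold n; lia.
Qed.

(** A shortest vector b is primitive, since dividing by the gcd of its coordinates would shorten it.
    Bezout completes it to a basis, a multiple of b is subtracted to bring the real part of the
    ratio into range, and the ratio has modulus at least 1 by minimality of b. *)
Lemma reduced_basis : exists b1 b2, (pdet b1 b2 * pdet b1 b2 = 1)%Z /\ b1 <> (0, 0)%Z /\
  reduced (U b2 / U b1)%C.
Proof.
destruct shortest_vector as (b & Hb & Hmin).
assert (Hub := lattice_neq_0 b Hb). assert (Hcb : 0 < Cmod (U b)) by now apply Cmod_gt_0.
set (g := Z.gcd (fst b) (snd b)).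
assert (Hg : g = 1%Z).
{ assert (Hg0 : (0 <= g)%Z) by apply Z.gcd_nonneg.
  destruct (Z.gcd_divide_l (fst b) (snd b)) as [x Hx]. destruct (Z.gcd_divide_r (fst b) (snd b))
    as [y Hy].
  fold g in Hx, Hy.
  assert (Eb : b = (g * fst (x, y), g * snd (x, y))%Z).
  { destruct b; cbn [fst snd] in *; f_equal; lia. }
  assert (Hxy : (x, y) <> (0, 0)%Z).
  { intros E; rewrite E in Eb. apply Hb. rewrite Eb. cbn [fst snd]. f_equal; ring. }
  specialize (Hmin _ Hxy). rewrite Eb in Hmin at 1. rewrite additive_scal, Cmod_mult, Cmod_R in
    Hmin by easy.
  rewrite Rabs_right in Hmin by (apply Rle_ge, IZR_le; lia).
  pose proof (lattice_neq_0 _ Hxy) as Hn. apply Cmod_gt_0 in Hn.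
  assert (IZR g <= 1) by nra. apply le_IZR in H.
  assert (g <> 0)%Z; [|lia]. intros E. apply Hb. rewrite Eb, E. reflexivity. }
assert (Hbz : exists u v, (fst b * u + snd b * v = 1)%Z).
{ destruct (Z.gcd_bezout (fst b) (snd b) g) as (u & v & E); [easy|]. exists u, v. lia. }
destruct Hbz as (u & v & Euv).
set (b' := (- v, u)%Z). set (x := Re (U b' / U b)%C).
(* This j is an integer nearest to x. *)
destruct (archimed (x - / 2)) as [H1 H2]. set (j := up (x - / 2)) in *.
set (b2 := padd b' (- j * fst b, - j * snd b)%Z).
assert (Hd : pdet b b2 = 1%Z).
{ unfold pdet, b2, b', padd; cbn [fst snd]. rewrite <- Euv. ring. }
assert (EU : (U b2 / U b)%C = (U b' / U b - IZR j)%C).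
{ unfold b2. rewrite HU, additive_scal by easy. rewrite opp_IZR, RtoC_opp. field. easy. }
exists b, b2. rewrite Hd. split; [easy|]. split; [easy|]. split.
- rewrite EU. replace (Re (U b' / U b - IZR j)%C) with (x - IZR j) by (unfold x, Re; simpl; ring).
  apply Rabs_le. lra.
- rewrite Cmod_div by easy. apply (Rmult_le_reg_r (Cmod (U b))); [easy|].
  unfold Rdiv. rewrite Rmult_assoc, Rinv_l by lra. rewrite Rmult_1_l, Rmult_1_r. apply Hmin.
  intros E. unfold pdet in Hd. rewrite E in Hd. cbn [fst snd] in Hd. lia.
Qed.
End Lattice.

(** If both residues were divisible by 7, so would be the determinant. *)
Lemma residue_basis b1 b2 : (pdet b1 b2 * pdet b1 b2 = 1)%Z -> (residue b1 mod 7 = 0)%Z ->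
  (residue b2 mod 7 <> 0)%Z.
Proof.
intros Hd H1 H2. apply Z.mod_divide in H1 as [x Hx]; [|lia]. apply Z.mod_divide in H2 as [y Hy];
  [|lia].
unfold residue in *.
assert (E : pdet b1 b2 = (7 * (x * snd b2 - y * snd b1))%Z).
{ unfold pdet. replace (fst b1) with (x * 7 - 4 * snd b1)%Z by lia.
  replace (fst b2) with (y * 7 - 4 * snd b2)%Z by lia. ring. }
rewrite E in Hd. nia.
Qed.

Definition latT (w : C) (p : Z * Z) : C := (Cconj (alpha p) - w * alpha p)%C.

Lemma latT_additive w : additive (latT w).
Proof. intros p q. unfold latT. rewrite alpha_additive, Cplus_conj. ring. Qed.

Lemma latT_lower w p : (1 - Cmod w) * Cmod (alpha p) <= Cmod (latT w p).
Proof.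
unfold latT. pose proof (Cmod_triangle_rev (Cconj (alpha p)) (- (w * alpha p))).
rewrite Cmod_opp, Cmod_mult, Cmod_conj in H. unfold Cminus. lra.
Qed.

Lemma latT_psize w p : Cmod w < 1 -> p <> (0, 0)%Z ->
  (1 - Cmod w) / 4 * psize p <= Cmod (latT w p).
Proof.
intros Hw Hp. pose proof (latT_lower w p). pose proof (alpha_psize p Hp).
apply Rle_trans with ((1 - Cmod w) * Cmod (alpha p)); [|easy].
replace ((1 - Cmod w) / 4 * psize p) with ((1 - Cmod w) * (psize p / 4)) by field.
apply Rmult_le_compat_l; lra.
Qed.

(** The real-linear map z -> conj(z) - w z has determinant |w|^2 - 1, and sqrt 7 / 2 is the covolume
    of Z[eta]. *)
Lemma latT_covolume w b1 b2 :
  Im (Cconj (latT w b1) * latT w b2) = (Cmod w ^ 2 - 1) * (sqrt 7 / 2) * IZR (pdet b1 b2).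
Proof.
rewrite Cmod2_alt. unfold latT.
assert (E1 := Re_alpha b1). assert (E2 := Im_alpha b1). assert (E3 := Re_alpha b2). assert (E4 :=
  Im_alpha b2).
destruct (alpha b1) as [x1 y1], (alpha b2) as [x2 y2], w as [w1 w2].
unfold Re, Im in *; cbn [fst snd] in *. unfold pdet. rewrite minus_IZR, !mult_IZR.
simpl. rewrite E1, E2, E3, E4. field.
Qed.

(* The sum of eps(alpha) / (conj(alpha) - w alpha), that is, the sum of the
   coef h w^h. *)
Definition Gf (w : C) : C := latG (latT w).

(** The covolume is |b1|^2 |Im v|, and (Im v)^2 >= 3/4 for reduced v; the resulting factor sqrt(7/3)
    is below 2. *)
Lemma latT_short w b1 b2 : Cmod w < 1 -> (pdet b1 b2 * pdet b1 b2 = 1)%Z -> latT w b1 <> 0 ->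
  reduced (latT w b2 / latT w b1)%C -> Cmod (latT w b1) ^ 2 <= 2 * (1 - Cmod w ^ 2).
Proof.
intros Hw Hd Hb [Hr Hm]. set (v := (latT w b2 / latT w b1)%C) in *.
assert (HC := latT_covolume w b1 b2).
assert (E : (Cconj (latT w b1) * latT w b2)%C = (RtoC (Cmod (latT w b1) ^ 2) * v)%C).
{ rewrite Cmod2_conj. unfold v. field. easy. }
rewrite E, im_scal_l in HC.
assert (Hv : 1 <= Re v ^ 2 + Im v ^ 2) by (rewrite <- Cmod2_alt; nra).
assert (HI : 3 / 4 <= Im v ^ 2).
{ apply Rabs_le_between in Hr. nra. }
set (A := Cmod (latT w b1) ^ 2) in *. assert (HA : 0 <= A) by apply pow2_ge_0.
set (B := 1 - Cmod w ^ 2). assert (HB : 0 <= B) by (unfold B; pose proof (Cmod_ge_0 w); nra).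
assert (Hsq : (A * Im v) ^ 2 = B ^ 2 * (7 / 4)).
{ rewrite HC. apply (f_equal IZR) in Hd. rewrite mult_IZR in Hd.
  replace (((Cmod w ^ 2 - 1) * (sqrt 7 / 2) * IZR (pdet b1 b2)) ^ 2)
    with (B ^ 2 * (sqrt 7 * sqrt 7) / 4 * (IZR (pdet b1 b2) * IZR (pdet b1 b2))) by (unfold B;
      field).
  rewrite Hd, sqrt_sqrt by lra. field. }
assert (A ^ 2 * (3 / 4) <= B ^ 2 * (7 / 4)).
{ rewrite <- Hsq, Rpow_mult_distr. apply Rmult_le_compat_l; [apply pow2_ge_0|easy]. }
apply Rsqr_incr_0_var; [|lra]. unfold Rsqr. nra.
Qed.

(** The short vector is exhibited along with its length because the averaging argument has to locate
    it in a finite box. *)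
Lemma Gf_bound : exists B, 0 <= B /\ forall w, Cmod w < 1 -> exists b, b <> (0, 0)%Z /\
  Cmod (latT w b) ^ 2 <= 2 * (1 - Cmod w ^ 2) /\ Cmod (Gf w) <= B / Cmod (latT w b).
Proof.
destruct generic_sum_bound as (B & HB & H). exists (B + 1200). split; [lra|]. intros w Hw.
assert (Hk : 0 < (1 - Cmod w) / 4) by lra.
assert (HU := latT_additive w). assert (HUk := fun p => latT_psize w p Hw).
destruct (reduced_basis (latT w) _ HU Hk HUk) as (b1 & b2 & Hd & Hb & Hred).
assert (Hn := lattice_neq_0 (latT w) _ Hk HUk b1 Hb).
assert (Hc : 0 < / Cmod (latT w b1)) by (apply Rinv_0_lt_compat; now apply Cmod_gt_0).
exists b1. split; [easy|]. split; [now apply (latT_short w b1 b2)|].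
unfold Gf, Rdiv. rewrite Rmult_comm.
destruct (Z.eq_dec (residue b1 mod 7) 0) as [H0|H0].
- assert (H2 := residue_basis b1 b2 Hd H0).
  rewrite (latG_kernel _ _ HU Hk HUk b1 b2 Hd Hn H0 H2), Cmod_mult, Cmod_inv by easy.
  apply Rmult_le_compat_l; [lra|]. pose proof (kernel_sum_bound _ _ Hred H2). lra.
- rewrite (latG_generic _ _ HU Hk HUk b1 b2 Hd Hn H0), Cmod_mult, Cmod_inv by easy.
  apply Rmult_le_compat_l; [lra|].
  pose proof (H _ (residue b1) (residue b2) Hred). lra.
Qed.

(** * Lower bound for the sum over a thin lattice *)

Lemma list_sum_C_single {I : Type} (f : I -> C) (i : I) F : NoDup F -> In i F ->
  (forall j, j <> i -> f j = RtoC 0) -> list_sum_C f F = f i.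
Proof.
intros HF Hi H. destruct (in_split i F Hi) as (A & B & ->).
apply NoDup_remove_2 in HF. rewrite list_sum_C_app. cbn [list_sum_C fold_right].
fold (list_sum_C f B).
assert (E : forall L, ~ In i L -> list_sum_C f L = RtoC 0).
{ intros L HL. rewrite (list_sum_C_ext f (fun _ => RtoC 0)); [apply list_sum_C_0|].
  intros j Hj. apply H. intros ->. easy. }
rewrite !E; [ring| |]; intros Hx; apply HF, in_or_app; auto.
Qed.

Lemma chi7_opp j : chi7 (- j) = - chi7 j.
Proof.
unfold chi7. rewrite <- opp_IZR. f_equal. rewrite legendre_mod, (legendre_mod j).
rewrite <- (Z.mul_1_l j) at 1. rewrite <- Z.mul_opp_l, <- Zmult_mod_idemp_r.
destruct (mod7_cases j) as [->|[->|[->|[->|[->|[->| ->]]]]]]; reflexivity.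
Qed.

(* Each block of seven terms is positive: the signs are + + - + - - . *)
Lemma sum_chi7_div_ge n : (1 <= n)%nat ->
  1 <= list_sum_R (fun i => chi7 (Z.of_nat i) / INR i) (seq 1 (7 * n)).
Proof.
intros Hn. destruct n as [|n]; [lia|]. clear Hn.
assert (Hblock : forall k,
  list_sum_R (fun i => chi7 (Z.of_nat i) / INR i) (seq (1 + 7 * k) 7)
  = 1 / (7 * INR k + 1) + 1 / (7 * INR k + 2) - 1 / (7 * INR k + 3)
   + 1 / (7 * INR k + 4) - 1 / (7 * INR k + 5) - 1 / (7 * INR k + 6)).
{ intros k. cbn [seq list_sum_R fold_right].
  assert (E : forall a : nat, chi7 (Z.of_nat (a + 7 * k)) = chi7 (Z.of_nat a)).
  { intros a. unfold chi7. rewrite legendre_mod, (legendre_mod (Z.of_nat a)). do 2 f_equal.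
    replace (Z.of_nat (a + 7 * k)) with (Z.of_nat a + Z.of_nat k * 7)%Z by lia. apply
      Z_mod_plus_full. }
  assert (E' : forall a : nat, INR (a + 7 * k) = 7 * INR k + INR a).
  { intros a. rewrite plus_INR, mult_INR. simpl (INR 7). ring. }
  change (S (S (S (S (S (S (1 + 7 * k))))))) with (7 + 7 * k)%nat.
  change (S (S (S (S (S (1 + 7 * k)))))) with (6 + 7 * k)%nat.
  change (S (S (S (S (1 + 7 * k))))) with (5 + 7 * k)%nat.
  change (S (S (S (1 + 7 * k)))) with (4 + 7 * k)%nat.
  change (S (S (1 + 7 * k))) with (3 + 7 * k)%nat.
  change (S (1 + 7 * k)) with (2 + 7 * k)%nat.
  rewrite !E, !E'.
  change (chi7 (Z.of_nat 1)) with 1. change (chi7 (Z.of_nat 2)) with 1.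
  change (chi7 (Z.of_nat 3)) with (-1). change (chi7 (Z.of_nat 4)) with 1.
  change (chi7 (Z.of_nat 5)) with (-1). change (chi7 (Z.of_nat 6)) with (-1).
  change (chi7 (Z.of_nat 7)) with 0.
  replace (INR 1) with 1 by (simpl; ring). replace (INR 2) with 2 by (simpl; ring).
  replace (INR 3) with 3 by (simpl; ring). replace (INR 4) with 4 by (simpl; ring).
  replace (INR 5) with 5 by (simpl; ring). replace (INR 6) with 6 by (simpl; ring).
  unfold Rdiv. ring. }
induction n as [|n IH].
(* The first block alone is 1 + 1/2 - 1/3 + 1/4 - 1/5 - 1/6 = 1.05. *)
- change (7 * 1)%nat with 7%nat. specialize (Hblock 0%nat). change (1 + 7 * 0)%nat with 1%nat in
  Hblock.
  rewrite Hblock. simpl INR. lra.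
- replace (7 * S (S n))%nat with (7 * S n + 7)%nat by lia.
  rewrite seq_app, list_sum_R_app, Hblock.
  set (x := 7 * INR (S n)). assert (Hx : 0 <= x) by (unfold x; pose proof (pos_INR (S n)); lra).
  assert (D : forall a b, 0 < a <= b -> 0 <= 1 / (x + a) - 1 / (x + b)).
  { intros a b Hab. assert (/ (x + b) <= / (x + a)) by (apply Rinv_le_contravar; lra). lra. }
  (* Each negative term is paired with an earlier positive one: 3 with 1, 5 with 2, 6 with 4. *)
  pose proof (D 1 3 ltac:(lra)). pose proof (D 2 5 ltac:(lra)). pose proof (D 4 6 ltac:(lra)). lra.
Qed.

Lemma zsym_split (f : Z -> C) X :
  list_sum_C f (zsym X)
  = (f 0%Z + list_sum_C (fun i => f (Z.of_nat i) + f (- Z.of_nat i)%Z) (seq 1 X))%C.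
Proof.
rewrite list_sum_C_plus, <- (list_sum_C_map Z.of_nat), <- (list_sum_C_map (fun i => - Z.of_nat
  i)%Z f).
rewrite <- list_sum_C_app.
transitivity (list_sum_C f (0%Z :: map Z.of_nat (seq 1 X) ++ map (fun i => - Z.of_nat i)%Z (seq 1
  X)));
 [|reflexivity].
apply list_sum_C_perm, NoDup_Permutation; [apply NoDup_zsym| |].
- constructor.
  + rewrite in_app_iff, !in_map_iff. intros [(i & E & Hi)|(i & E & Hi)]; apply in_seq in Hi; lia.
  + apply NoDup_app.
    * apply FinFun.Injective_map_NoDup; [|apply seq_NoDup]. intros i j H; lia.
    * apply FinFun.Injective_map_NoDup; [|apply seq_NoDup]. intros i j H; lia.
    * intros z Hz Hz'. apply in_map_iff in Hz as (i & <- & Hi). apply in_map_iff in Hz' as (j & E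
      & Hj).
      apply in_seq in Hi, Hj. lia.
- intros z. rewrite in_zsym. simpl. rewrite in_app_iff, !in_map_iff. split.
  + intros H. destruct (Z.lt_trichotomy z 0) as [Hz|[Hz|Hz]]; [right; right|now left|right; left].
    * exists (Z.to_nat (- z)). rewrite in_seq. lia.
    * exists (Z.to_nat z). rewrite in_seq. lia.
  + intros [<-|[(i & <- & Hi)|(i & <- & Hi)]]; [lia| |]; apply in_seq in Hi; lia.
Qed.

(** A partial sum of 2 L(1, chi7): the character and the inverse are both odd, so i and -i
    contribute equally. *)
Lemma row0_ge n : (1 <= n)%nat ->
  2 <= Re (list_sum_C (fun i => chi7 i * / IZR i)%C (zsym (7 * n))).
Proof.
intros Hn. rewrite zsym_split, Re_plus.
change (chi7 0) with 0. rewrite Cmult_0_l, re_RtoC, Rplus_0_l.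
rewrite (list_sum_C_ext _ (fun i => RtoC (2 * (chi7 (Z.of_nat i) / INR i)))).
- rewrite list_sum_C_RtoC, re_RtoC, list_sum_R_scal. pose proof (sum_chi7_div_ge n Hn). lra.
- intros i Hi. apply in_seq in Hi. assert (INR i <> 0) by (apply not_0_INR; lia).
  assert (RtoC (INR i) <> 0) by (intros E; apply RtoC_inj in E; easy).
  rewrite chi7_opp, opp_IZR, <- INR_IZR_INZ, !RtoC_opp, RtoC_mult, RtoC_div by easy. field. easy.
Qed.

Lemma Cmod_inv_IZR_le n (b : R) : 0 < b -> b <= Rabs (IZR n) -> Cmod (/ IZR n) <= / b.
Proof. intros Hb H. apply Cinv_Cmod_le; [easy|]. now rewrite Cmod_R. Qed.

(** Two summations by parts are undone. The boundary terms amount to 3 + 3 for weight 1 and 18 + 18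
    for weight 2, hence 42. *)
Lemma row0_by_parts X : (2 <= X)%nat ->
  Cmod (list_sum_C (fun n => weight 2 1 n * (/ IZR n - / IZR (n + 1) - (/ IZR (n + 1) - / IZR (n
    + 1 + 1))))%C (zsym X)
    - list_sum_C (fun i => chi7 i * / IZR i)%C (zsym X)) <= 42 / (INR X - 1).
Proof.
intros HX. apply le_INR in HX. simpl (INR 2) in HX.
set (a := fun n : Z => (/ IZR n)%C). set (b := fun n : Z => (a n - a (n + 1)%Z)%C).
change (Cmod (list_sum_C (fun n => weight 2 1 n * (b n - b (n + 1)%Z))%C (zsym X)
   - list_sum_C (fun i => chi7 i * a i)%C (zsym X)) <= 42 / (INR X - 1)).
rewrite zsym_by_parts.
rewrite (list_sum_C_ext (fun m => ((weight 2 1 m - weight 2 1 (m - 1)%Z)%R * b m)%C)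
  (fun m => weight 1 1 m * (a m - a (m + 1)%Z))%C) by (intros m _; now rewrite weight_S).
rewrite zsym_by_parts.
rewrite (list_sum_C_ext (fun m => ((weight 1 1 m - weight 1 1 (m - 1)%Z)%R * a m)%C)
  (fun i => chi7 i * a i)%C).
2:{ intros m _. rewrite weight_S by easy. unfold weight; cbn [iter_antidiff]. now rewrite
  Z.mul_1_l. }
set (S0 := list_sum_C _ _).
assert (Ha : forall n, INR X - 1 <= Rabs (IZR n) -> Cmod (a n) <= / (INR X - 1)).
{ intros n Hn. apply Cmod_inv_IZR_le; [lra|easy]. }
assert (Hb : forall n, INR X - 1 <= Rabs (IZR n) -> INR X - 1 <= Rabs (IZR (n + 1)) ->
   Cmod (b n) <= 2 * / (INR X - 1)).
{ intros n Hn Hn'. unfold b, Cminus. eapply Rle_trans; [apply Cmod_triangle|]. rewrite Cmod_opp.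
  pose proof (Ha n Hn). pose proof (Ha _ Hn'). lra. }
assert (Hw : forall K m z B, 0 <= B -> Cmod z <= B -> Cmod (weight K 1 m * z) <= 3 ^ K * B).
{ intros K m z B HB Hz. rewrite Cmod_mult, Cmod_R.
  apply Rmult_le_compat; [apply Rabs_pos|apply Cmod_ge_0|apply weight_bound|easy]. }
assert (Hi : 0 < / (INR X - 1)) by (apply Rinv_0_lt_compat; lra).
assert (A1 : Cmod (weight 1 1 (- Z.of_nat X - 1) * a (- Z.of_nat X)%Z) <= 3 ^ 1 * / (INR X - 1)).
{ apply Hw; [lra|]. apply Ha. rewrite opp_IZR, Rabs_Ropp, <- INR_IZR_INZ, Rabs_right; lra. }
assert (A2 : Cmod (weight 1 1 (Z.of_nat X) * a (Z.of_nat X + 1)%Z) <= 3 ^ 1 * / (INR X - 1)).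
{ apply Hw; [lra|]. apply Ha. rewrite plus_IZR, <- INR_IZR_INZ, Rabs_right; lra. }
assert (A3 : Cmod (weight 2 1 (- Z.of_nat X - 1) * b (- Z.of_nat X)%Z) <= 3 ^ 2 * (2 * / (INR X -
  1))).
{ apply Hw; [lra|]. apply Hb.
  - rewrite opp_IZR, Rabs_Ropp, <- INR_IZR_INZ, Rabs_right; lra.
  - rewrite plus_IZR, opp_IZR, <- INR_IZR_INZ, Rabs_left1; lra. }
assert (A4 : Cmod (weight 2 1 (Z.of_nat X) * b (Z.of_nat X + 1)%Z) <= 3 ^ 2 * (2 * / (INR X - 1))).
{ apply Hw; [lra|]. apply Hb; rewrite !plus_IZR, <- INR_IZR_INZ, Rabs_right; lra. }
match goal with |- Cmod ?z <= _ =>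
  set (x1 := (weight 1 1 (- Z.of_nat X - 1) * a (- Z.of_nat X)%Z)%C) in *;
  set (x2 := (weight 1 1 (Z.of_nat X) * a (Z.of_nat X + 1)%Z)%C) in *;
  set (x3 := (weight 2 1 (- Z.of_nat X - 1) * b (- Z.of_nat X)%Z)%C) in *;
  set (x4 := (weight 2 1 (Z.of_nat X) * b (Z.of_nat X + 1)%Z)%C) in * end.
replace (S0 + x1 - x2 + x3 - x4 - S0)%C with ((x1 + - x2) + (x3 + - x4))%C by ring.
eapply Rle_trans; [apply Cmod_triangle|].
pose proof (Cmod_triangle x1 (- x2)) as T1. pose proof (Cmod_triangle x3 (- x4)) as T2.
rewrite Cmod_opp in T1, T2. unfold Rdiv. simpl pow in *. lra.
Qed.

(** Interpolation between two lower bounds for x. The product of three such factors has exponent 5/2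
    > 2 in the first, enough for summability, and 1/2 in the second, which supplies decay. *)
Lemma le_Rpower_mean x a b : 0 < a <= x -> 0 < b <= x -> Rpower a (5 / 6) * Rpower b (1 / 6) <= x.
Proof.
intros Ha Hb.
apply Rle_trans with (Rpower x (5 / 6) * Rpower x (1 / 6)).
- apply Rmult_le_compat; try (apply Rlt_le, exp_pos); apply Rle_Rpower_l; lra.
- rewrite <- Rpower_plus. replace (5 / 6 + 1 / 6) with 1 by field. rewrite Rpower_1; lra.
Qed.

(** The row m = 0 does not involve v and gives at least 2, up to two errors of 1/4; the other rows
    together are O(|v|^(-1/2)). The residues 1 and 4 are those of 1 and eta. *)
Lemma generic_sum_lower : exists c, 0 <= c /\ forall v, reduced v ->
  3 / 2 - c * Rpower (Cmod v) (- (1 / 2)) <= Re (generic_sum v 1 4).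
Proof.
destruct (sum_psize_bounded (5 / 2)) as (B & HB0 & HB); [lra|].
(* 18 is the weight bound 9 times the 2 of the second difference; each denominator exceeds both
   psize p / 12 and |v| / 2. *)
set (k := 18 * Rpower 12 (5 / 2) * Rpower 2 (1 / 2)).
assert (Hk : 0 < k) by (unfold k; repeat apply Rmult_lt_0_compat; try apply exp_pos; lra).
exists (k * B). split; [nra|]. intros v Hv. assert (Hv1 : 1 <= Cmod v) by apply Hv.
set (u := fun p : Z * Z => (iter_antidiff 1 2 chi7 (1 * fst p + 4 * snd p)%Z
     * iter_pdiff e1 2 (fun p => / latU v p) p)%C).
assert (HUk : forall p, p <> (0, 0)%Z -> / 4 * psize p <= Cmod (latU v p))
  by (intros; now apply latU_psize).
assert (Hw : forall j, Rabs (iter_antidiff 1 2 chi7 j) <= 9).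
{ intros j. pose proof (iter_antidiff_bound chi7 1 1 2 chi7_bound j). lra. }
assert (Hu : summable u).
{ apply summable_bounded_mult with 9; [intros; apply Hw|].
  apply summable_second_diff_inv with (/ 4); [apply latU_additive|lra|easy]. }
set (u0 := fun p : Z * Z => if (snd p =? 0)%Z then u p else RtoC 0).
set (u1 := fun p : Z * Z => if (snd p =? 0)%Z then RtoC 0 else u p).
assert (Hu0 : summable u0).
{ apply (summable_le u _ 1 Hu). intros p. unfold u0. destruct (_ =? _)%Z; [lra|].
  rewrite Cmod_0. pose proof (Cmod_ge_0 (u p)); lra. }
assert (Hu1 : summable u1).
{ apply (summable_le u _ 1 Hu). intros p. unfold u1. destruct (_ =? _)%Z; [|lra].
  rewrite Cmod_0. pose proof (Cmod_ge_0 (u p)); lra. }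
assert (E : generic_sum v 1 4 = (usum u0 + usum u1)%C).
{ rewrite <- usum_plus by easy. apply (usum_ext u); [easy|]. intros p. unfold u0, u1.
  destruct (_ =? _)%Z; ring. }
assert (B1 : Cmod (usum u1) <= k * B * Rpower (Cmod v) (- (1 / 2))).
{ apply usum_Cmod_le. intros F HF.
  apply Rle_trans with (list_sum_R (fun p => k * Rpower (Cmod v) (- (1 / 2)) * Rpower (psize p)
    (- (5 / 2))) F).
  - apply list_sum_R_le. intros p _. unfold u1.
    destruct (Z.eqb_spec (snd p) 0) as [H0|H0].
    { rewrite Cmod_0. repeat apply Rmult_le_pos; try apply Rlt_le, exp_pos; lra. }
    unfold u. rewrite Cmod_mult, Cmod_R.
    (* The three denominators i = 0, 1, 2 are treated at once; the right-hand alternative only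
       restricts i to these values. *)
    assert (HN : forall i, Rpower (psize p / 12) (5 / 6) * Rpower (Cmod v / 2) (1 / 6)
       <= Cmod (latU v p + IZR i) \/ (i <> 0 /\ i <> 1 /\ i <> 2)%Z).
    { intros i. destruct (Z.eq_dec i 0) as [Hi|Hi0]; [left|destruct (Z.eq_dec i 1) as [Hi|Hi1];
        [left|destruct (Z.eq_dec i 2) as [Hi|Hi2]; [left|now right]]];
      (apply le_Rpower_mean;
       [split; [pose proof (psize_pos p); lra|]|split; [lra|]];
       replace (latU v p + IZR i)%C with (latU v (padd p (i, 0%Z)))
         by (rewrite latU_additive; unfold latU; cbn [fst snd]; ring);
       [apply Rle_trans with (/ 4 * psize (padd p (i, 0%Z)));
         [pose proof (psize_shift p (i, 0%Z)) as HP; subst i; unfold psize at 3 in HP; simpl in HP;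
          pose proof (psize_pos p); lra
         |apply HUk; unfold padd; cbn [fst snd]; intros E'; inversion E'; lia]
       |apply Rsqr_incr_0_var; [|apply Cmod_ge_0]; unfold Rsqr;
        pose proof (reduced_quadratic v (IZR (fst p + i)) (IZR (snd p)) Hv) as HQ;
        unfold latU, padd; cbn [fst snd]; rewrite Z.add_0_r;
        assert (1 <= IZR (snd p) ^ 2) by
          (rewrite pow_IZR_abs; assert (1 <= IZR (Z.abs (snd p))) by (apply IZR_le; lia); nra);
        pose proof (pow2_ge_0 (IZR (fst p + i))); nra]). }
    set (x := Rpower (psize p / 12) (5 / 6) * Rpower (Cmod v / 2) (1 / 6)) in *.
    assert (Hx : 0 < x) by (unfold x; apply Rmult_lt_0_compat; apply exp_pos).
    set (z := latU v p) in *.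
    destruct (HN 0%Z) as [N0|]; [|lia]. destruct (HN 1%Z) as [N1|]; [|lia]. destruct (HN 2%Z) as
      [N2|]; [|lia].
    rewrite iter_pdiff_2, !latU_additive. fold z.
    replace (latU v e1) with (RtoC 1) by (unfold latU, e1; cbn [fst snd]; ring).
    assert (z + 0 <> 0 /\ z + 1 <> 0 /\ z + 2 <> 0)%C as (M0 & M1 & M2).
    { repeat split; apply Cmod_gt_0; lra. }
    replace (z + (1 + 1))%C with (z + 2)%C by ring. rewrite Cplus_0_r in M0, N0.
    replace (/ z - 2 * / (z + 1) + / (z + 2))%C with (2 * (/ z * / (z + 1) * / (z + 2)))%C
      by (field; auto).
    rewrite !Cmod_mult, Cmod_R, (Rabs_right 2) by lra.
    apply Rle_trans with (9 * (2 * (/ x * / x * / x))).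
    { apply Rmult_le_compat; [apply Rabs_pos|repeat apply Rmult_le_pos; try apply Cmod_ge_0;
      lra|apply Hw|].
      apply Rmult_le_compat_l; [lra|].
      repeat apply Rmult_le_compat; try apply Cmod_ge_0; try (apply Rmult_le_pos; apply Cmod_ge_0);
      now apply Cinv_Cmod_le. }
    assert (Ex : x * x * x = Rpower (psize p / 12) (5 / 2) * Rpower (Cmod v / 2) (1 / 2)).
    { unfold x. replace (5 / 2) with (5 / 6 + 5 / 6 + 5 / 6) by field.
      replace (1 / 2) with (1 / 6 + 1 / 6 + 1 / 6) by field. rewrite !Rpower_plus. ring. }
    replace (9 * (2 * (/ x * / x * / x))) with (18 * / (x * x * x)) by (field; lra). rewrite Ex.
    rewrite Rinv_mult. unfold k. right.
    pose proof (psize_pos p) as Hp.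
    rewrite !Rpower_Ropp. unfold Rdiv. rewrite <- !Rpower_mult_distr by (try lra; apply
      Rinv_0_lt_compat; lra).
    assert (EI : forall y a, 0 < y -> Rpower (/ y) a = / Rpower y a).
    { intros y a Hy. unfold Rpower. rewrite ln_Rinv by easy. rewrite <- exp_Ropp. f_equal; ring. }
    rewrite !EI by lra. rewrite !Rinv_mult, !Rinv_inv.
    ring.
  - rewrite list_sum_R_scal. specialize (HB F HF).
    assert (0 < Rpower (Cmod v) (- (1 / 2))) by apply exp_pos.
    replace (k * B * Rpower (Cmod v) (- (1 / 2))) with (k * Rpower (Cmod v) (- (1 / 2)) * B) by
      ring.
    apply Rmult_le_compat_l; [apply Rlt_le, Rmult_lt_0_compat; easy|easy]. }
assert (B0 : 3 / 2 <= Re (usum u0)).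
{ destruct (box_limit u0 (/ 4) Hu0) as (n0 & Hn0); [lra|].
  (* A multiple of 7, as [row0_ge] requires, and at least 700 so that 42 / (X - 1) is below 1/4. *)
  set (X := (7 * (n0 + 100))%nat). specialize (Hn0 X n0 ltac:(unfold X; lia) (le_n _)).
  rewrite (list_sum_C_single _ 0%Z) in Hn0; [|apply NoDup_zsym|apply in_zsym; lia|].
  2:{ intros m Hm. rewrite (list_sum_C_ext _ (fun _ => RtoC 0)); [apply list_sum_C_0|].
      intros n _. unfold u0; cbn [snd]. apply Z.eqb_neq in Hm. now rewrite Hm. }
  rewrite (list_sum_C_ext _ (fun n => weight 2 1 n * (/ IZR n - / IZR (n + 1) - (/ IZR (n + 1) -
    / IZR (n + 1 + 1))))%C) in Hn0.
  2:{ intros n _. unfold u0; cbn [snd Z.eqb]. unfold u, weight; cbn [fst snd].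
      rewrite Z.mul_0_r, Z.add_0_r. f_equal. rewrite iter_pdiff_2. unfold latU, padd, e1; cbn
        [fst snd].
      rewrite !Z.add_0_r, !Z.add_assoc, !Cmult_0_l, !Cplus_0_r. ring. }
  pose proof (row0_by_parts X ltac:(unfold X; lia)) as HP.
  pose proof (row0_ge (n0 + 100) ltac:(lia)) as HR. fold X in HR.
  assert (42 / (INR X - 1) <= / 4).
  { assert (700 <= INR X) by (unfold X; rewrite mult_INR, plus_INR; pose proof (pos_INR n0);
      replace (INR 100) with 100 by (rewrite INR_IZR_INZ; reflexivity); simpl (INR 7); lra).
    apply (Rmult_le_reg_r (INR X - 1)); [lra|]. unfold Rdiv. rewrite Rmult_assoc, Rinv_l by lra.
      lra. }
  set (S1 := list_sum_C (fun n => weight 2 1 n * _)%C (zsym X)) in *.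
  set (S2 := list_sum_C (fun i => chi7 i * / IZR i)%C (zsym X)) in *.
  pose proof (re_le_Cmod (S1 - S2)) as H1. pose proof (re_le_Cmod (S1 - usum u0)) as H2.
  apply Rabs_le_between in H1, H2.
  replace (Re (S1 - S2)%C) with (Re S1 - Re S2) in H1 by (unfold Re; simpl; ring).
  replace (Re (S1 - usum u0)%C) with (Re S1 - Re (usum u0)) in H2 by (unfold Re; simpl; ring).
    lra. }
rewrite E, Re_plus. pose proof (re_le_Cmod (usum u1)) as H. apply Rabs_le_between in H. lra.
Qed.

(** * The generating function on the real axis *)

Lemma sqrt7_bounds : 2 < sqrt 7 < 3.
Proof.
pose proof (sqrt_sqrt 7 ltac:(lra)). pose proof (sqrt_pos 7). split; nra.
Qed.

Lemma alpha_eta : alpha e2 = (1 / 2, sqrt 7 / 2).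
Proof. apply C_ext; [rewrite Re_alpha|rewrite Im_alpha]; unfold Re, Im, e2; simpl; field. Qed.

(** At w = r the basis 1, eta is sent to 1 - r and an almost imaginary vector of bounded length. The
    ratio v is reduced with |v| of order 1/(1 - r), so the error in [generic_sum_lower] becomes
    small. *)
Lemma Gf_pos_lower : exists r0, 0 < r0 < 1 /\ forall r, r0 <= r < 1 -> 1 / (1 - r) <= Re (Gf r).
Proof.
destruct generic_sum_lower as (c & Hc & H).
(* Chosen so that c V^(-1/2) = c / (2 c + 1) <= 1/2, which leaves 3/2 - 1/2 = 1. *)
set (V := (2 * c + 1) ^ 2). assert (HV : 1 <= V) by (unfold V; nra).
exists (1 - / (V + 1)). assert (HiV : 0 < / (V + 1) <= / 2).
{ split; [apply Rinv_0_lt_compat; lra|apply Rinv_le_contravar; lra]. }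
split; [lra|]. intros r Hr.
assert (Hcr : Cmod r < 1) by (rewrite Cmod_R, Rabs_right; lra).
assert (Hk : 0 < (1 - Cmod r) / 4) by lra.
assert (ET1 : latT r e1 = RtoC (1 - r)).
{ unfold latT, e1. rewrite alpha_int. apply C_ext; simpl; ring. }
assert (ET2 : latT r e2 = ((1 - r) / 2, - ((1 + r) * sqrt 7) / 2)).
{ unfold latT. rewrite alpha_eta. apply C_ext; unfold Re, Im; simpl; field. }
set (v := (latT r e2 / latT r e1)%C).
assert (Ev : v = (1 / 2, - ((1 + r) * sqrt 7) / (2 * (1 - r)))).
{ unfold v. rewrite ET1, ET2.
  apply C_ext; unfold Cdiv, Cinv, Cmult, RtoC, Re, Im; cbn [fst snd]; field; nra. }
pose proof sqrt7_bounds as H7.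
assert (HIm : V <= Rabs (Im v)).
{ rewrite Ev. unfold Im; cbn [snd]. unfold Rdiv. rewrite Ropp_mult_distr_l_reverse, Rabs_Ropp.
  assert (Hi : V + 1 <= / (1 - r)).
  { rewrite <- (Rinv_inv (V + 1)). apply Rinv_le_contravar; lra. }
  assert (0 < / (1 - r)) by lra.
  rewrite Rinv_mult. rewrite Rabs_right by (apply Rle_ge, Rmult_le_pos; [nra|apply Rmult_le_pos;
    lra]).
  replace ((1 + r) * sqrt 7 * (/ 2 * / (1 - r))) with ((1 + r) * sqrt 7 / 2 * / (1 - r)) by
    (field; lra).
  assert (1 <= (1 + r) * sqrt 7 / 2) by nra. nra. }
assert (HvV : V <= Cmod v) by (eapply Rle_trans; [exact HIm|apply im_le_Cmod]).
assert (Hred : reduced v).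
{ split; [|lra]. rewrite Ev. unfold Re; simpl. rewrite Rabs_right; lra. }
unfold Gf.
rewrite (latG_generic _ _ (latT_additive r) Hk (fun p => latT_psize r p Hcr) e1 e2);
  [|reflexivity|rewrite ET1; intros E; apply RtoC_inj in E; lra|easy].
fold v. rewrite ET1. change (residue e1) with 1%Z. change (residue e2) with 4%Z.
rewrite <- RtoC_inv by lra. rewrite re_scal_l. unfold Rdiv. rewrite Rmult_comm.
apply Rmult_le_compat_l; [apply Rlt_le, Rinv_0_lt_compat; lra|].
eapply Rle_trans; [|apply (H v Hred)].
assert (c * Rpower (Cmod v) (- (1 / 2)) <= / 2); [|lra].
apply Rle_trans with (c * Rpower V (- (1 / 2))).
{ apply Rmult_le_compat_l; [easy|]. apply Rpower_neg_le; lra. }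
assert (EV : Rpower V (- (1 / 2)) = / (2 * c + 1)).
{ rewrite Rpower_Ropp. f_equal. unfold V. rewrite <- Rpower_pow by lra.
  rewrite Rpower_mult. replace (INR 2 * (1 / 2)) with 1 by (simpl; field). apply Rpower_1; lra. }
rewrite EV. apply (Rmult_le_reg_r (2 * c + 1)); [lra|]. rewrite Rmult_assoc, Rinv_l by lra. lra.
Qed.

(** Here the shortest vector is the image of sqrt(-7) = -1 + 2 eta, of length s = (1 - r) sqrt 7,
    and the kernel case applies. Its main term over s may be of order 1/(1 - r), but it has the
    favourable sign; the error 1056 / |v| over s stays bounded since |v| >= 1/(2 s). *)
Lemma Gf_neg_lower r : 9 / 10 <= r < 1 -> - 2112 <= Re (Gf (- r)%R).
Proof.
intros Hr.
assert (Hcr : Cmod (- r)%R < 1) by (rewrite Cmod_R, Rabs_Ropp, Rabs_right; lra).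
assert (Hk : 0 < (1 - Cmod (- r)%R) / 4) by lra.
set (b1 := (-1, 2)%Z).
pose proof sqrt7_bounds as H7.
assert (Ea : alpha b1 = (0, sqrt 7)).
{ apply C_ext; [rewrite Re_alpha|rewrite Im_alpha]; unfold Re, Im, b1; simpl; field. }
assert (ET1 : latT (- r)%R b1 = (0, - ((1 - r) * sqrt 7))).
{ unfold latT. rewrite Ea. apply C_ext; unfold Re, Im; simpl; ring. }
assert (ET2 : latT (- r)%R e2 = ((1 + r) / 2, - ((1 - r) * sqrt 7) / 2)).
{ unfold latT. rewrite alpha_eta. apply C_ext; unfold Re, Im; simpl; field. }
assert (HT1 : latT (- r)%R b1 <> 0).
{ rewrite ET1. intros E. apply (f_equal Im) in E. unfold Im in E; simpl in E. nra. }
set (v := (latT (- r)%R e2 / latT (- r)%R b1)%C).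
assert (Hv1 : 0 < (1 - r) * sqrt 7) by nra.
assert (Ev : v = (1 / 2, (1 + r) / (2 * ((1 - r) * sqrt 7)))).
{ unfold v. rewrite ET1, ET2.
  apply C_ext; unfold Cdiv, Cinv, Cmult, RtoC, Re, Im; cbn [fst snd]; field; nra. }
set (y := (1 + r) / (2 * ((1 - r) * sqrt 7))) in *.
assert (Hy : / (2 * ((1 - r) * sqrt 7)) <= y).
{ unfold y, Rdiv. rewrite <- (Rmult_1_l (/ _)) at 1. apply Rmult_le_compat_r; [|lra].
  apply Rlt_le, Rinv_0_lt_compat. lra. }
assert (Hs : (1 - r) * sqrt 7 <= / 2) by nra.
assert (Hy1 : 1 <= y).
{ eapply Rle_trans; [|exact Hy]. rewrite <- Rinv_1 at 1. apply Rinv_le_contravar; lra. }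
assert (Hvy : y <= Cmod v).
{ eapply Rle_trans; [|apply im_le_Cmod]. rewrite Ev. unfold Im; cbn [snd]. apply Rle_abs. }
assert (Hred : reduced v).
{ split; [|lra]. rewrite Ev. unfold Re; simpl. rewrite Rabs_right; lra. }
unfold Gf.
rewrite (latG_kernel _ _ (latT_additive _) Hk (fun p => latT_psize _ p Hcr) b1 e2); try easy.
fold v. rewrite ET1. change (residue e2) with 4%Z.
set (s := (1 - r) * sqrt 7) in *.
assert (EI : (/ (0%R, (- s)%R))%C = (0, / s)).
{ apply C_ext; unfold Cinv, Re, Im; cbn [fst snd]; field; lra. }
rewrite EI. set (z := kernel_sum v 4).
replace (Re ((0%R, (/ s)%R) * z)%C) with (- (/ s * Im z)) by (destruct z; unfold Re, Im; simpl;
  ring).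
assert (His : 0 < / s) by (apply Rinv_0_lt_compat; lra).
assert (Hz : Im z <= 1056 / Cmod v).
{ apply le_epsilon. intros d Hd.
  destruct (kernel_sum_approx v 4 d Hred ltac:(easy) Hd) as (X & HX).
  specialize (HX X (le_n _)). fold z in HX.
  (* Thus the kernel sum is close to +2 times the row; its imaginary part is then bounded above,
     because Im v > 0 makes every term of the row have negative imaginary part. *)
  assert (Ew : weight 1 4 0 + weight 1 4 (-1) = -2).
  { unfold weight, antidiff, iter_antidiff, antidiff, chi7. cbn [seq list_sum_R fold_right].
    repeat match goal with |- context [legendre ?a ?b] =>
      let t := eval vm_compute in (legendre a b) in change (legendre a b) with t end.
    simpl INR. lra. }
  rewrite Ew in HX. pose proof (im_le_Cmod (z + (-2)%R * row v X 1)) as HI.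
  replace (Im (z + (-2)%R * row v X 1)%C) with (Im z + (-2) * Im (row v X 1)) in HI
    by (destruct z, (row v X 1); unfold Im; simpl; ring).
  assert (Hrow : Im (row v X 1) <= 0).
  { unfold row. rewrite list_sum_C_Im.
    apply Rle_trans with (list_sum_R (fun _ : Z => 0) (zsym X)); [|rewrite list_sum_R_const; lra].
    apply list_sum_R_le. intros n _. unfold latU; cbn [fst snd]. rewrite Ev.
    set (x := IZR n + 1 / 2).
    replace (IZR n + 1 * ((1 / 2)%R, y))%C with ((x, y) : C)
      by (apply C_ext; unfold x, Re, Im; simpl; ring).
    unfold Cinv, Im; cbn [fst snd].
    assert (0 < / (x ^ 2 + y ^ 2)) by (apply Rinv_0_lt_compat; nra).
    unfold Rdiv. nra. }
  apply Rabs_le_between in HI. lra. }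
assert (H2 : / s * (1056 / Cmod v) <= 2112).
{ assert (Hiv : / Cmod v <= 2 * s).
  { rewrite <- (Rinv_inv (2 * s)). apply Rinv_le_contravar; [apply Rinv_0_lt_compat; lra|lra]. }
  unfold Rdiv. assert (HP : / s * / Cmod v <= / s * (2 * s)) by (apply Rmult_le_compat_l; lra).
  replace (/ s * (2 * s)) with 2 in HP by (field; lra). lra. }
assert (/ s * Im z <= / s * (1056 / Cmod v)) by (apply Rmult_le_compat_l; lra). lra.
Qed.

(** * Taylor expansion of the generating function *)

(** Discrete Leibniz rule for second differences. *)
Lemma second_diff_mult (f0 f1 f2 g0 g1 g2 : C) :
  (f0 * g0 - 2 * (f1 * g1) + f2 * g2
   = f0 * (g0 - 2 * g1 + g2) + 2 * ((f0 - f1) * (g1 - g2)) + (f0 - 2 * f1 + f2) * g2)%C.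
Proof. ring. Qed.

Lemma Cmod_2 (z : C) : Cmod (2 * z) = 2 * Cmod z.
Proof. rewrite Cmod_mult, Cmod_R, Rabs_right; lra. Qed.

Lemma Cmod_triangle3 (a b c : C) : Cmod (a + b + c) <= Cmod a + Cmod b + Cmod c.
Proof.
eapply Rle_trans; [apply Cmod_triangle|]. apply Rplus_le_compat_r, Cmod_triangle.
Qed.

Lemma unimodular_pow_diff (a b : C) x n : Cmod a = 1 -> Cmod b = 1 -> Cmod (a - b) <= x ->
  Cmod (a ^ n - b ^ n) <= INR n * x.
Proof.
intros Ha Hb Hx. induction n as [|n IH].
- simpl. replace (1 - 1)%C with (RtoC 0) by ring. rewrite Cmod_0; lra.
- rewrite !Cpow_S, S_INR.
  replace (a * a ^ n - b * b ^ n)%C with (a * (a ^ n - b ^ n) + (a - b) * b ^ n)%C by ring.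
  eapply Rle_trans; [apply Cmod_triangle|]. rewrite !Cmod_mult, Cmod_pow, Ha, Hb, pow1. lra.
Qed.

Lemma unimodular_pow_second_diff (a b c : C) x y n : Cmod a = 1 -> Cmod b = 1 -> Cmod c = 1 ->
  Cmod (a - b) <= x -> Cmod (b - c) <= x -> Cmod (a - 2 * b + c) <= y ->
  Cmod (a ^ n - 2 * b ^ n + c ^ n) <= INR n * y + INR n ^ 2 * x ^ 2.
Proof.
intros Ha Hb Hc Hx Hx' Hy.
assert (Hx0 : 0 <= x) by (eapply Rle_trans; [apply Cmod_ge_0|exact Hx]).
induction n as [|n IH].
- simpl. replace (1 - 2 * 1 + 1)%C with (RtoC 0) by ring. rewrite Cmod_0; lra.
- replace (a ^ S n - 2 * b ^ S n + c ^ S n)%C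
    with (a ^ n * a - 2 * (b ^ n * b) + c ^ n * c)%C by (rewrite !Cpow_S; ring).
  rewrite second_diff_mult. eapply Rle_trans; [apply Cmod_triangle3|].
  rewrite Cmod_2, !Cmod_mult, Cmod_pow, Ha, Hc, pow1.
  assert (HD := unimodular_pow_diff a b x n Ha Hb Hx). rewrite S_INR.
  assert (Cmod (a ^ n - b ^ n) * Cmod (b - c) <= INR n * x * x).
  { apply Rmult_le_compat; try apply Cmod_ge_0; easy. }
  pose proof (pos_INR n). nra.
Qed.

(* 1 / latT w = sum_(h < H) w^h coef_term h + w^H tail H w. *)
Definition tail (H : nat) (w : C) (p : Z * Z) : C :=
  ((alpha p * / Cconj (alpha p)) ^ H * / latT w p)%C.

Lemma latT_neq_0 w p : Cmod w < 1 -> p <> (0, 0)%Z -> latT w p <> 0.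
Proof.
intros Hw Hp. apply Cmod_gt_0. pose proof (latT_psize w p Hw Hp). pose proof (psize_pos p).
assert (0 < (1 - Cmod w) / 4 * psize p) by (apply Rmult_lt_0_compat; lra). lra.
Qed.

Lemma latT_at_0 w : latT w (0, 0)%Z = RtoC 0.
Proof. apply additive_0, latT_additive. Qed.

Lemma tail_S H w p : Cmod w < 1 -> tail H w p = (coef_term H p + w * tail (S H) w p)%C.
Proof.
intros Hw. unfold tail, coef_term.
destruct (excluded_middle_informative (p = (0, 0)%Z)) as [->|Hp].
- rewrite latT_at_0, alpha_0. replace (Cconj 0) with (RtoC 0) by (apply C_ext; simpl; ring).
  rewrite Cinv_0, !Cpow_S. ring.
- assert (HT := latT_neq_0 w p Hw Hp). assert (Ha := alpha_neq_0 p Hp).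
  assert (Hc := Cconj_neq_0 _ Ha). unfold latT in *.
  rewrite !Cpow_S, Cpow_mult_l. set (z := alpha p) in *. set (c := Cconj z) in *.
  set (A := (z ^ H)%C). set (B := ((/ c) ^ H)%C). field. auto.
Qed.

Lemma Cmod_ratio (z : C) : Cmod (z * / Cconj z) <= 1.
Proof.
destruct (excluded_middle_informative (z = 0)) as [->|Hz].
- rewrite Cmult_0_l, Cmod_0; lra.
- assert (Hc := Cconj_neq_0 z Hz). rewrite Cmod_mult, Cmod_inv, Cmod_conj by easy.
  rewrite Rinv_r; [lra|]. apply Cmod_gt_0 in Hz. lra.
Qed.

Lemma Cmod_ratio_1 (z : C) : z <> 0 -> Cmod (z * / Cconj z) = 1.
Proof.
intros Hz. assert (Hc := Cconj_neq_0 z Hz). rewrite Cmod_mult, Cmod_inv, Cmod_conj by easy.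
rewrite Rinv_r; [easy|]. apply Cmod_gt_0 in Hz. lra.
Qed.

(** The first difference is (z - conj z) / (conj z (conj z + 1)). For every real k, |z - conj z| <=
    2 |conj z + k|, which cancels one denominator and leaves a factor X per difference. *)
Lemma ratio_bounds (z : C) X : 0 < X -> z <> 0 -> (z + 1)%C <> 0 -> (z + 2)%C <> 0 ->
  Cmod (/ (z + 1)) <= X -> Cmod (/ (z + 2)) <= X ->
  let a := (z * / Cconj z)%C in
  let b := ((z + 1) * / Cconj (z + 1))%C in
  let c := ((z + 2) * / Cconj (z + 2))%C in
  Cmod (a - b) <= 2 * X /\ Cmod (b - c) <= 2 * X /\ Cmod (a - 2 * b + c) <= 4 * X ^ 2.
Proof.
intros HX H0 H1 H2 B1 B2 a b c.
assert (C0 := Cconj_neq_0 _ H0). assert (C1 := Cconj_neq_0 _ H1). assert (C2 := Cconj_neq_0 _ H2).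
rewrite <- (Cmod_conj (/ (z + 1))), Cinv_conj in B1 by easy.
rewrite <- (Cmod_conj (/ (z + 2))), Cinv_conj in B2 by easy.
unfold a, b, c.
rewrite Cplus_conj in C1, B1. rewrite Cplus_conj in C2, B2. rewrite !Cplus_conj.
assert (E1 : Cconj 1 = RtoC 1) by (apply C_ext; simpl; ring).
assert (E2 : Cconj 2 = RtoC 2) by (apply C_ext; simpl; ring).
rewrite E1 in *. rewrite E2 in *.
assert (D : forall k : R, Cmod (z - Cconj z) <= 2 * Cmod (Cconj z + k)).
{ intros k. replace (z - Cconj z)%C with (Cconj (Cconj z + k) - (Cconj z + k))%C.
  - unfold Cminus. eapply Rle_trans; [apply Cmod_triangle|]. rewrite Cmod_opp, Cmod_conj. lra.
  - rewrite Cplus_conj, Cconj_conj. replace (Cconj k) with (RtoC k) by (apply C_ext; simpl;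
    ring). ring. }
assert (G : forall k : R, (Cconj z + k)%C <> 0 -> Cmod (z - Cconj z) * Cmod (/ (Cconj z + k)) <= 2).
{ intros k Hk. rewrite Cmod_inv by easy. assert (Hp := Hk). apply Cmod_gt_0 in Hp.
  apply (Rmult_le_reg_r (Cmod (Cconj z + k))); [easy|]. rewrite Rmult_assoc, Rinv_l, Rmult_1_r by
    lra.
  apply D. }
assert (G0 : Cmod (z - Cconj z) * Cmod (/ Cconj z) <= 2).
{ assert (E : Cconj z = (Cconj z + 0)%C) by ring.
  rewrite E at 2. apply G. now rewrite <- E. }
assert (G1 := G 1 C1).
set (y := Cconj z) in *.
assert (N0 := Cmod_ge_0 (z - y)). assert (P0 := Cmod_ge_0 (/ y)).
assert (P1 := Cmod_ge_0 (/ (y + 1))). assert (P2 := Cmod_ge_0 (/ (y + 2))).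
split; [|split].
- replace (z * / y - (z + 1) * / (y + 1))%C with ((z - y) * / y * / (y + 1))%C by (field; auto).
  rewrite !Cmod_mult. apply Rmult_le_compat; [apply Rmult_le_pos| | |]; easy.
- replace ((z + 1) * / (y + 1) - (z + 2) * / (y + 2))%C with ((z - y) * / (y + 1) * / (y + 2))%C
  by (field; auto).
  rewrite !Cmod_mult. apply Rmult_le_compat; [apply Rmult_le_pos| | |]; easy.
- replace (z * / y - 2 * ((z + 1) * / (y + 1)) + (z + 2) * / (y + 2))%C
    with (2 * ((z - y) * / y * (/ (y + 1) * / (y + 2))))%C by (field; auto).
  rewrite Cmod_2, !Cmod_mult.
  assert (Cmod (/ (y + 1)) * Cmod (/ (y + 2)) <= X * X) by (apply Rmult_le_compat; easy).
  assert (Cmod (z - y) * Cmod (/ y) * (Cmod (/ (y + 1)) * Cmod (/ (y + 2))) <= 2 * (X * X)).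
  { apply Rmult_le_compat; [apply Rmult_le_pos|apply Rmult_le_pos| |]; easy. }
  lra.
Qed.

(** Leibniz for the product of a unimodular H-th power and 1/latT: each difference gains a power of
    1/psize and costs at most a factor H, whence (1 + H)^2. This growth is harmless against the
    factor w^H of the expansion. *)
Lemma tail_diff_le r : 0 <= r < 1 -> exists c, 0 <= c /\ forall w H p, Cmod w <= r ->
  Cmod (iter_pdiff e1 2 (tail H w) p) <= c * (1 + INR H) ^ 2 * Rpower (psize p) (- (3)).
Proof.
(* 12 = 4 * 3: the constant of [latT_psize] times the loss of a shift by at most two steps. *)
intros Hr. set (k := 12 / (1 - r)). assert (Hk : 12 <= k).
{ unfold k. apply (Rmult_le_reg_r (1 - r)); [lra|]. unfold Rdiv. rewrite Rmult_assoc, Rinv_l; lra. }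
exists (10000 * k ^ 3). split; [apply Rmult_le_pos; [lra|apply pow_le; lra]|].
intros w H p Hw. pose proof (psize_ge_1 p) as Hp. pose proof (pos_INR H) as HH.
rewrite Rpower_neg3 by lra.
set (P := / psize p). assert (HP : 0 < P) by (apply Rinv_0_lt_compat; lra).
replace (/ psize p ^ 3) with (P ^ 3) by (unfold P; now rewrite pow_inv).
assert (Hk3 : 0 < k ^ 3) by (apply pow_lt; lra).
assert (Hk1 : k <= k ^ 3).
{ replace (k ^ 3) with (k * (k * k)) by ring. rewrite <- (Rmult_1_r k) at 1.
  apply Rmult_le_compat_l; nra. }
assert (Hk2 : k ^ 2 <= k ^ 3).
{ replace (k ^ 3) with (k ^ 2 * k) by ring. rewrite <- (Rmult_1_r (k ^ 2)) at 1.
  apply Rmult_le_compat_l; nra. }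
set (q1 := padd p e1). set (q2 := padd p (padd e1 e1)).
assert (S1 : psize p <= psize q1 * 3).
{ pose proof (psize_shift p e1). fold q1 in H0. replace (psize e1) with 2 in H0 by (unfold psize;
  simpl; ring).
  pose proof (psize_pos q1). lra. }
assert (S2 : psize p <= psize q2 * 3).
{ pose proof (psize_shift p (padd e1 e1)). fold q2 in H0.
  replace (psize (padd e1 e1)) with 3 in H0 by (unfold psize; simpl; ring). easy. }
rewrite iter_pdiff_2. fold q1 q2.
assert (HT : forall q, psize p <= psize q * 3 -> q <> (0, 0)%Z -> Cmod (/ latT w q) <= k * P).
{ intros q Hq Hq0.
  replace (k * P) with (/ ((1 - r) / 12 * psize p)) by (unfold k, P; field; lra).
  apply Cinv_Cmod_le; [apply Rmult_lt_0_compat; lra|].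
  eapply Rle_trans; [|apply latT_psize; [lra|easy]].
  assert (1 - r <= 1 - Cmod w) by lra. pose proof (psize_pos q). nra. }
assert (HT0 : forall q, psize p <= psize q * 3 -> Cmod (tail H w q) <= k * P).
{ intros q Hq. unfold tail. rewrite Cmod_mult, Cmod_pow.
  destruct (excluded_middle_informative (q = (0, 0)%Z)) as [->|Hq0].
  - rewrite latT_at_0, Cinv_0, Cmod_0, Rmult_0_r. apply Rmult_le_pos; lra.
  - rewrite <- (Rmult_1_l (k * P)). apply Rmult_le_compat; [apply pow_le, Cmod_ge_0|apply
    Cmod_ge_0| |auto].
    apply Rle_trans with (1 ^ H); [apply pow_incr; split; [apply Cmod_ge_0|apply
      Cmod_ratio]|rewrite pow1; lra]. }
destruct (excluded_middle_informative (p <> (0, 0)%Z /\ q1 <> (0, 0)%Z /\ q2 <> (0, 0)%Z)) as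
  [(N0 & N1 & N2)|Hn].
- assert (A0 := alpha_neq_0 _ N0). assert (A1 := alpha_neq_0 _ N1). assert (A2 := alpha_neq_0 _ N2).
  assert (Eq1 : alpha q1 = (alpha p + 1)%C) by (unfold q1; rewrite alpha_additive; unfold e1; now
    rewrite alpha_int).
  assert (Eq2 : alpha q2 = (alpha p + 2)%C).
  { unfold q2. rewrite !alpha_additive. unfold e1; rewrite alpha_int. simpl. ring. }
  assert (HA : forall q, psize p <= psize q * 3 -> q <> (0, 0)%Z -> Cmod (/ alpha q) <= 12 * P).
  { intros q Hq Hq0. replace (12 * P) with (/ (psize p / 12)) by (unfold P; field; lra).
    apply Cinv_Cmod_le; [lra|]. pose proof (alpha_psize q Hq0). lra. }
  assert (HA1 := HA q1 S1 N1). assert (HA2 := HA q2 S2 N2). rewrite Eq1 in A1, HA1. rewrite Eq2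
    in A2, HA2.
  destruct (ratio_bounds (alpha p) (12 * P) ltac:(lra) A0 A1 A2 HA1 HA2) as (R1 & R2 & R3).
  rewrite <- Eq1 in R1, R2, R3. rewrite <- Eq2 in R2, R3.
  assert (U0 := Cmod_ratio_1 _ A0). assert (U1 := Cmod_ratio_1 _ A1). assert (U2 := Cmod_ratio_1
    _ A2).
  rewrite <- Eq1 in U1. rewrite <- Eq2 in U2.
  unfold tail.
  set (a := (alpha p * / Cconj (alpha p))%C) in *.
  set (b := (alpha q1 * / Cconj (alpha q1))%C) in *.
  set (c := (alpha q2 * / Cconj (alpha q2))%C) in *.
  assert (T0 := latT_neq_0 w p ltac:(lra) N0). assert (T1 := latT_neq_0 w q1 ltac:(lra) N1).
  assert (T2 := latT_neq_0 w q2 ltac:(lra) N2).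
  assert (V0 := HT p ltac:(lra) N0). assert (V1 := HT q1 S1 N1). assert (V2 := HT q2 S2 N2).
  assert (Ht : Cmod (latT w e1) <= 2).
  { unfold latT, e1. rewrite alpha_int. unfold Cminus. eapply Rle_trans; [apply Cmod_triangle|].
    rewrite Cmod_opp, Cmod_mult, Cmod_conj, Cmod_1. lra. }
  assert (L1 : latT w q1 = (latT w p + latT w e1)%C) by apply latT_additive.
  assert (L2 : latT w q2 = (latT w p + (latT w e1 + latT w e1))%C)
    by (unfold q2; now rewrite !latT_additive).
  assert (D1 : Cmod (/ latT w q1 - / latT w q2) <= 2 * (k * P * (k * P))).
  { replace (/ latT w q1 - / latT w q2)%C with (latT w e1 * (/ latT w q1 * / latT w q2))%C.
    - rewrite !Cmod_mult. apply Rmult_le_compat; try apply Cmod_ge_0; [|easy|].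
      + apply Rmult_le_pos; apply Cmod_ge_0.
      + apply Rmult_le_compat; try apply Cmod_ge_0; easy.
    - rewrite L1 in T1 |- *. rewrite L2 in T2 |- *. field. auto. }
  assert (D2 : Cmod (/ latT w p - 2 * / latT w q1 + / latT w q2) <= 8 * (k * P * (k * P) * (k *
    P))).
  { replace (/ latT w p - 2 * / latT w q1 + / latT w q2)%C
      with (2 * (latT w e1 * latT w e1 * (/ latT w p * / latT w q1 * / latT w q2)))%C.
    - rewrite Cmod_2, !Cmod_mult.
      replace (8 * (k * P * (k * P) * (k * P))) with (2 * (2 * 2 * (k * P * (k * P) * (k * P))))
        by ring.
      apply Rmult_le_compat_l; [lra|].
      repeat (apply Rmult_le_compat; try easy); repeat apply Rmult_le_pos; apply Cmod_ge_0.
    - rewrite L1 in T1 |- *. rewrite L2 in T2 |- *. field. auto. }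
  rewrite second_diff_mult. eapply Rle_trans; [apply Cmod_triangle3|].
  rewrite Cmod_2, !Cmod_mult, Cmod_pow, U0, pow1.
  assert (F1 := unimodular_pow_diff a b _ H U0 U1 R1).
  assert (F2 := unimodular_pow_second_diff a b c _ _ H U0 U1 U2 R1 R2 R3).
  assert (G1 : Cmod (a ^ H - b ^ H) * Cmod (/ latT w q1 - / latT w q2)
     <= INR H * (2 * (12 * P)) * (2 * (k * P * (k * P))))
    by (apply Rmult_le_compat; try apply Cmod_ge_0; easy).
  assert (G2 : Cmod (a ^ H - 2 * b ^ H + c ^ H) * Cmod (/ latT w q2)
     <= (INR H * (4 * (12 * P) ^ 2) + INR H ^ 2 * (2 * (12 * P)) ^ 2) * (k * P))
    by (apply Rmult_le_compat; try apply Cmod_ge_0; easy).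
  set (h := INR H) in *.
  apply Rle_trans with ((8 * k ^ 3 + 96 * h * k ^ 2 + 576 * (h + h ^ 2) * k) * P ^ 3).
  { nra. }
  apply Rmult_le_compat_r; [apply pow_le; lra|].
  assert (0 <= h ^ 2) by apply pow2_ge_0.
  assert (96 * h * k ^ 2 <= 96 * h * k ^ 3) by (apply Rmult_le_compat_l; lra).
  assert (576 * (h + h ^ 2) * k <= 576 * (h + h ^ 2) * k ^ 3) by (apply Rmult_le_compat_l; lra).
  replace (10000 * k ^ 3 * (1 + h) ^ 2) with (k ^ 3 * (10000 * (1 + h) ^ 2)) by ring.
  apply Rle_trans with (k ^ 3 * (8 + 96 * h + 576 * (h + h ^ 2))); [lra|].
  apply Rmult_le_compat_l; [lra|]. nra.
(* One of the three points is the origin, so psize p <= 3 and no decay has to be shown. *)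
- assert (HP3 : / 3 <= P).
  { unfold P. apply Rinv_le_contravar; [lra|].
    assert (E0 : psize (0, 0)%Z = 1) by (unfold psize; simpl; ring).
    destruct (excluded_middle_informative (p = (0, 0)%Z)) as [->|]; [lra|].
    destruct (excluded_middle_informative (q1 = (0, 0)%Z)) as [E|]; [rewrite E in S1; lra|].
    destruct (excluded_middle_informative (q2 = (0, 0)%Z)) as [E|]; [rewrite E in S2; lra|].
    exfalso; apply Hn; auto. }
  unfold Cminus. eapply Rle_trans; [apply Cmod_triangle3|]. rewrite Cmod_opp, Cmod_2.
  pose proof (HT0 p ltac:(lra)). pose proof (HT0 q1 S1). pose proof (HT0 q2 S2).
  apply Rle_trans with (4 * k * P); [lra|].
  assert (1 <= 9 * P ^ 2) by nra.
  assert (4 * k * P <= 36 * k * P ^ 3).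
  { replace (36 * k * P ^ 3) with (4 * k * P * (9 * P ^ 2)) by ring.
    rewrite <- (Rmult_1_r (4 * k * P)) at 1. apply Rmult_le_compat_l; [|easy].
    apply Rmult_le_pos; lra. }
  assert (0 < P ^ 3) by (apply pow_lt; easy).
  assert (36 * k * P ^ 3 <= 36 * k ^ 3 * P ^ 3) by nra.
  assert (0 < k ^ 3 * P ^ 3) by (apply Rmult_lt_0_compat; easy).
  assert (1 <= (1 + INR H) ^ 2) by nra. nra.
Qed.

Lemma tail_summable w H : Cmod w < 1 -> summable (iter_pdiff e1 2 (tail H w)).
Proof.
intros Hw. destruct (tail_diff_le (Cmod w)) as (c & Hc & HT).
{ split; [apply Cmod_ge_0|easy]. }
apply (summable_psize 3 (c * (1 + INR H) ^ 2)); [lra|]. intros p. apply HT. lra.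
Qed.

Lemma coef_term_tail h p : coef_term h p = tail h 0 p.
Proof.
rewrite tail_S by (rewrite Cmod_0; lra). ring.
Qed.

Lemma coef_summable h : summable (iter_pdiff e1 2 (coef_term h)).
Proof.
replace (coef_term h) with (tail h 0) by (extensionality p; now rewrite coef_term_tail).
apply tail_summable. rewrite Cmod_0; lra.
Qed.

Lemma reg_sum_plus e K f g g' : mean_zero_mod7 f -> summable (iter_pdiff e K g) ->
  summable (iter_pdiff e K g') ->
  reg_sum e K f (fun p => g p + g' p)%C = (reg_sum e K f g + reg_sum e K f g')%C.
Proof.
intros Hf Hg Hg'. unfold reg_sum.
rewrite <- usum_plus by auto using summable_weighted.
symmetry; apply usum_ext; [apply summable_plus; now apply summable_weighted|].
intros p. assert (E : forall K p, iter_pdiff e K (fun q => g q + g' q)%C p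
   = (iter_pdiff e K g p + iter_pdiff e K g' p)%C).
{ clear. induction K; intros p; simpl; [easy|]. unfold pdiff; rewrite !IHK; ring. }
rewrite E. ring.
Qed.

Lemma reg_sum_scal e K f c g : mean_zero_mod7 f -> summable (iter_pdiff e K g) ->
  reg_sum e K f (fun p => c * g p)%C = (c * reg_sum e K f g)%C.
Proof.
intros Hf Hg. unfold reg_sum. rewrite <- usum_scal by auto using summable_weighted.
symmetry; apply usum_ext; [now apply summable_scal, summable_weighted|].
intros p. rewrite iter_pdiff_scal. ring.
Qed.

(** A finite geometric expansion with exact remainder, by iterating [tail_S]; linearity of [reg_sum]
    is enough, and no two infinite sums are interchanged. *)
Lemma Gf_expansion w H : Cmod w < 1 ->
  Gf w = (list_sum_C (fun h => coef h * w ^ h) (seq 0 H) + w ^ H * reg_sum e1 2 chi7 (tail H w))%C.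
Proof.
intros Hw. induction H as [|H IH].
- simpl. rewrite Cplus_0_l, Cmult_1_l. unfold Gf, latG. f_equal. extensionality p.
  unfold tail; simpl. ring.
- rewrite IH, seq_S, list_sum_C_app. cbn [list_sum_C fold_right Nat.add].
  replace (tail H w) with (fun p => coef_term H p + w * tail (S H) w p)%C
    by (extensionality p; now rewrite <- tail_S).
  rewrite reg_sum_plus, reg_sum_scal; auto using chi7_mean_zero, coef_summable, tail_summable.
  + fold (coef H). rewrite Cpow_S. ring.
  + eapply summable_ext; [intros p; symmetry; apply iter_pdiff_scal|].
    now apply summable_scal, tail_summable.
Qed.

Lemma Gf_partial_sum r : 0 <= r < 1 -> exists c, 0 <= c /\ forall w H, Cmod w <= r ->
  Cmod (Gf w - list_sum_C (fun h => coef h * w ^ h)%C (seq 0 H)) <= c * ((1 + INR H) ^ 2 * r ^ H).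
Proof.
intros Hr. destruct (tail_diff_le r Hr) as (c & Hc & HT).
destruct (sum_psize_bounded 3) as (B & HB0 & HB); [lra|].
exists (9 * c * B). split; [apply Rmult_le_pos; lra|]. intros w H Hw.
rewrite (Gf_expansion w H) by lra.
match goal with |- Cmod (?a + ?b - ?a) <= _ => replace (a + b - a)%C with b by ring end.
rewrite Cmod_mult, Cmod_pow.
replace (9 * c * B * ((1 + INR H) ^ 2 * r ^ H)) with (r ^ H * (9 * c * (1 + INR H) ^ 2 * B)) by
  ring.
apply Rmult_le_compat; [apply pow_le, Cmod_ge_0|apply Cmod_ge_0| |].
- apply pow_incr. split; [apply Cmod_ge_0|easy].
- apply usum_Cmod_le. intros F HF.
  apply Rle_trans with (list_sum_R (fun p => 9 * c * (1 + INR H) ^ 2 * Rpower (psize p) (- (3))) F).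
  + apply list_sum_R_le. intros p _. rewrite Cmod_mult, Cmod_R, !Rmult_assoc.
    apply Rmult_le_compat; [apply Rabs_pos|apply Cmod_ge_0| |].
    * pose proof (iter_antidiff_bound chi7 (residue e1) 1 2 chi7_bound (residue p)). lra.
    * rewrite <- Rmult_assoc. now apply HT.
  + rewrite list_sum_R_scal. apply Rmult_le_compat_l; [|now apply HB].
    apply Rmult_le_pos; [lra|apply pow2_ge_0].
Qed.

Lemma sqr_pow_small r e : 0 < r < 1 -> 0 < e -> exists H0, forall H, (H0 <= H)%nat ->
  (1 + INR H) ^ 2 * r ^ H <= e.
Proof.
intros Hr He. set (l := - ln r). assert (Hl : 0 < l).
{ unfold l. rewrite <- ln_Rinv by lra. rewrite <- ln_1. apply ln_increasing; [lra|].
  rewrite <- Rinv_1. apply Rinv_lt_contravar; lra. }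
(* From exp(x) >= (x/3)^3 with x = h l, and 1 + h <= 2 h: the quotient is at most 4 * 27 / (l^3
   h). *)
set (k := 108 / (l ^ 3 * e)). destruct (archimed k) as [Hup _].
exists (1 + Z.to_nat (up k))%nat. intros H HH.
assert (Hl3 : 0 < l ^ 3) by (apply pow_lt; easy).
assert (Hk : 0 < k) by (unfold k; apply Rdiv_lt_0_compat; [lra|apply Rmult_lt_0_compat; easy]).
assert (H1 : 1 <= INR H) by (apply le_INR in HH; rewrite plus_INR in HH; pose proof (pos_INR
  (Z.to_nat (up k))); simpl in HH; lra).
assert (H2 : k <= INR H).
{ apply Rle_trans with (IZR (up k)); [lra|]. rewrite INR_IZR_INZ. apply IZR_le. lia. }
set (h := INR H) in *.
assert (Er : r ^ H = / exp (h * l)).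
{ rewrite <- Rpower_pow by lra. unfold Rpower. rewrite <- exp_Ropp. f_equal. unfold l, h. ring. }
rewrite Er.
assert (Hexp : (h * l / 3) ^ 3 <= exp (h * l)).
{ replace (h * l) with (h * l / 3 + h * l / 3 + h * l / 3) at 2 by field.
  rewrite !exp_plus. assert (0 < h * l) by nra. pose proof (exp_ineq1_le (h * l / 3)).
  replace (exp (h * l / 3) * exp (h * l / 3) * exp (h * l / 3)) with (exp (h * l / 3) ^ 3) by ring.
  apply pow_incr. lra. }
assert (HP : 0 < (h * l / 3) ^ 3) by (apply pow_lt; nra).
apply Rle_trans with ((2 * h) ^ 2 * / (h * l / 3) ^ 3).
- apply Rmult_le_compat; [apply pow2_ge_0|apply Rlt_le, Rinv_0_lt_compat, exp_pos| |].
  + apply pow_incr. lra.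
  + apply Rinv_le_contravar; easy.
- replace ((2 * h) ^ 2 * / (h * l / 3) ^ 3) with (108 / l ^ 3 * / h) by (field; lra).
  apply (Rmult_le_reg_r h); [lra|]. rewrite Rmult_assoc, Rinv_l, Rmult_1_r by lra.
  apply (Rmult_le_compat_l e) in H2; [|lra].
  replace (e * k) with (108 / l ^ 3) in H2 by (unfold k; field; lra). lra.
Qed.

(** * Second moment *)

Definition root_unity (H : nat) : C := cexp (Ci * (2 * PI / INR H)%R).

Lemma cexp_Ci (t : R) : cexp (Ci * t) = (cos t, sin t).
Proof.
unfold cexp. replace (Re (Ci * t)%C) with 0 by (unfold Re; simpl; ring).
replace (Im (Ci * t)%C) with t by (unfold Im; simpl; ring). rewrite exp_0. f_equal; ring.
Qed.

Lemma cexp_pow z n : (cexp z ^ n)%C = cexp (INR n * z).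
Proof.
induction n as [|n IH]; [simpl; now rewrite Cmult_0_l, cexp_0|].
rewrite Cpow_S, IH, <- cexp_plus, S_INR, RtoC_plus. f_equal; ring.
Qed.

Lemma root_unity_pow H d : (root_unity H ^ d)%C = cexp (Ci * (2 * (PI * INR d / INR H))%R).
Proof.
unfold root_unity. rewrite cexp_pow. f_equal. unfold Rdiv.
rewrite !RtoC_mult. ring.
Qed.

Lemma root_unity_order H : (1 <= H)%nat -> (root_unity H ^ H)%C = RtoC 1.
Proof.
intros HH. rewrite root_unity_pow, cexp_Ci.
assert (INR H <> 0) by (apply not_0_INR; lia).
replace (2 * (PI * INR H / INR H)) with (2 * PI) by (field; easy). now rewrite cos_2PI, sin_2PI.
Qed.

Lemma root_unity_primitive H d : (0 < d < H)%nat -> (root_unity H ^ d)%C <> 1.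
Proof.
intros Hd E. rewrite root_unity_pow, cexp_Ci in E. apply (f_equal Re) in E.
unfold Re in E; cbn [fst RtoC] in E. rewrite cos_2a_sin in E.
assert (H0 : 0 < INR H) by (apply lt_0_INR; lia).
assert (H1 : 0 < INR d) by (apply lt_0_INR; lia).
assert (H2 : INR d < INR H) by (apply lt_INR; lia). pose proof PI_RGT_0.
assert (0 < sin (PI * INR d / INR H)); [|nra].
apply sin_gt_0.
- apply Rdiv_lt_0_compat; nra.
- apply (Rmult_lt_reg_r (INR H)); [easy|]. unfold Rdiv. rewrite Rmult_assoc, Rinv_l by lra. nra.
Qed.

Lemma Cmod_root_unity H : Cmod (root_unity H) = 1.
Proof.
unfold root_unity. rewrite Cmod_cexp. replace (Re _) with 0 by (unfold Re; simpl; ring). apply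
  exp_0.
Qed.

Lemma geometric_sum (z : C) n :
  ((1 - z) * list_sum_C (fun j => z ^ j) (seq 0 n) = 1 - z ^ n)%C.
Proof.
induction n as [|n IH]; [simpl; ring|].
rewrite seq_S, list_sum_C_app, Cmult_plus_distr_l, IH. cbn [list_sum_C fold_right Nat.add].
rewrite Cpow_S. ring.
Qed.

Lemma geometric_sum_0 (z : C) n : z <> 1 -> (z ^ n)%C = RtoC 1 ->
  list_sum_C (fun j => z ^ j)%C (seq 0 n) = RtoC 0.
Proof.
intros Hz E. assert (H := geometric_sum z n). rewrite E in H.
assert (N : (1 - z)%C <> 0) by (intros E'; apply Hz; symmetry; now apply Ceq_minus).
rewrite <- (Cmult_1_l (list_sum_C _ _)), <- (Cinv_l _ N), <- Cmult_assoc, H. ring.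
Qed.

Lemma root_unity_orthogonal H h k : (h < H)%nat -> (k < H)%nat ->
  list_sum_C (fun j => (root_unity H ^ h * Cconj (root_unity H) ^ k) ^ j)%C (seq 0 H)
  = RtoC (if Nat.eq_dec h k then INR H else 0).
Proof.
intros Hh Hk. set (w := root_unity H).
assert (Hw : (w * Cconj w)%C = RtoC 1).
{ rewrite <- Cmod2_conj. unfold w. rewrite Cmod_root_unity. f_equal; ring. }
assert (HwH : (w ^ H)%C = RtoC 1) by (apply root_unity_order; lia).
assert (HcH : (Cconj w ^ H)%C = RtoC 1).
{ rewrite <- Cpow_conj, HwH. apply C_ext; simpl; ring. }
assert (Hone : forall n, ((w ^ n * Cconj w ^ n) = 1)%C).
{ intros n. now rewrite <- Cpow_mult_l, Hw, Cpow_1_l. }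
destruct (Nat.eq_dec h k) as [->|Hne].
- rewrite (list_sum_C_ext _ (fun _ => RtoC 1)).
  + rewrite list_sum_C_RtoC, list_sum_R_const, length_seq. f_equal; ring.
  + intros j _. now rewrite Hone, Cpow_1_l.
- apply geometric_sum_0.
  + intros E. destruct (Nat.lt_trichotomy h k) as [Hlt|[Hlt|Hlt]]; [|easy|].
    * apply (root_unity_primitive H (k - h)); [lia|]. fold w.
      replace k with (h + (k - h))%nat in E by lia.
      rewrite Cpow_add_r, Cmult_assoc, Hone, Cmult_1_l in E.
      transitivity (w ^ (k - h) * Cconj w ^ (k - h))%C; [rewrite E; ring|apply Hone].
    * apply (root_unity_primitive H (h - k)); [lia|]. fold w.
      replace h with (h - k + k)%nat in E by lia.
      now rewrite Cpow_add_r, <- Cmult_assoc, Hone, Cmult_1_r in E.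
  + rewrite Cpow_mult_l, <- !Cpow_mult_r, (Nat.mul_comm h), (Nat.mul_comm k), !Cpow_mult_r, HwH,
    HcH.
    rewrite !Cpow_1_l. ring.
Qed.

(** For polynomials of degree below H, averaging over the H-th roots of unity is exact and replaces
    the integral over the circle. *)
Lemma discrete_parseval (c : nat -> C) H : (1 <= H)%nat ->
  list_sum_R (fun j => Cmod (list_sum_C (fun h => c h * (root_unity H ^ j) ^ h)%C (seq 0 H)) ^ 2)
    (seq 0 H)
  = INR H * list_sum_R (fun h => Cmod (c h) ^ 2) (seq 0 H).
Proof.
intros HH. apply RtoC_inj. rewrite <- list_sum_C_RtoC.
set (w := root_unity H).
rewrite (list_sum_C_ext _ (fun j => list_sum_C (fun h => list_sum_C (fun k =>
   c h * Cconj (c k) * (w ^ h * Cconj w ^ k) ^ j) (seq 0 H)) (seq 0 H)))%C.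
2:{ intros j _. rewrite Cmod2_conj, list_sum_C_conj, Cmult_comm, <- list_sum_C_scal.
    apply list_sum_C_ext. intros h _. rewrite Cmult_comm, <- list_sum_C_scal.
    apply list_sum_C_ext. intros k _. rewrite Cmult_conj, !Cpow_conj, Cpow_mult_l, <- !Cpow_mult_r.
    rewrite (Nat.mul_comm j h), (Nat.mul_comm j k). ring. }
rewrite list_sum_C_exchange.
rewrite RtoC_mult, <- list_sum_C_RtoC, <- list_sum_C_scal.
apply list_sum_C_ext. intros h Hh. apply in_seq in Hh.
rewrite list_sum_C_exchange.
rewrite (list_sum_C_ext _ (fun k => c h * Cconj (c k) * RtoC (if Nat.eq_dec h k then INR H else
  0))%C).
2:{ intros k Hk. apply in_seq in Hk. rewrite list_sum_C_scal. f_equal.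
    apply root_unity_orthogonal; lia. }
rewrite (list_sum_C_single _ h).
- destruct (Nat.eq_dec h h); [|easy]. rewrite Cmod2_conj. ring.
- apply seq_NoDup.
- apply in_seq. lia.
- intros k Hk. destruct (Nat.eq_dec h k); [now symmetry in e|ring].
Qed.

(* The Poisson kernel has mean one. *)
Lemma circle_average_le (z : C) H : (1 <= H)%nat -> Cmod z < 1 -> Cmod z ^ H <= / 3 ->
  list_sum_R (fun j => / Cmod (1 - z * root_unity H ^ j) ^ 2) (seq 0 H) <= 2 * INR H / (1 - Cmod
    z ^ 2).
Proof.
intros HH Hz HzH. set (w := root_unity H). set (r := Cmod z) in *.
assert (Hr0 : 0 <= r) by apply Cmod_ge_0.
assert (Hmod : forall j, Cmod (z * w ^ j) = r).
{ intros j. rewrite Cmod_mult, Cmod_pow. unfold w. rewrite Cmod_root_unity, pow1, Rmult_1_r. easy. }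
assert (Hn1 : forall u : C, Cmod u < 1 -> (1 - u)%C <> 0).
{ intros u Hu E. apply Ceq_minus in E. rewrite <- E, Cmod_1 in Hu. lra. }
(* The Poisson kernel (1 - |u|^2) / |1 - u|^2 as the real part of an analytic function of u. *)
assert (HP : forall u : C, Cmod u < 1 -> / Cmod (1 - u) ^ 2 = (2 * Re (/ (1 - u)) - 1) / (1 -
  Cmod u ^ 2)).
{ intros u Hu. pose proof (Cmod2_neq_0 _ (Hn1 u Hu)) as H1. rewrite !Cmod2_alt.
  assert (H2 : 0 < 1 - (Re u ^ 2 + Im u ^ 2)).
  { rewrite <- Cmod2_alt. pose proof (Cmod_ge_0 u). nra. }
  destruct u as [a b]. unfold Cinv, Cminus, Cplus, Copp, RtoC, Re, Im in *. cbn [fst snd] in *.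
  field. split; lra. }
assert (HzH1 : Cmod (z ^ H) <= / 3) by (now rewrite Cmod_pow).
assert (Hsum : list_sum_C (fun j => / (1 - z * w ^ j))%C (seq 0 H) = (INR H * / (1 - z ^ H))%C).
{ assert (N : (1 - z ^ H)%C <> 0) by (apply Hn1; lra).
  rewrite (list_sum_C_ext _ (fun j => list_sum_C (fun k => / (1 - z ^ H) * z ^ k * (w ^ k * Cconj
    w ^ 0) ^ j) (seq 0 H)))%C.
  2:{ intros j _. assert (Nj := Hn1 (z * w ^ j)%C ltac:(rewrite Hmod; easy)).
      assert (G := geometric_sum (z * w ^ j) H).
      assert (EH : ((z * w ^ j) ^ H = z ^ H)%C).
      { rewrite Cpow_mult_l, <- Cpow_mult_r, Nat.mul_comm, Cpow_mult_r. unfold w.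
        rewrite root_unity_order, Cpow_1_l by easy. ring. }
      rewrite EH in G.
      rewrite (list_sum_C_ext _ (fun k => / (1 - z ^ H) * (z * w ^ j) ^ k)%C).
      - rewrite list_sum_C_scal.
        assert (ES : list_sum_C (fun k => (z * w ^ j) ^ k)%C (seq 0 H) = (/ (1 - z * w ^ j) * (1
          - z ^ H))%C).
        { rewrite <- G. field. easy. }
        transitivity (/ (1 - z ^ H) * (/ (1 - z * w ^ j) * (1 - z ^ H)))%C;
          [field; auto|f_equal; symmetry; exact ES].
      - intros k _. simpl (Cpow _ 0). rewrite Cmult_1_r, Cpow_mult_l, <- !Cpow_mult_r,
        (Nat.mul_comm j). ring. }
  rewrite list_sum_C_exchange.
  rewrite (list_sum_C_ext _ (fun k => / (1 - z ^ H) * z ^ k * RtoC (if Nat.eq_dec k 0 then INR H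
    else 0))%C).
  2:{ intros k Hk. apply in_seq in Hk. rewrite list_sum_C_scal. f_equal.
      apply root_unity_orthogonal; lia. }
  rewrite (list_sum_C_single _ 0%nat).
  - destruct (Nat.eq_dec 0 0); [|easy]. simpl (Cpow z 0). ring.
  - apply seq_NoDup.
  - apply in_seq. lia.
  - intros k Hk. destruct (Nat.eq_dec k 0); [easy|ring]. }
assert (H1r : 0 < 1 - r ^ 2) by nra.
rewrite (list_sum_R_ext _ (fun j => / (1 - r ^ 2) * (2 * Re (/ (1 - z * w ^ j))%C + -1))).
2:{ intros j _. rewrite HP by (rewrite Hmod; easy). rewrite Hmod. unfold Rdiv. ring. }
rewrite list_sum_R_scal, list_sum_R_plus, list_sum_R_scal, list_sum_R_const, length_seq.
rewrite <- list_sum_C_Re, Hsum, re_scal_l.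
(* The discrete average of 1/(1 - z w^j) is 1/(1 - z^H) instead of 1; with |z|^H <= 1/3 the final
   factor is 2 * (3/2) - 1 = 2. *)
assert (HR : Re (/ (1 - z ^ H))%C <= 3 / 2).
{ eapply Rle_trans; [apply Rle_abs|]. eapply Rle_trans; [apply re_le_Cmod|].
  replace (3 / 2) with (/ (2 / 3)) by field. apply Cinv_Cmod_le; [lra|].
  pose proof (Cmod_triangle_rev 1 (- z ^ H)). rewrite Cmod_opp, Cmod_1 in H0. unfold Cminus. lra. }
pose proof (pos_INR H) as HI. unfold Rdiv. rewrite Rmult_comm.
apply Rmult_le_compat_r; [apply Rlt_le, Rinv_0_lt_compat, H1r|]. nra.
Qed.

Lemma ln_step x : 0 < x -> / (1 + x) <= ln (1 + x) - ln x.
Proof.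
intros Hx.
assert (E : ln x = ln (1 + x) + ln (x / (1 + x))).
{ rewrite <- ln_mult; [f_equal; field; lra|lra|apply Rdiv_lt_0_compat; lra]. }
rewrite E. assert (0 < x / (1 + x)) by (apply Rdiv_lt_0_compat; lra).
pose proof (exp_ineq1_le (ln (x / (1 + x)))) as H1. rewrite exp_ln in H1 by easy.
replace (x / (1 + x)) with (1 - / (1 + x)) in H1 at 2 by (field; lra). lra.
Qed.

Lemma harmonic_le n : list_sum_R (fun i => / (1 + INR i)) (seq 0 (S n)) <= 1 + ln (1 + INR n).
Proof.
induction n as [|n IH].
- simpl. rewrite !Rplus_0_r, ln_1. lra.
- rewrite seq_S, list_sum_R_app. cbn [list_sum_R fold_right Nat.add].
  pose proof (pos_INR n). pose proof (ln_step (1 + INR n) ltac:(lra)).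
  rewrite S_INR. replace (1 + (INR n + 1)) with (1 + (1 + INR n)) by ring. lra.
Qed.

Lemma sum_inv_sq_from_le y n : 1 <= y -> list_sum_R (fun i => / (INR i + y) ^ 2) (seq 0 n) <= 2 / y.
Proof.
intros Hy.
assert (H : forall n, list_sum_R (fun i => / (INR i + y) ^ 2) (seq 0 (S n))
   <= / y ^ 2 + (/ y - / (INR n + y))).
{ induction n0 as [|k IH].
  - simpl. rewrite Rplus_0_l. lra.
  - rewrite seq_S, list_sum_R_app. cbn [list_sum_R fold_right Nat.add].
    pose proof (pos_INR k). rewrite S_INR.
    assert (/ (INR k + 1 + y) ^ 2 <= / (INR k + y) - / (INR k + 1 + y)); [|lra].
    replace (/ (INR k + y) - / (INR k + 1 + y)) with (/ ((INR k + y) * (INR k + 1 + y))) by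
      (field; lra).
    apply Rinv_le_contravar; nra. }
assert (H2 : / y ^ 2 <= / y) by (apply Rinv_le_contravar; nra).
destruct n as [|n].
- simpl. apply Rlt_le, Rdiv_lt_0_compat; lra.
- specialize (H n). pose proof (pos_INR n).
  assert (0 < / (INR n + y)) by (apply Rinv_0_lt_compat; lra). lra.
Qed.

Definition nonzero_box (n : nat) : list (Z * Z) :=
  filter (fun p => negb ((fst p =? 0)%Z && (snd p =? 0)%Z)) (list_prod (zbox n) (zbox n)).

Lemma in_nonzero_box n p : In p (nonzero_box n) -> p <> (0, 0)%Z.
Proof. intros H. apply filter_In in H as [_ H]. now intros ->. Qed.

Lemma list_sum_R_filter_le {I : Type} (f : I -> bool) (u : I -> R) F : (forall i, 0 <= u i) ->
  list_sum_R u (filter f F) <= list_sum_R u F.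
Proof.
intros Hu. induction F as [|i F IH]; simpl; [lra|].
specialize (Hu i). destruct (f i); simpl; lra.
Qed.

(** The logarithm of the second moment originates here: summing over one coordinate leaves a
    harmonic sum in the other. *)
Lemma sum_inv_norm_le n :
  list_sum_R (fun p => / Cmod (alpha p) ^ 2) (nonzero_box n) <= 128 * (1 + ln (1 + INR n)).
Proof.
apply Rle_trans with (list_sum_R (fun p => 16 * / psize p ^ 2) (nonzero_box n)).
{ apply list_sum_R_le. intros p Hp. apply in_nonzero_box, alpha_psize in Hp.
  pose proof (psize_pos p).
  replace (16 * / psize p ^ 2) with (/ (psize p / 4) ^ 2) by (field; lra).
  apply Rinv_le_contravar; [apply pow_lt; lra|apply pow_incr; lra]. }
rewrite list_sum_R_scal.
apply Rle_trans with (16 * list_sum_R (fun p => / psize p ^ 2) (list_prod (zbox n) (zbox n))).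
{ apply Rmult_le_compat_l; [lra|]. apply list_sum_R_filter_le.
  intros p. apply Rlt_le, Rinv_0_lt_compat, pow_lt, psize_pos. }
replace (128 * (1 + ln (1 + INR n))) with (16 * (2 * (4 * (1 + ln (1 + INR n))))) by ring.
apply Rmult_le_compat_l; [lra|]. rewrite list_sum_R_prod.
apply Rle_trans with (list_sum_R (fun a => 4 * / (1 + IZR (Z.abs a))) (zbox n)).
- apply list_sum_R_le. intros a _. unfold psize; cbn [fst snd].
  assert (Ha : 0 <= IZR (Z.abs a)) by (apply IZR_le; lia).
  rewrite (list_sum_zbox (fun x => / (1 + IZR (Z.abs a) + x) ^ 2)).
  rewrite (list_sum_R_ext _ (fun i => / (INR i + (1 + IZR (Z.abs a))) ^ 2))
    by (intros i _; do 2 f_equal; ring).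
  pose proof (sum_inv_sq_from_le (1 + IZR (Z.abs a)) (S n)). unfold Rdiv in H. lra.
- rewrite list_sum_R_scal, (list_sum_zbox (fun x => / (1 + x))).
  pose proof (harmonic_le n). lra.
Qed.

(** The shortest vector varies with w, so 1/l^2 is replaced by the sum over all nonzero vectors of a
    fixed box. The sums are then exchanged, and for each alpha the circle average of |conj(alpha) -
    w alpha|^(-2) is a Poisson-kernel average. *)
Lemma Gf_circle_average : exists B, 0 <= B /\ forall M H, 2 <= M -> (1 <= H)%nat ->
  (1 - / M) ^ H <= / 3 ->
  list_sum_R (fun j => Cmod (Gf ((1 - / M)%R * root_unity H ^ j)) ^ 2) (seq 0 H)
  <= INR H * (B * (M * (10 + ln M))).
Proof.
destruct Gf_bound as (B & HB0 & HB). exists (B ^ 2 * 256). split; [nra|].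
intros M H HM HH HrH. set (r := 1 - / M) in *.
assert (HiM : 0 < / M <= / 2).
{ split; [apply Rinv_0_lt_compat; lra|apply Rinv_le_contravar; lra]. }
assert (Hr : / 2 <= r < 1) by (unfold r; lra).
(* From |T|^2 <= 4 / M and |alpha| <= M |T|, where T is the short vector, follows |alpha|^2 <= 4 M,
   so psize <= 8 M. This generous box enters only through its logarithm. *)
destruct (archimed (8 * M)) as [Hup1 Hup2]. set (n := Z.to_nat (up (8 * M))).
assert (Hn : INR n = IZR (up (8 * M))).
{ unfold n. rewrite INR_IZR_INZ, Z2Nat.id; [easy|]. apply le_IZR. lra. }
assert (HwM : forall j, Cmod (r * root_unity H ^ j) = r).
{ intros j. rewrite Cmod_mult, Cmod_pow, Cmod_root_unity, pow1, Cmod_R, Rabs_right; lra. }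
assert (Hpt : forall j, Cmod (Gf (r * root_unity H ^ j)) ^ 2
   <= B ^ 2 * list_sum_R (fun p => / Cmod (latT (r * root_unity H ^ j) p) ^ 2) (nonzero_box n)).
{ intros j. set (w := (r * root_unity H ^ j)%C).
  assert (Hw : Cmod w = r) by apply HwM.
  destruct (HB w ltac:(lra)) as (b & Hb & Hs & HG). rewrite Hw in Hs.
  assert (HTp : 0 < Cmod (latT w b)) by (apply Cmod_gt_0, latT_neq_0; [lra|easy]).
  apply Rle_trans with ((B / Cmod (latT w b)) ^ 2).
  { apply pow_incr. split; [apply Cmod_ge_0|easy]. }
  unfold Rdiv. rewrite Rpow_mult_distr. apply Rmult_le_compat_l; [nra|]. rewrite pow_inv.
  replace (/ Cmod (latT w b) ^ 2) with (list_sum_R (fun p => / Cmod (latT w p) ^ 2) [b]) by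
    (simpl; ring).
  apply list_sum_R_incl.
  - intros p. assert (0 <= Cmod (latT w p) ^ 2) by apply pow2_ge_0.
    destruct (Req_dec (Cmod (latT w p) ^ 2) 0) as [->|]; [rewrite Rinv_0; lra|].
    apply Rlt_le, Rinv_0_lt_compat. lra.
  - constructor; [easy|constructor].
  - intros p [<-|[]]. apply filter_In. split.
    + pose proof (latT_lower w b) as HL. rewrite Hw in HL. pose proof (alpha_psize b Hb) as HS.
      pose proof (psize_pos b) as HP.
      assert (HiMr : 1 - r = / M) by (unfold r; ring). rewrite HiMr in HL.
      assert (HA : Cmod (alpha b) <= M * Cmod (latT w b)).
      { apply (Rmult_le_compat_l M) in HL; [|lra]. rewrite <- Rmult_assoc, Rinv_r, Rmult_1_l in
        HL by lra. easy. }
      assert (Hs2 : Cmod (latT w b) ^ 2 <= 4 * / M) by (assert (1 - r ^ 2 <= 2 * / M) by (rewrite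
        <- HiMr; nra); lra).
      assert (HA2 : Cmod (alpha b) ^ 2 <= 4 * M).
      { apply Rle_trans with ((M * Cmod (latT w b)) ^ 2).
        - apply pow_incr. split; [apply Cmod_ge_0|easy].
        - rewrite Rpow_mult_distr. replace (4 * M) with (M ^ 2 * (4 * / M)) by (field; lra).
          apply Rmult_le_compat_l; [nra|easy]. }
      assert (HP8 : psize b <= 8 * M).
      { assert (Cmod (alpha b) <= 2 * M) by (pose proof (Cmod_ge_0 (alpha b)); nra). lra. }
      assert (Hlt : psize b < IZR (up (8 * M))) by lra. unfold psize in Hlt.
      rewrite <- !plus_IZR in Hlt. apply lt_IZR in Hlt. destruct b as [x y]; cbn [fst snd] in *.
      apply in_prod; apply in_zbox; unfold n; lia.
    + destruct b as [x y]; cbn [fst snd].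
      destruct (Z.eqb_spec x 0), (Z.eqb_spec y 0); subst; easy. }
apply Rle_trans with (list_sum_R (fun j => B ^ 2 * list_sum_R (fun p =>
   / Cmod (latT (r * root_unity H ^ j) p) ^ 2) (nonzero_box n)) (seq 0 H)).
{ apply list_sum_R_le. intros j _. apply Hpt. }
rewrite list_sum_R_scal, list_sum_R_exchange.
assert (Hin : list_sum_R (fun p => list_sum_R (fun j => / Cmod (latT (r * root_unity H ^ j) p) ^
  2) (seq 0 H)) (nonzero_box n)
  <= 2 * INR H / (1 - r ^ 2) * list_sum_R (fun p => / Cmod (alpha p) ^ 2) (nonzero_box n)).
{ rewrite <- list_sum_R_scal. apply list_sum_R_le. intros p Hp. apply in_nonzero_box in Hp.
  assert (Ha := alpha_neq_0 p Hp). assert (Hc := Cconj_neq_0 _ Ha).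
  assert (Ha0 : 0 < Cmod (alpha p)) by now apply Cmod_gt_0.
  set (z := (r * (alpha p * / Cconj (alpha p)))%C).
  assert (Hz : Cmod z = r).
  { unfold z. rewrite Cmod_mult, Cmod_ratio_1, Cmod_R, Rabs_right by (easy || lra). ring. }
  rewrite (list_sum_R_ext _ (fun j => / Cmod (alpha p) ^ 2 * / Cmod (1 - z * root_unity H ^ j) ^
    2)).
  - rewrite list_sum_R_scal, Rmult_comm.
    apply Rmult_le_compat_r; [apply Rlt_le, Rinv_0_lt_compat, pow_lt, Ha0|].
    rewrite <- Hz. apply circle_average_le; [easy|lra|now rewrite Hz].
  - intros j _. rewrite <- Rinv_mult, <- Rpow_mult_distr. do 2 f_equal.
    rewrite <- (Cmod_conj (alpha p)), <- Cmod_mult. f_equal. unfold latT, z. field. easy. }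
pose proof (sum_inv_norm_le n) as HS.
assert (HiM2 : 1 - r ^ 2 >= / M).
{ replace (/ M) with (1 - r) by (unfold r; ring). nra. }
assert (HI : 0 <= INR H) by apply pos_INR.
assert (Hq : 2 * INR H / (1 - r ^ 2) <= 2 * INR H * M).
{ unfold Rdiv. apply Rmult_le_compat_l; [lra|]. rewrite <- (Rinv_inv M).
  apply Rinv_le_contravar; lra. }
assert (Hln : 1 + ln (1 + INR n) <= 10 + ln M).
{ assert (H10 : ln (1 + INR n) <= ln (10 * M)) by (apply ln_le; [pose proof (pos_INR n);
  lra|rewrite Hn; lra]).
  rewrite ln_mult in H10 by lra.
  assert (ln 10 <= 9). { pose proof (exp_ineq1_le (ln 10)). rewrite exp_ln in H0; lra. }
  lra. }
assert (HS0 : 0 <= list_sum_R (fun p => / Cmod (alpha p) ^ 2) (nonzero_box n)).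
{ apply list_sum_R_pos. intros p Hp. apply Rlt_le, Rinv_0_lt_compat, pow_lt, Cmod_gt_0, alpha_neq_0.
  now apply in_nonzero_box in Hp. }
assert (HF : list_sum_R (fun p => list_sum_R (fun j => / Cmod (latT (r * root_unity H ^ j) p) ^
  2) (seq 0 H)) (nonzero_box n)
   <= 2 * INR H * M * (128 * (10 + ln M))).
{ eapply Rle_trans; [exact Hin|]. apply Rmult_le_compat; [|easy|easy|lra].
  apply Rmult_le_pos; [lra|]. apply Rlt_le, Rinv_0_lt_compat. lra. }
apply (Rmult_le_compat_l (B ^ 2)) in HF; [|nra].
replace (INR H * (B ^ 2 * 256 * (M * (10 + ln M)))) with (B ^ 2 * (2 * INR H * M * (128 * (10 +
  ln M)))) by ring.
exact HF.
Qed.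

Lemma second_moment : exists B, 0 <= B /\ forall M H, 2 <= M ->
  list_sum_R (fun h => (Cmod (coef h) * (1 - / M) ^ h) ^ 2) (seq 0 H) <= B * (M * (10 + ln M)).
Proof.
destruct Gf_circle_average as (B & HB0 & HB). exists (2 * B + 2). split; [lra|]. intros M H0 HM.
set (r := 1 - / M).
assert (HiM : 0 < / M <= / 2).
{ split; [apply Rinv_0_lt_compat; lra|apply Rinv_le_contravar; lra]. }
assert (Hr : / 2 <= r < 1) by (unfold r; lra).
destruct (Gf_partial_sum r) as (c & Hc & HG); [lra|].
assert (He : 0 < Rmin (/ 3) (/ (c + 1))).
{ apply Rmin_glb_lt; [lra|apply Rinv_0_lt_compat; lra]. }
destruct (sqr_pow_small r _ ltac:(lra) He) as (H1 & Hsm).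
(* The terms are nonnegative, so the range may be enlarged until the remainder is at most 1; then
   |P| <= |G| + 1 gives |P|^2 <= 2 |G|^2 + 2. *)
set (H := (1 + H0 + H1)%nat). specialize (Hsm H ltac:(unfold H; lia)).
assert (HrH : 0 < r ^ H) by (apply pow_lt; lra).
assert (HI : 0 <= INR H) by apply pos_INR.
assert (Hr3 : r ^ H <= / 3).
{ pose proof (Rmin_l (/ 3) (/ (c + 1))). assert (1 <= (1 + INR H) ^ 2) by nra. nra. }
assert (Herr : c * ((1 + INR H) ^ 2 * r ^ H) <= 1).
{ pose proof (Rmin_r (/ 3) (/ (c + 1))).
  apply Rle_trans with ((c + 1) * / (c + 1)); [|rewrite Rinv_r; lra].
  apply Rmult_le_compat; [easy| |lra|lra]. apply Rmult_le_pos; [apply pow2_ge_0|lra]. }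
assert (HH1 : (1 <= H)%nat) by (unfold H; lia).
specialize (HB M H HM HH1 Hr3). fold r in HB.
pose proof (discrete_parseval (fun h => coef h * r ^ h)%C H HH1) as HP.
assert (Hinc : list_sum_R (fun h => (Cmod (coef h) * r ^ h) ^ 2) (seq 0 H0)
   <= list_sum_R (fun h => (Cmod (coef h) * r ^ h) ^ 2) (seq 0 H)).
{ apply list_sum_R_incl; [intros; apply pow2_ge_0|apply seq_NoDup|].
  intros i Hi. apply in_seq in Hi. apply in_seq. unfold H. lia. }
eapply Rle_trans; [exact Hinc|].
rewrite (list_sum_R_ext (fun h => Cmod (coef h * r ^ h) ^ 2) (fun h => (Cmod (coef h) * r ^ h) ^
  2)) in HP.
2:{ intros h _. rewrite Cmod_mult, Cmod_pow, Cmod_R, Rabs_right by lra. easy. }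
set (S2 := list_sum_R (fun h => (Cmod (coef h) * r ^ h) ^ 2) (seq 0 H)) in *.
assert (Hle : INR H * S2 <= list_sum_R (fun j => 2 * Cmod (Gf (r * root_unity H ^ j)) ^ 2 + 2)
  (seq 0 H)).
{ rewrite <- HP. apply list_sum_R_le. intros j _.
  set (w := (r * root_unity H ^ j)%C).
  assert (Hw : Cmod w <= r).
  { unfold w. rewrite Cmod_mult, Cmod_pow, Cmod_root_unity, pow1, Cmod_R, Rabs_right; lra. }
  rewrite (list_sum_C_ext _ (fun h => coef h * w ^ h)%C).
  2:{ intros h _. unfold w. rewrite Cpow_mult_l. ring. }
  specialize (HG w H Hw). set (P := list_sum_C _ _) in *.
  assert (Cmod P <= Cmod (Gf w) + 1).
  { replace P with (Gf w + - (Gf w - P))%C by ring. eapply Rle_trans; [apply Cmod_triangle|].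
    rewrite Cmod_opp. lra. }
  pose proof (Cmod_ge_0 P). pose proof (Cmod_ge_0 (Gf w)).
  assert (Cmod P ^ 2 <= (Cmod (Gf w) + 1) ^ 2) by (apply pow_incr; lra).
  pose proof (pow2_ge_0 (Cmod (Gf w) - 1)). nra. }
rewrite list_sum_R_plus, list_sum_R_scal, list_sum_R_const, length_seq in Hle.
assert (HI1 : 1 <= INR H) by (apply le_INR in HH1; easy).
assert (Hln : 0 <= ln M) by (rewrite <- ln_1; apply ln_le; lra).
assert (1 <= M * (10 + ln M)) by nra.
apply (Rmult_le_reg_l (INR H)); [lra|].
replace (INR H * ((2 * B + 2) * (M * (10 + ln M))))
  with (2 * (INR H * (B * (M * (10 + ln M)))) + 2 * INR H * (M * (10 + ln M))) by ring.
assert (2 * INR H * 1 <= 2 * INR H * (M * (10 + ln M))) by (apply Rmult_le_compat_l; lra).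
lra.
Qed.

(** * Counting nonzero coefficients *)

Lemma even_part_sum (c : nat -> C) (r : R) n :
  (list_sum_C (fun h => c h * r ^ h) (seq 0 (2 * n)) + list_sum_C (fun h => c h * (- r)%R ^ h)
    (seq 0 (2 * n))
   = 2 * list_sum_C (fun i => c (2 * i)%nat * r ^ (2 * i)) (seq 0 n))%C.
Proof.
induction n as [|n IH]; [simpl; ring|].
replace (2 * S n)%nat with (S (S (2 * n))) by lia.
rewrite !seq_S, !list_sum_C_app. cbn [list_sum_C fold_right Nat.add].
assert (E : ((- r)%R ^ (2 * n) = r ^ (2 * n))%C).
{ rewrite !Cpow_mult_r. f_equal. rewrite RtoC_opp. simpl. ring. }
rewrite !Cpow_S, E, RtoC_opp.
transitivity (list_sum_C (fun h => c h * r ^ h) (seq 0 (2 * n)) + list_sum_C (fun h => c h * (-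
  r)%R ^ h) (seq 0 (2 * n))
   + 2 * (c (2 * n)%nat * r ^ (2 * n)))%C; [rewrite RtoC_opp; ring|].
rewrite IH. ring.
Qed.

(** The even part is (G(r) + G(-r)) / 2, bounded below by (M - 2112 - 1/2 - 1/2) / 2, where the
    halves are the truncation errors. *)
Lemma first_moment : exists M0, 10 <= M0 /\ forall M, M0 <= M -> exists n0, forall n, (n0 <=
  n)%nat ->
  (M - 2113) / 2 <= list_sum_R (fun i => Cmod (coef (2 * i)) * (1 - / M) ^ (2 * i)) (seq 0 n).
Proof.
destruct Gf_pos_lower as (r0 & Hr0 & HG).
assert (Hi0 : 0 < / (1 - r0)) by (apply Rinv_0_lt_compat; lra).
exists (10 + / (1 - r0)). split; [lra|]. intros M HM. set (r := 1 - / M).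
assert (HiM : 0 < / M <= / 10).
{ split; [apply Rinv_0_lt_compat; lra|apply Rinv_le_contravar; lra]. }
assert (Hr : 9 / 10 <= r < 1) by (unfold r; lra).
assert (Hrr0 : r0 <= r).
{ unfold r. assert (/ M <= / / (1 - r0)) by (apply Rinv_le_contravar; lra).
  rewrite Rinv_inv in H. lra. }
destruct (Gf_partial_sum r) as (c & Hc & HP); [lra|].
destruct (sqr_pow_small r (/ (2 * (c + 1)))) as (H0 & Hsm); [lra|apply Rinv_0_lt_compat; lra|].
exists H0. intros n Hn. specialize (Hsm (2 * n)%nat ltac:(lia)).
set (e := (1 + INR (2 * n)) ^ 2 * r ^ (2 * n)) in *.
assert (He0 : 0 <= e) by (apply Rmult_le_pos; [apply pow2_ge_0|apply pow_le; lra]).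
assert (Herr : c * e <= / 2).
{ apply Rle_trans with ((c + 1) * / (2 * (c + 1))).
  - apply Rmult_le_compat; lra.
  - right. field. lra. }
assert (P1 := HP r (2 * n)%nat ltac:(rewrite Cmod_R, Rabs_right; lra)).
assert (P2 := HP (- r)%R (2 * n)%nat ltac:(rewrite Cmod_R, Rabs_Ropp, Rabs_right; lra)).
fold e in P1, P2.
assert (G1 := HG r ltac:(lra)). assert (G2 := Gf_neg_lower r Hr).
replace (1 / (1 - r)) with M in G1 by (unfold r; field; lra).
set (s1 := list_sum_C (fun h => coef h * r ^ h)%C (seq 0 (2 * n))) in *.
set (s2 := list_sum_C (fun h => coef h * (- r)%R ^ h)%C (seq 0 (2 * n))) in *.
set (T := list_sum_R _ _).
assert (HS : Cmod (s1 + s2) <= 2 * T).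
{ unfold s1, s2. rewrite even_part_sum, Cmod_2. apply Rmult_le_compat_l; [lra|].
  eapply Rle_trans; [apply Cmod_list_sum|]. right. apply list_sum_R_ext. intros i _.
  rewrite Cmod_mult, Cmod_pow, Cmod_R, Rabs_right by lra. easy. }
pose proof (re_le_Cmod (Gf r - s1)) as R1. pose proof (re_le_Cmod (Gf (- r)%R - s2)) as R2.
pose proof (re_le_Cmod (s1 + s2)) as R3.
apply Rabs_le_between in R1, R2, R3.
replace (Re (Gf r - s1)%C) with (Re (Gf r) - Re s1) in R1 by (unfold Re; simpl; ring).
replace (Re (Gf (- r)%R - s2)%C) with (Re (Gf (- r)%R) - Re s2) in R2 by (unfold Re; simpl; ring).
rewrite Re_plus in R3. lra.
Qed.

Definition nonzero_index (i : nat) : bool :=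
  if excluded_middle_informative (coef (2 * i) = RtoC 0) then false else true.

Lemma even_second_moment (u : nat -> R) n :
  list_sum_R (fun i => u (2 * i)%nat ^ 2) (seq 0 n) <= list_sum_R (fun h => u h ^ 2) (seq 0 (2 *
    n)).
Proof.
rewrite <- (list_sum_R_map (fun i => 2 * i)%nat (fun h => u h ^ 2)).
apply list_sum_R_incl.
- intros; apply pow2_ge_0.
- apply FinFun.Injective_map_NoDup; [|apply seq_NoDup]. intros i j E; lia.
- intros h Hh. apply in_map_iff in Hh as (i & <- & Hi). apply in_seq in Hi. apply in_seq. lia.
Qed.

Lemma head_le B M N :
  (forall H, list_sum_R (fun h => (Cmod (coef h) * (1 - / M) ^ h) ^ 2) (seq 0 H) <= B) ->
  list_sum_R (fun i => Cmod (coef (2 * i)) * (1 - / M) ^ (2 * i)) (seq 0 N) ^ 2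
  <= B * INR (length (filter nonzero_index (seq 0 N))).
Proof.
intros HB. set (u := fun h => Cmod (coef h) * (1 - / M) ^ h).
change (list_sum_R (fun i => u (2 * i)%nat) (seq 0 N) ^ 2 <= B * INR (length (filter
  nonzero_index (seq 0 N)))).
set (L := filter nonzero_index (seq 0 N)).
assert (E : list_sum_R (fun i => u (2 * i)%nat) (seq 0 N) = list_sum_R (fun i => u (2 * i)%nat *
  1) L).
{ unfold L. induction (seq 0 N) as [|i F IH]; [easy|]. cbn [list_sum_R fold_right filter].
  change (fold_right _ _ F) with (list_sum_R (fun i => u (2 * i)%nat) F). rewrite IH.
  unfold nonzero_index at 2. destruct (excluded_middle_informative _) as [Hz|Hz].
  - assert (Eu : u (2 * i)%nat = 0) by (unfold u; rewrite Hz, Cmod_0; ring). rewrite Eu. apply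
    Rplus_0_l.
  - cbn [list_sum_R fold_right]. change (fold_right _ _ (filter nonzero_index F)) with
     (list_sum_R (fun i => u (2 * i)%nat * 1) (filter nonzero_index F)). ring. }
rewrite E. eapply Rle_trans; [apply list_sum_R_Cauchy_Schwarz|].
rewrite (list_sum_R_ext (fun _ => 1 ^ 2) (fun _ => 1)) by (intros; ring).
rewrite list_sum_R_const, Rmult_1_l. apply Rmult_le_compat_r; [apply pos_INR|].
eapply Rle_trans; [|apply (HB (2 * N)%nat)].
eapply Rle_trans; [|apply (even_second_moment u N)].
apply list_sum_R_filter_le. intros; apply pow2_ge_0.
Qed.

Lemma geometric_tail_le q N n : 0 < q < 1 -> list_sum_R (fun i => q ^ i) (seq N n) <= q ^ N / (1
  - q).
Proof.
intros Hq.
assert (H : (1 - q) * list_sum_R (fun i => q ^ i) (seq N n) = q ^ N - q ^ (N + n)).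
{ induction n as [|n IH]; [simpl; rewrite Nat.add_0_r; ring|].
  rewrite seq_S, list_sum_R_app, Rmult_plus_distr_l, IH. cbn [list_sum_R fold_right].
  replace (N + S n)%nat with (S (N + n)) by lia. simpl. ring. }
apply (Rmult_le_reg_l (1 - q)); [lra|]. rewrite H.
replace ((1 - q) * (q ^ N / (1 - q))) with (q ^ N) by (field; lra).
assert (0 < q ^ (N + n)) by (apply pow_lt; lra). lra.
Qed.

Lemma one_minus_pow_le x n : 0 <= x <= 1 -> (1 - x) ^ n <= exp (- (INR n * x)).
Proof.
intros Hx. replace (- (INR n * x)) with (INR n * (- x)) by ring.
assert (E : exp (INR n * - x) = exp (- x) ^ n).
{ induction n as [|n IH]; [simpl; rewrite Rmult_0_l; apply exp_0|].
  rewrite S_INR, Rmult_plus_distr_r, Rmult_1_l, exp_plus, IH. simpl; ring. }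
rewrite E. apply pow_incr. pose proof (exp_ineq1_le (- x)). lra.
Qed.

(** Since 1 - 1/M <= q^2 with q = 1 - 1/(2M), the weight splits into q^(2i), used in the second
    moment at scale 2M, and another q^(2i), whose square sums geometrically from N on. *)
Lemma tail_sum_le B M N n : 2 <= M ->
  (forall H, list_sum_R (fun h => (Cmod (coef h) * (1 - / (2 * M)) ^ h) ^ 2) (seq 0 H) <= B) ->
  list_sum_R (fun i => Cmod (coef (2 * i)) * (1 - / M) ^ (2 * i)) (seq N n) ^ 2
  <= B * (2 * M * exp (- (2 * (INR N / M)))).
Proof.
intros HM HB. set (q := 1 - / (2 * M)).
assert (HiM : 0 < / M <= / 2).
{ split; [apply Rinv_0_lt_compat; lra|apply Rinv_le_contravar; lra]. }
assert (Hi2 : / (2 * M) = / M / 2) by (field; lra).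
assert (Hq : 3 / 4 <= q < 1) by (unfold q; lra).
set (u := fun h => Cmod (coef h) * q ^ h).
assert (H1 : list_sum_R (fun i => Cmod (coef (2 * i)) * (1 - / M) ^ (2 * i)) (seq N n)
  <= list_sum_R (fun i => u (2 * i)%nat * (q ^ 2) ^ i) (seq N n)).
{ apply list_sum_R_le. intros i _. unfold u. rewrite Rmult_assoc.
  apply Rmult_le_compat_l; [apply Cmod_ge_0|]. rewrite <- !pow_mult, <- pow_add.
  replace (2 * i + 2 * i)%nat with (2 * (2 * i))%nat by lia. rewrite (pow_mult q 2).
  apply pow_incr. split; [lra|]. unfold q. rewrite Hi2. nra. }
assert (H0 : 0 <= list_sum_R (fun i => Cmod (coef (2 * i)) * (1 - / M) ^ (2 * i)) (seq N n)).
{ apply list_sum_R_pos. intros i _. apply Rmult_le_pos; [apply Cmod_ge_0|apply pow_le; lra]. }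
eapply Rle_trans; [apply pow_incr; split; [exact H0|exact H1]|].
eapply Rle_trans; [apply list_sum_R_Cauchy_Schwarz|].
apply Rmult_le_compat.
- apply list_sum_R_pos; intros; apply pow2_ge_0.
- apply list_sum_R_pos; intros; apply pow2_ge_0.
- eapply Rle_trans; [|apply (HB (2 * (N + n))%nat)].
  eapply Rle_trans; [|apply (even_second_moment u (N + n))].
  apply list_sum_R_incl; [intros; apply pow2_ge_0|apply seq_NoDup|].
  intros i Hi. apply in_seq in Hi. apply in_seq. lia.
- rewrite (list_sum_R_ext _ (fun i => (q ^ 4) ^ i)).
  2:{ intros i _. rewrite <- !pow_mult. f_equal. lia. }
  assert (Hq2 : 0 < q ^ 2 <= q) by nra.
  assert (Hq4 : 0 < q ^ 4 <= q).
  { replace (q ^ 4) with (q ^ 2 * q ^ 2) by ring. nra. }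
  eapply Rle_trans; [apply geometric_tail_le; lra|].
  rewrite <- pow_mult.
  assert (Hpow : q ^ (4 * N) <= exp (- (2 * (INR N / M)))).
  { unfold q. eapply Rle_trans; [apply one_minus_pow_le; lra|]. apply exp_le.
    rewrite mult_INR. simpl (INR 4). right. field. lra. }
  assert (Hd : / (1 - q ^ 4) <= 2 * M).
  { rewrite <- (Rinv_inv (2 * M)). apply Rinv_le_contravar; [lra|].
    replace (/ (2 * M)) with (1 - q) by (unfold q; ring). lra. }
  unfold Rdiv. rewrite Rmult_comm. apply Rmult_le_compat; [|apply pow_le; lra|easy|easy].
  apply Rlt_le, Rinv_0_lt_compat. lra.
Qed.

(** With y = sqrt(log N) and M = N / y, the first moment minus the tail leaves at least M/4 for the
    indices below N. Cauchy-Schwarz gives a count of order M / log N, and the spare factor y absorbs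
    the constants. *)
Lemma nonvanishing_count : exists y0, 1 <= y0 /\ forall N, (1 <= N)%nat -> y0 ^ 2 <= ln (INR N) ->
  INR N / ln (INR N) ^ 2 <= INR (length (filter nonzero_index (seq 0 N))).
Proof.
destruct first_moment as (M0 & HM0 & HF). destruct second_moment as (B & HB0 & HB).
(* 10000 turns (M - 2113)/2 - M/8 into at least M/4, [M0] is the threshold of the first moment, and
   3000 (B + 1) exceeds the factors 2048 B and 32 (B + 1) met below; all use M >= y. *)
exists (10000 + M0 + 3000 * (B + 1)). split; [lra|]. intros N HN HL.
set (L := ln (INR N)) in *. set (y := sqrt L).
assert (HN1 : 1 <= INR N) by (apply le_INR in HN; easy).
assert (HL0 : 0 <= L) by (unfold L; rewrite <- ln_1; apply ln_le; lra).
assert (Hyy : y * y = L) by (apply sqrt_sqrt; easy).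
assert (Hy : 10000 + M0 + 3000 * (B + 1) <= y).
{ unfold y. rewrite <- (sqrt_pow2 (10000 + M0 + 3000 * (B + 1))) by lra. now apply sqrt_le_1_alt. }
set (M := INR N / y).
assert (HNy : INR N = M * y) by (unfold M; field; lra).
assert (HMN : M <= INR N).
{ apply (Rmult_le_reg_r y); [lra|]. rewrite <- HNy. nra. }
assert (HMy : y <= M).
{ apply (Rmult_le_reg_r y); [lra|]. rewrite <- HNy.
  assert (E : INR N = exp L) by (unfold L; now rewrite exp_ln by lra).
  rewrite E. pose proof (exp_ineq1_le L). lra. }
assert (HlnM : ln M <= L) by (apply ln_le; lra).
assert (HM2 : 2 <= M) by lra.
destruct (HF M ltac:(lra)) as (n0 & Hn0). specialize (Hn0 (N + n0)%nat ltac:(lia)).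
rewrite seq_app, list_sum_R_app in Hn0. cbn [Nat.add] in Hn0.
assert (HL10 : 100 <= L) by nra.
assert (Hln2 : ln (2 * M) <= 1 + L).
{ rewrite ln_mult by lra. pose proof (exp_ineq1_le (ln 2)). rewrite exp_ln in H by lra. lra. }
assert (Hhead := head_le (B * (M * (10 + ln M))) M N (fun H => HB M H HM2)).
assert (Htail := tail_sum_le (B * (2 * M * (10 + ln (2 * M)))) M N n0 HM2
   (fun H => HB (2 * M) H ltac:(lra))).
set (hd := list_sum_R _ (seq 0 N)) in *. set (tl := list_sum_R _ (seq N n0)) in *.
set (A := INR (length (filter nonzero_index (seq 0 N)))) in *.
assert (HA0 : 0 <= A) by apply pos_INR.
(* exp(2y) >= (2y/3)^3 >= y^3 / 4: three powers of y beat the y^2 = log N of the second moment. *)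
assert (Hexp : exp (- (2 * (INR N / M))) <= / (y * y * y / 4)).
{ replace (INR N / M) with y by (unfold M; field; lra).
  rewrite exp_Ropp. apply Rinv_le_contravar; [nra|].
  replace (2 * y) with (2 * y / 3 + 2 * y / 3 + 2 * y / 3) by field. rewrite !exp_plus.
  pose proof (exp_ineq1_le (2 * y / 3)) as H1. set (E := exp (2 * y / 3)) in *.
  assert (H2 : 2 * y / 3 <= E) by lra.
  assert (2 * y / 3 * (2 * y / 3) * (2 * y / 3) <= E * E * E).
  { apply Rmult_le_compat; [nra|lra| |lra]. apply Rmult_le_compat; lra. }
  assert (0 < y * y * y) by (apply Rmult_lt_0_compat; nra). lra. }
assert (Htl : tl <= M / 8).
{ apply Rsqr_incr_0_var; [|lra]. unfold Rsqr. replace (tl * tl) with (tl ^ 2) by ring.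
  eapply Rle_trans; [exact Htail|].
  apply Rle_trans with (B * (2 * M * (2 * L)) * (2 * M * / (y * y * y / 4))).
  - apply Rmult_le_compat.
    + apply Rmult_le_pos; [easy|]. apply Rmult_le_pos; [lra|].
      assert (0 <= ln (2 * M)) by (rewrite <- ln_1; apply ln_le; lra). lra.
    + apply Rmult_le_pos; [lra|apply Rlt_le, exp_pos].
    + apply Rmult_le_compat_l; [easy|]. apply Rmult_le_compat_l; lra.
    + apply Rmult_le_compat_l; [lra|easy].
  - rewrite <- Hyy.
    replace (B * (2 * M * (2 * (y * y))) * (2 * M * / (y * y * y / 4))) with (M ^ 2 * (32 * B /
      y)) by (field; lra).
    replace (M / 8 * (M / 8)) with (M ^ 2 * / 64) by field.
    apply Rmult_le_compat_l; [apply pow2_ge_0|].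
    apply (Rmult_le_reg_r y); [lra|]. unfold Rdiv. rewrite Rmult_assoc, Rinv_l by lra. lra. }
assert (Hhd : M / 4 <= hd) by lra.
assert (HhdA : (M / 4) ^ 2 <= B * (M * (10 + ln M)) * A).
{ eapply Rle_trans; [|exact Hhead]. apply pow_incr. lra. }
assert (HA : M <= 32 * (B + 1) * L * A).
{ apply (Rmult_le_reg_l M); [lra|].
  apply Rle_trans with (16 * (B * (M * (10 + ln M)) * A)); [lra|].
  replace (M * (32 * (B + 1) * L * A)) with (16 * ((B + 1) * (M * (2 * L)) * A)) by ring.
  apply Rmult_le_compat_l; [lra|]. apply Rmult_le_compat_r; [easy|].
  assert (Hln0 : 0 <= ln M) by (rewrite <- ln_1; apply ln_le; lra).
  apply Rmult_le_compat; [easy| |lra|].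
  - apply Rmult_le_pos; lra.
  - apply Rmult_le_compat_l; lra. }
apply (Rmult_le_reg_r (L ^ 2)); [nra|].
replace (INR N / L ^ 2 * L ^ 2) with (INR N) by (field; lra).
(* N = M y <= 32 (B + 1) L A y, and 32 (B + 1) y <= y^2 = L. *)
rewrite HNy. apply Rle_trans with (32 * (B + 1) * L * A * y).
- apply Rmult_le_compat_r; lra.
- replace (32 * (B + 1) * L * A * y) with (L * A * (32 * (B + 1) * y)) by ring.
  replace (A * L ^ 2) with (L * A * L) by ring.
  apply Rmult_le_compat_l; [apply Rmult_le_pos; lra|]. rewrite <- Hyy.
  apply Rmult_le_compat_r; lra.
Qed.

Local Close Scope R_scope.

Theorem corollary2p5 :
  exists N0 : nat, forall N : nat, (N0 <= N)%nat ->
    exists l : list nat,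
      NoDup l /\
      (forall n : nat, In n l -> (1 <= n <= N)%nat /\ L_central_nonzero n) /\
      (INR N / (ln (INR N)) ^ 2 <= INR (length l))%R.
Proof.
destruct nonvanishing_count as (y0 & Hy0 & H).
destruct (archimed (exp (y0 ^ 2))) as [Hup _].
(* Beyond this bound log N >= y0^2. *)
exists (S (Z.to_nat (up (exp (y0 ^ 2))))). intros N HN.
(* The index i stands for n = i + 1, whose central value is half of [coef (2 * i)]. *)
exists (map S (filter nonzero_index (seq 0 N))). split; [|split].
- apply FinFun.Injective_map_NoDup; [|apply NoDup_filter, seq_NoDup].
  intros i j E. now inversion E.
- intros n Hn. apply in_map_iff in Hn as (i & <- & Hi).
  apply filter_In in Hi as [Hi Hc]. apply in_seq in Hi. split; [lia|].
  apply L_central_nonzero_coef; [lia|].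
  replace (2 * S i - 2)%nat with (2 * i)%nat by lia.
  unfold nonzero_index in Hc. destruct (excluded_middle_informative _) as [E|E]; [easy|exact E].
- rewrite length_map. apply H; [lia|].
  rewrite <- (ln_exp (y0 ^ 2)). apply ln_le; [apply exp_pos|].
  apply Rle_trans with (IZR (up (exp (y0 ^ 2)))); [lra|].
  rewrite INR_IZR_INZ. apply IZR_le. lia.
Qed.
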